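(* Let $(M,\mathcal{T},\Phi)$ be a weighted triangulated surface with $\chi(M)\le 0$. Then the constant $R$-curvature circle packing metric is unique (if it exists) up to scaling. Moreover, for any initial circle packing metric $r(0)\in\mathbb{R}^N_{>0}$, the following statements are mutually equivalent: (1) There exists a constant $R$-curvature circle packing metric. (2) The solution to the combinatorial Ricci flow $\frac{dg_i}{dt}=(R_{av}-R_i)g_i$ ($i\in V$) with initial metric $r(0)$ converges. (3) The solution to the combinatorial Calabi flow $\frac{dg_i}{dt}=(\Delta R)_i\, g_i$ ($i\in V$) with initial metric $r(0)$ converges. (4) The solution to the modified Calabi flow $\dot u=-\frac12\nabla_u\widetilde C$ with initial metric $r(0)$ converges. (5) There exists a circle packing metric $r^*$ such that, for every nonempty proper subset $I$ of $V$, $$2\pi\chi(M)\frac{\sum_{i\in I}(r_i^{*})^2}{\sum_{i\in V}(r_i^* )^2}>-\sum_{(e,v)\in Lk(I)}(\pi-\Phi(e))+2\pi\chi(F_I).$$ (6) If $\chi(M)<0$: $\mathscr{Y}\cap\mathbb{R}^N_{<0}\ne\emptyset$; if $\chi(M)=0$: $0\in\mathscr{Y}$.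
   Context: $M$ is a closed connected surface with a triangulation $\mathcal{T}=\{V,E,F\}$ (vertices, edges, faces), $V=\{1,\dots,N\}$, and $\Phi:E\to[0,\pi/2]$ is a weight function; the triple $(M,\mathcal{T},\Phi)$ is called a weighted triangulated surface. $\chi$ denotes Euler characteristic. Write $i\sim j$ if $\{ij\}\in E$. A circle packing metric is a map $r:V\to(0,+\infty)$, i.e. $r\in\mathbb{R}^N_{>0}$. It determines edge lengths $l_{ij}=\sqrt{r_i^2+r_j^2+2r_ir_j\cos\Phi_{ij}}$; for each face $\{ijk\}$ the lengths $l_{ij},l_{jk},l_{ik}$ satisfy the triangle inequalities, so the face is realized as a Euclidean triangle, and $\theta_i^{jk}$ denotes its inner angle at $i$. The classical discrete Gauss curvature is $K_i=2\pi-\sum_{\{ijk\}\in F}\theta_i^{jk}$ (sum over all faces containing $i$). The $R$-curvature is $R_i=K_i/r_i^2$; $r$ is a constant $R$-curvature metric if $R_i$ is the same for all $i\in V$. Put $g_i=r_i^2$, $u_i=\ln g_i=2\ln r_i$, $\|r\|^2=\sum_i r_i^2$, $R_{av}=2\pi\chi(M)/\|r\|^2$. The discrete Laplacian acts on $f:V\to\mathbb{R}$ by $(\Delta f)_i=\frac{1}{r_i^2}\sum_{j\sim i}\left(-\frac{\partial K_i}{\partial u_j}\right)(f_j-f_i)$. Put $\varphi_i=K_i-R_{av}r_i^2$ and $\widetilde C=\sum_{i=1}^N\varphi_i^2$, regarded as a function of $u=(u_1,\dots,u_N)$. A solution of a flow ''converges'' if it exists for all $t\in[0,+\infty)$ and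 $r(t)$ tends to a point of $\mathbb{R}^N_{>0}$ as $t\to+\infty$. For a nonempty proper subset $I\subset V$, $F_I$ is the subcomplex of $\mathcal{T}$ consisting of all cells whose vertices are all in $I$, and $Lk(I)$ is the set of pairs $(e,v)$ of an edge $e$ and a vertex $v$ such that the end points of $e$ are not in $I$, $v\in I$, and $e$ and $v$ form a triangle of $\mathcal{T}$. Finally $\mathscr{Y}$ is the set of all $x\in\mathbb{R}^N$ with $\sum_{i=1}^N x_i=2\pi\chi(M)$ and $\sum_{i\in I}x_i>-\sum_{(e,v)\in Lk(I)}(\pi-\Phi(e))+2\pi\chi(F_I)$ for every nonempty proper subset $I\subset V$. *)

(* Defs.v *)
From mathcomp Require Import all_boot all_order all_algebra.
From mathcomp Require Import all_classical all_reals all_analysis.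

Set Implicit Arguments.
Unset Strict Implicit.
Unset Printing Implicit Defensive.

Import Order.TTheory GRing.Theory Num.Theory.
Import numFieldNormedType.Exports.

Local Open Scope classical_set_scope.
Local Open Scope ring_scope.

(* A triangulated closed connected surface with vertex set {0, ..., N-1}, as a
   connected 2-dimensional simplicial complex in which the link of every vertex
   is a cycle (this also forces every edge to lie in exactly two faces). *)
Record triangulated_surface (N : nat) := TriangulatedSurface {
  edges : {set {set 'I_N}};
  faces : {set {set 'I_N}};
  vertex_gt0 : (0 < N)%N;
  card_edge : forall e, e \in edges -> #|e| = 2;
  card_face : forall f, f \in faces -> #|f| = 3;
  edge_of_face : forall f e : {set 'I_N},
    f \in faces -> e \subset f -> #|e| = 2 -> e \in edges;
  link_cycle : forall i : 'I_N, exists c : seq 'I_N,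
    [/\ uniq c, (2 < size c)%N,
        (forall j, ([set i; j]%SET \in edges) = (j \in c)) &
        (forall j k, ([set i; j; k]%SET \in faces) =
           (j \in c) && ((k == next c j) || (k == prev c j)))];
  surface_connected : forall i j : 'I_N,
    connect [rel a b | [set a; b]%SET \in edges] i j }.

(* Euler characteristic of the subcomplex F_I of all cells with vertices in I *)
Definition euler_sub N (T : triangulated_surface N) (I : {set 'I_N}) : int :=
  #|I|%:Z - #|[set e in edges T | e \subset I]%SET|%:Z
          + #|[set f in faces T | f \subset I]%SET|%:Z.

Definition euler N (T : triangulated_surface N) : int :=
  euler_sub T [set: 'I_N]%SET.

Definition Lk N (T : triangulated_surface N) (I : {set 'I_N}) :
    {set {set 'I_N} * 'I_N} :=
  [set p | [&& p.1 \in edges T, [disjoint p.1 & I], p.2 \in I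
             & (p.2 |: p.1)%SET \in faces T]]%SET.

Definition is_weight (R : realType) N (T : triangulated_surface N)
    (Phi : {set 'I_N} -> R) : Prop :=
  forall e, e \in edges T -> 0 <= Phi e <= pi / 2.

Definition is_metric (R : realType) N (r : 'rV[R]_N) : Prop :=
  forall i, 0 < r 0 i.

Definition edge_length (R : realType) N (Phi : {set 'I_N} -> R) (r : 'rV[R]_N)
    (i j : 'I_N) : R :=
  Num.sqrt (r 0 i ^+ 2 + r 0 j ^+ 2
            + 2 * r 0 i * r 0 j * cos (Phi [set i; j]%SET)).

(* inner angle at i of the Euclidean triangle ijk, by the law of cosines *)
Definition angle (R : realType) N (Phi : {set 'I_N} -> R) (r : 'rV[R]_N)
    (i j k : 'I_N) : R :=
  let l := edge_length Phi r in
  acos ((l i j ^+ 2 + l i k ^+ 2 - l j k ^+ 2) / (2 * l i j * l i k)).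

(* the condition j < k makes each face containing i occur exactly once *)
Definition gauss_curv (R : realType) N (T : triangulated_surface N)
    (Phi : {set 'I_N} -> R) (r : 'rV[R]_N) (i : 'I_N) : R :=
  2 * pi - \sum_(j < N) \sum_(k < N |
             (j < k)%N && ([set i; j; k]%SET \in faces T)) angle Phi r i j k.

Definition Rcurv (R : realType) N (T : triangulated_surface N)
    (Phi : {set 'I_N} -> R) (r : 'rV[R]_N) (i : 'I_N) : R :=
  gauss_curv T Phi r i / r 0 i ^+ 2.

Definition constant_Rcurv (R : realType) N (T : triangulated_surface N)
    (Phi : {set 'I_N} -> R) (r : 'rV[R]_N) : Prop :=
  forall i j, Rcurv T Phi r i = Rcurv T Phi r j.

Definition Rav (R : realType) N (T : triangulated_surface N)
    (r : 'rV[R]_N) : R :=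
  2 * pi * (euler T)%:~R / (\sum_i r 0 i ^+ 2).

Definition g_of_r (R : realType) N (r : 'rV[R]_N) : 'rV[R]_N :=
  \row_i (r 0 i ^+ 2).

Definition u_of_r (R : realType) N (r : 'rV[R]_N) : 'rV[R]_N :=
  \row_i (2 * ln (r 0 i)).

Definition r_of_u (R : realType) N (u : 'rV[R]_N) : 'rV[R]_N :=
  \row_i expR (u 0 i / 2).

Definition partial (R : realType) N (f : 'rV[R]_N -> R) (j : 'I_N)
    (u : 'rV[R]_N) : R :=
  'D_(delta_mx 0 j) f u.

Definition laplacian (R : realType) N (T : triangulated_surface N)
    (Phi : {set 'I_N} -> R) (r : 'rV[R]_N) (f : 'I_N -> R) (i : 'I_N) : R :=
  (r 0 i ^+ 2)^-1 * \sum_(j < N | [set i; j]%SET \in edges T)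
    (- partial (fun u => gauss_curv T Phi (r_of_u u) i) j (u_of_r r))
    * (f j - f i).

Definition Ctilde (R : realType) N (T : triangulated_surface N)
    (Phi : {set 'I_N} -> R) (u : 'rV[R]_N) : R :=
  let r := r_of_u u in
  \sum_i (gauss_curv T Phi r i - Rav T r * r 0 i ^+ 2) ^+ 2.

(* [r] is a solution on [0, +oo[ of the flow whose velocity, in the coordinates
   [c r], is [X r]; at time 0 the derivative is the right derivative. *)
Definition flow_solution (R : realType) N (c X : 'rV[R]_N -> 'rV[R]_N)
    (r : R -> 'rV[R]_N) : Prop :=
  [/\ forall t : R, 0 <= t -> is_metric (r t),
      forall (t : R) i, 0 < t ->
        is_derive t (1 : R) (fun s => c (r s) 0 i) (X (r t) 0 i) &
      forall i, (fun h => h^-1 * (c (r h) 0 i - c (r 0) 0 i)) @ 0^'+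
                  --> X (r 0) 0 i].

(* The velocities used below are smooth in [r], so the solution with initial
   metric [r0] is unique and may be quantified existentially. *)
Definition flow_converges (R : realType) N (c X : 'rV[R]_N -> 'rV[R]_N)
    (r0 : 'rV[R]_N) : Prop :=
  exists r : R -> 'rV[R]_N,
    [/\ r 0 = r0, flow_solution c X r &
        exists2 l : 'rV[R]_N, is_metric l & r t @[t --> +oo] --> l].

Definition ricci_velocity (R : realType) N (T : triangulated_surface N)
    (Phi : {set 'I_N} -> R) (r : 'rV[R]_N) : 'rV[R]_N :=
  \row_i ((Rav T r - Rcurv T Phi r i) * g_of_r r 0 i).

Definition calabi_velocity (R : realType) N (T : triangulated_surface N)
    (Phi : {set 'I_N} -> R) (r : 'rV[R]_N) : 'rV[R]_N :=
  \row_i (laplacian T Phi r (Rcurv T Phi r) i * g_of_r r 0 i).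

Definition modified_calabi_velocity (R : realType) N
    (T : triangulated_surface N) (Phi : {set 'I_N} -> R) (r : 'rV[R]_N) :
    'rV[R]_N :=
  \row_i (- (1 / 2) * partial (Ctilde T Phi) i (u_of_r r)).

Definition link_bound (R : realType) N (T : triangulated_surface N)
    (Phi : {set 'I_N} -> R) (I : {set 'I_N}) : R :=
  - (\sum_(p in Lk T I) (pi - Phi p.1)) + 2 * pi * (euler_sub T I)%:~R.

Definition Yset (R : realType) N (T : triangulated_surface N)
    (Phi : {set 'I_N} -> R) : set 'rV[R]_N :=
  [set x | \sum_i x 0 i = 2 * pi * (euler T)%:~R /\
     forall I : {set 'I_N}, I != finset.set0 -> I \proper [set: 'I_N]%SET ->
       \sum_(i in I) x 0 i > link_bound T Phi I].

(* Main.v *)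
(* In the coordinates u the quantities phi_i = K_i - R_av r_i^2 form the gradient
   of a function G whose Hessian is a weighted graph Laplacian: the contribution
   of K because the derivative of the angle at i with respect to u_j is symmetric
   and nonnegative, that of R_av r_i^2 because chi(M) <= 0. Hence G is convex,
   strictly so transversally to the constants, and constant R-curvature metrics
   are its critical points; this gives uniqueness.

   The three flows have the form u' = - P(u) phi with phi . P(u) phi > 0 when
   phi <> 0, and each conserves sum_i h(u_i) for an increasing h. When G has a
   critical point it is proper on the level sets of that sum, so solutions, which
   exist by Peano's theorem, stay in a compact set and converge by the Lyapunov
   argument. Conversely the limit of a convergent solution is a zero of phi.

   Counting faces by their intersection with I shows that sum_(i in I) K_i
   exceeds the link bound of I, and tends to it along a ray t v for which I is a
   lower level set of v, while sum_(i in I) R_av r_i^2 tends to 0. If all link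
   bounds are negative, which (5) and (6) imply, Abel summation over the level
   sets of v shows that G increases along every nonconstant ray, so G has a
   minimum. *)
Require Import Defs.
From mathcomp Require Import all_boot all_order all_algebra.
From mathcomp Require Import all_classical all_reals all_analysis.
From mathcomp Require Import ring lra.
Set Implicit Arguments.
Unset Strict Implicit.
Unset Printing Implicit Defensive.

Import Order.TTheory GRing.Theory Num.Theory.
Import numFieldNormedType.Exports.

Local Open Scope classical_set_scope.
Local Open Scope ring_scope.

(** * One-variable calculus, row vectors and potentials *)

Section RealCalculus.
Variable R : realType.
Implicit Types (f : R -> R) (x d : R).

(** All derivatives are taken along lines or curves. [G] is an integral of [phi] along rays from the
    origin, and monotonicity of [phi] along lines then yields the continuity of [G] and its
    derivative along a trajectory. Scaling [r] adds a constant to [u] and changes neither [phi] nor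
    [G]. So coercivity and minima are understood modulo constants: one coordinate [i0] is normalised
    to 0, and along a flow the conserved sum selects the representative. The delicate point of
    strict convexity is that the weight of an edge in a face can vanish: its two circles are tangent
    and the third is orthogonal to both. Connectedness of the edge graph is therefore used through
    faces, going around such an edge by the other two sides. Cells are counted by sums over ordered
    triples of vertices that span a face. Regrouping angles then amounts to exchanging summation
    indices, and this is the origin of the factors 6, 4 and 2. For a constant [R]-curvature metric
    [K_i = R_av r_i^2], so (5) compares its own curvatures with the link bounds. This closes the
    circle (1), (5), (6), (1), while each flow is compared with (1) directly. *)

Lemma is_derive1_near f x d : is_derive x 1 f d <->
  (forall e, 0 < e ->
     \forall h \near (0 : R), `|f (x + h) - f x - h * d| <= e * `|h|).
Proof.
split.
- move=> [df dfE] e e0.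
  have : (fun h => h^-1 *: (f (h *: (1:R) + x) - f x)) @ 0^' --> d.
    rewrite -dfE; exact: df.
  move/cvgrPdist_le => /(_ e e0).
  rewrite /dnbhs near_withinE; apply: filterS => h hh.
  have [->|h0] := eqVneq h 0.
    by rewrite addr0 subrr mul0r subr0 !normr0 mulr0.
  have := hh h0.
  have -> : h *: (1 : R) + x = x + h by rewrite scaler1 addrC.
  move=> {}hh.
  rewrite -normrN opprB.
  have -> : h * d - (f (x + h) - f x) = (d - h^-1 *: (f (x + h) - f x)) * h.
    by rewrite /GRing.scale /=; field.
  by rewrite normrM ler_wpM2r.
- move=> H.
  have C : (fun h => h^-1 *: (f (h *: (1:R) + x) - f x)) @ 0^' --> d.
    apply/cvgrPdist_le => e e0.
    rewrite /dnbhs near_withinE; apply: filterS (H e e0) => h hh h0.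
    have -> : h *: (1 : R) + x = x + h by rewrite scaler1 addrC.
    rewrite -(@ler_pM2r _ `|h|) ?normr_gt0 //.
    rewrite -normrM -normrN -mulNr opprB.
    suff -> : (h^-1 *: (f (x + h) - f x) - d) * h = f (x + h) - f x - h * d by [].
    by rewrite /GRing.scale /=; field.
  apply: DeriveDef; first by apply/cvg_ex; exists d.
  exact/cvg_lim.
Qed.

Lemma cvg_sumr (T I : Type) (F : set_system T) (FF : Filter F) (r : seq I)
    (P : pred I) (f : I -> T -> R) (l : I -> R) :
  (forall i, P i -> f i @ F --> l i) ->
  (fun t => \sum_(i <- r | P i) f i t) @ F --> \sum_(i <- r | P i) l i.
Proof. by move=> H; apply: cvg_big => //; exact: add_continuous. Qed.

Lemma is_derive1_continuous f x d : is_derive x 1 f d -> {for x, continuous f}.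
Proof. by move=> [df _]; apply/differentiable_continuous/derivable1_diffP. Qed.

Lemma derive1_shift0 f t d :
  is_derive (0 : R) 1 (fun h => f (t + h)) d -> is_derive t 1 f d.
Proof.
move/is_derive1_near => H; apply/is_derive1_near => e /H.
by apply: filterS => h; rewrite add0r addr0.
Qed.

Lemma MVT_seg f (df : R -> R) (a b : R) :
  (forall t : R, a <= t <= b -> is_derive t 1 f (df t)) -> a < b ->
  exists2 c, a < c < b & f b - f a = df c * (b - a).
Proof.
move=> H ab.
have [x||c] := @MVT R f df a b ab.
- by rewrite in_itv /= => /andP[/ltW ax /ltW xb]; apply: H; rewrite ax xb.
- apply: continuous_in_subspaceT => x.
  rewrite inE /= in_itv /= => axb.
  exact: is_derive1_continuous (H x axb).
- by rewrite in_itv /=; exists c.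
Qed.

Lemma MVT_between f (df : R -> R) (t : R) :
  (forall s : R, is_derive s 1 f (df s)) ->
  exists2 c, `|c| <= `|t| & f t - f 0 = df c * t.
Proof.
move=> H; have [t0|t0|->] := ltgtP t 0; last first.
- by exists 0; rewrite // subrr mulr0.
- have [c /andP[c0 ct]] := MVT_seg (fun s _ => H s) t0.
  rewrite subr0 => E; exists c => //.
  by rewrite !gtr0_norm // ltW.
- have [c /andP[tc c0]] := MVT_seg (fun s _ => H s) t0.
  rewrite sub0r mulrN => E; exists c; last by rewrite -[LHS]opprB E opprK.
  by rewrite !ltr0_norm // lerN2 ltW.
Qed.

(** The interval is an open neighbourhood of [0, 1], so that the derivative is two-sided at both
    ends of the segment on which the mean value theorem is applied. *)
Lemma antiderivative_itv (f : R -> R) : continuous f ->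
  exists F : R -> R, forall x : R, -1 < x < 2 -> is_derive x 1 F (f x).
Proof.
move=> cf.
exists (fun x => \int[lebesgue_measure]_(t in `[-1, x]) f t)%R => x /andP[x1 x2].
have [|//| |d e] := @continuous_FTC1 R f (BLeft (-1)) x 2 x2.
  apply: continuous_compact_integrable; first exact: segment_compact.
    exact: continuous_subspaceT.
  exact: cf.
exact: (DeriveDef d (etrans (esym (derive1E _ _)) e)).
Qed.

Section ContinuousFunctions.
Variable T : topologicalType.
Lemma continuous_fadd (f g : T -> R) :
  continuous f -> continuous g -> continuous (fun y => f y + g y).
Proof. by move=> cf cg y; apply: continuousD; [exact: cf|exact: cg]. Qed.

Lemma continuous_fsub (f g : T -> R) :
  continuous f -> continuous g -> continuous (fun y => f y - g y).
Proof. by move=> cf cg y; apply: continuousB; [exact: cf|exact: cg]. Qed.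

Lemma continuous_fmul (f g : T -> R) :
  continuous f -> continuous g -> continuous (fun y => f y * g y).
Proof. by move=> cf cg y; apply: continuousM; [exact: cf|exact: cg]. Qed.

Lemma continuous_finv (f : T -> R) :
  (forall y, f y != 0) -> continuous f -> continuous (fun y => (f y)^-1).
Proof. by move=> f0 cf y; apply: continuousV; [exact: f0|exact: cf]. Qed.

Lemma continuous_fsum (I : Type) (r : seq I) (P : pred I) (F : I -> T -> R) :
  (forall i, P i -> continuous (F i)) ->
  continuous (fun y => \sum_(i <- r | P i) F i y).
Proof. by move=> cF y; apply: cvg_sumr => i Pi; exact: cF. Qed.

Lemma continuous_fcomp (h : R -> R) (f : T -> R) :
  continuous h -> continuous f -> continuous (fun y => h (f y)).
Proof. by move=> ch cf y; apply: continuous_comp; [exact: cf|exact: ch]. Qed.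

End ContinuousFunctions.

End RealCalculus.

(** * Row vectors: coordinates, limits and derivatives along lines *)

Section RowVectors.
Variables (R : realType) (n : nat).
Implicit Types (u v w : 'rV[R]_n).

Lemma ler_coord_norm v i : `|v 0 i| <= `|v|.
Proof.
by rewrite [leRHS]/Num.Def.normr /= mx_normrE; apply: (le_bigmax _ (fun ij : 'I_1 * 'I_n => `|v ij.1 ij.2|) (0, i)).
Qed.

Lemma norm_rV_le v (c : R) : 0 <= c -> (forall i, `|v 0 i| <= c) -> `|v| <= c.
Proof.
move=> c0 H; rewrite [leLHS]/Num.Def.normr /= mx_normrE; apply: bigmax_le => // -[i j] _ /=.
by rewrite ord1.
Qed.

Lemma cvg_rVP (T : Type) (F : set_system T) (FF : Filter F) (f : T -> 'rV[R]_n) v :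
  (forall i, (fun t => f t 0 i) @ F --> v 0 i) -> f @ F --> v.
Proof.
move=> H; apply/cvgrPdist_le => e e0.
have : \forall t \near F, forall i, `|v 0 i - f t 0 i| <= e.
  apply: filter_forall => i.
  by have /cvgrPdist_le /(_ e e0) := H i.
by apply: filterS => t ht; apply: norm_rV_le; [exact: ltW|move=> i; rewrite !mxE; exact: ht].
Qed.

Lemma cvg_coord (T : Type) (F : set_system T) (FF : Filter F) (f : T -> 'rV[R]_n) v i :
  f @ F --> v -> (fun t => f t 0 i) @ F --> v 0 i.
Proof.
by move=> H; apply: (@continuous_cvg _ _ _ F FF f (fun w : 'rV[R]_n => w 0 i) v) => //;
  exact: coord_continuous.
Qed.

Lemma continuous_rVP (T : topologicalType) (f : T -> 'rV[R]_n) :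
  (forall i, continuous (fun t => f t 0 i)) -> continuous f.
Proof. by move=> H x; apply: cvg_rVP => i; exact: H. Qed.

Lemma continuous_subr u : continuous (fun w : 'rV[R]_n => w - u).
Proof. by move=> w; exact: (@cvgB _ _ _ (nbhs w) _ id (cst u) _ _ cvg_id (cvg_cst _)). Qed.

Lemma sub_line u v : u + 1 *: (v - u) = v.
Proof. by rewrite scale1r addrC subrK. Qed.

Lemma line_derive_shift (g : 'rV[R]_n -> R) (d : 'rV[R]_n -> R) v :
  (forall u, is_derive (0 : R) 1 (fun h => g (u + h *: v)) (d u)) ->
  forall u (t : R), is_derive t 1 (fun h => g (u + h *: v)) (d (u + t *: v)).
Proof.
move=> H u t; apply: derive1_shift0.
have -> : (fun h : R => g (u + (t + h) *: v)) = (fun h => g ((u + t *: v) + h *: v)).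
  by apply/funext => h; rewrite scalerDl addrA.
exact: H.
Qed.

Lemma line_partial (g : 'rV[R]_n -> R) (d : R) u v :
  is_derive (0 : R) 1 (fun h => g (u + h *: v)) d -> 'D_v g u = d.
Proof.
move=> [_ <-]; rewrite /derive.
set g1 := fun h => h^-1 *: _; set g2 := fun h => h^-1 *: _.
suff -> : g1 = g2 by [].
apply/funext => h; rewrite /g1 /g2 /= scaler1 addr0 scale0r addr0.
by rewrite [u + _]addrC.
Qed.

End RowVectors.

(** * A field with symmetric Jacobian has a potential *)

Section Potential.
Variables (R : realType) (n : nat).
Variables (F : 'rV[R]_n -> 'I_n -> R) (J : 'rV[R]_n -> 'I_n -> 'I_n -> R).
Hypothesis dF : forall u v i (t : R),
  is_derive t 1 (fun s => F (u + s *: v) i) (\sum_j J (u + t *: v) i j * v 0 j).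
Hypothesis cJ : forall i j, continuous (fun u => J u i j).
Hypothesis symJ : forall u i j, J u i j = J u j i.

Let defect (u v : 'rV[R]_n) i (s : R) (p : R * R) : R :=
  \sum_j (J (s *: u + p.1 *: v) i j * v 0 j * (u 0 i + p.2 * v 0 i)
          - J (s *: u) i j * v 0 j * u 0 i).

(* Up to the factor [s h], [defect u v i s (eta, h)] is the [i]-th term of the
   derivative in [s] of the error of the first-order expansion of the ray
   integral in the direction [v]; it takes this form because [J] is symmetric. *)
Lemma defect_small u v (e : R) : 0 < e -> \forall p \near (0 : R, 0 : R),
  forall s i, 0 <= s <= 1 -> `|defect u v i s p| <= e.
Proof.
move=> e0.
suff : \forall p \near (0 : R, 0 : R), `[0, 1]%classic `<=`
         (fun s => forall i, `|defect u v i s p| <= e).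
  apply: filterS => p hp s i s01; apply: hp.
  by rewrite /= in_itv.
(* Tube lemma: [defect] vanishes at (0, 0) for every [s], and compactness of [0, 1] makes the
   neighbourhood of (0, 0) uniform in [s]. *)
have /compact_near_coveringP K := @segment_compact R 0 1.
apply: (K _ (nbhs (0 : R, 0 : R)) (fun p s => forall i, `|defect u v i s p| <= e)).
move=> s _.
have C i : {for (s, (0 : R, 0 : R)), continuous (fun q : R * (R * R) => defect u v i q.1 q.2)}.
  apply: cvg_sumr => j _; apply: cvgB; apply: cvgM.
  - apply: cvgM; last exact: cvg_cst.
    apply: (@continuous_cvg _ _ _ _ _ (fun q : R * (R * R) => q.1 *: u + q.2.1 *: v) (fun u => J u i j)).
      exact: cJ.
    apply: cvgD; apply: cvgZr_tmp; first exact: cvg_fst.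
    exact: (@cvg_comp _ _ _ snd fst _ _ _ cvg_snd cvg_fst).
  - apply: cvgD; first exact: cvg_cst.
    apply: cvgM; last exact: cvg_cst.
    exact: (@cvg_comp _ _ _ snd snd _ _ _ cvg_snd cvg_snd).
  - apply: cvgM; last exact: cvg_cst.
    apply: (@continuous_cvg _ _ _ _ _ (fun q : R * (R * R) => q.1 *: u) (fun u => J u i j)).
      exact: cJ.
    apply: cvgZr_tmp; exact: cvg_fst.
  - exact: cvg_cst.
have : \forall q \near (s, (0 : R, 0 : R)), forall i, `|defect u v i q.1 q.2| <= e.
  apply: (@filter_forall _ _ (fun i q => `|defect u v i q.1 q.2| <= e) (nbhs (s, (0 : R, 0 : R)))) => i.
  have /cvgrPdist_le /(_ e e0) := C i.
  apply: filterS => q /=.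
  have -> : defect u v i s (0, 0) = 0.
    rewrite /defect big1 // => j _ /=.
    by rewrite scale0r addr0 mul0r addr0 subrr.
  by rewrite sub0r normrN.
by [].
Qed.

(* The potential is [G u = \int_0^1 \sum_i F (s u) i * u i ds]. *)
Lemma potential_exists : exists G : 'rV[R]_n -> R, forall u v (t : R),
  is_derive t 1 (fun s => G (u + s *: v)) (\sum_i F (u + t *: v) i * v 0 i).
Proof.
have cF u v i : continuous (fun s : R => F (u + s *: v) i).
  by move=> t; apply: is_derive1_continuous (dF u v i t).
have cS (w : 'rV[R]_n) : continuous (fun s : R => \sum_i F (s *: w) i * w 0 i).
  move=> s; apply: cvg_sumr => i _.
  apply: cvgM; last exact: cvg_cst.
  by have := cF 0 w i s; rewrite /continuous_at; under eq_fun do rewrite add0r; rewrite add0r.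
have [g gP] := choice (fun w => antiderivative_itv (cS w)).
exists (fun w => g w 1 - g w 0) => u v.
apply: (@line_derive_shift R n (fun w => g w 1 - g w 0)
  (fun w => \sum_i F w i * v 0 i)) => {}u.
apply/is_derive1_near => e e0.
(* The error [e] is shared among [n] coordinates; [n.+1] keeps the denominator nonzero when [n] is
   0. *)
have e'0 : 0 < e / n.+1%:R by rewrite divr_gt0.
have := defect_small u v e'0.
case=> -[A B] /= [nA nB] AB.
have nAB : nbhs (0 : R) (A `&` B) by apply: filterI.
have /nbhs_ballP[d /= d0 dAB] := nAB.
apply/nbhs_ballP; exists d => //= h; rewrite /ball /= sub0r normrN => hd.
rewrite add0r scale0r addr0.
(* The factor [s] makes the last term vanish at 0 and equal the expected linear term at 1, so the
   increment of [Q] over [0, 1] is the error to be bounded, and one mean value theorem in [s] treats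
   the whole integral. *)
pose Q s := g (u + h *: v) s - g u s - h * (s * \sum_i F (s *: u) i * v 0 i).
have dQ (s : R) : 0 <= s <= 1 -> is_derive s 1 Q
   (\sum_i F (s *: (u + h *: v)) i * (u + h *: v) 0 i - \sum_i F (s *: u) i * u 0 i
    - h * (\sum_i F (s *: u) i * v 0 i + s * \sum_i (\sum_j J (s *: u) i j * u 0 j) * v 0 i)).
  move=> /andP[s0 s1].
  have s12 : -1 < s < 2 by apply/andP; split; lra.
  have d1 := gP (u + h *: v) s s12.
  have d2 := gP u s s12.
  have dS : is_derive s 1 (fun s => \sum_i F (s *: u) i * v 0 i)
     (\sum_i (\sum_j J (s *: u) i j * u 0 j) * v 0 i).
    rewrite (_ : (fun s => _) = \sum_i (fun s => F (s *: u) i * v 0 i)); last first.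
      by apply/funext => x; rewrite fct_sumE.
    apply: is_derive_sum => i.
    have := dF 0 u i s; rewrite add0r.
    rewrite (_ : (fun s => F (0 + s *: u) i) = (fun s => F (s *: u) i)); last first.
      by apply/funext => x; rewrite add0r.
    move=> d3.
    have := is_deriveM d3 (is_derive_cst (v 0 i) s 1).
    move=> d4; apply: is_derive_eq d4 _.
    by rewrite /GRing.scale /= mulr0 add0r mulrC.
  have d5 := is_deriveM (is_derive_id s (1 : R)) dS.
  have d6 := is_deriveM (is_derive_cst h s 1) d5.
  have d7 := is_deriveB (is_deriveB d1 d2) d6.
  apply: is_derive_eq d7 _.
  rewrite /GRing.scale /= mulr0 addr0 mulr1.
  congr (_ - h * _); by rewrite addrC.
have [c /andP[c0 c1]] := MVT_seg dQ (@ltr01 R).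
rewrite subr0 mulr1 => E.
have -> : g (u + h *: v) 1 - g (u + h *: v) 0 - (g u 1 - g u 0) - h * (\sum_i F u i * v 0 i)
   = Q 1 - Q 0.
  rewrite /Q !mul0r mulr0 subr0 mul1r scale1r; ring.
rewrite E.
have eta i : exists eta, `|eta| <= `|h| /\
   F (c *: u + (c * h) *: v) i - F (c *: u) i = c * h * \sum_j J (c *: u + eta *: v) i j * v 0 j.
  have [x xh Ex] := MVT_between (c * h) (dF (c *: u) v i).
  exists x; split; last by move: Ex; rewrite scale0r addr0 => ->; rewrite mulrC.
  apply: (le_trans xh); rewrite normrM gtr0_norm //.
  by rewrite ler_piMl // ltW.
have [eta1 eta1h] := choice eta.
have -> : \sum_i F (c *: (u + h *: v)) i * (u + h *: v) 0 i - \sum_i F (c *: u) i * u 0 i -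
    h * (\sum_i F (c *: u) i * v 0 i + c * \sum_i (\sum_j J (c *: u) i j * u 0 j) * v 0 i)
  = h * (c * \sum_i defect u v i c (eta1 i, h)).
  have -> : \sum_i (\sum_j J (c *: u) i j * u 0 j) * v 0 i =
            \sum_i (\sum_j J (c *: u) i j * v 0 j) * u 0 i.
    under eq_bigr do rewrite mulr_suml.
    rewrite exchange_big /=; apply: eq_bigr => i _; rewrite mulr_suml.
    by apply: eq_bigr => j _; rewrite symJ; ring.
  rewrite mulrDr mulrA !mulr_sumr opprD addrA -!sumrN -!big_split /=; apply: eq_bigr => i _.
  have [_ E1] := eta1h i.
  rewrite /defect /= sumrB -!mulr_suml !mxE scalerDr scalerA.
  have -> : F (c *: u + (c * h) *: v) i = F (c *: u) i + c * h * \sum_j J (c *: u + eta1 i *: v) i j * v 0 j.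
    by rewrite -E1 [RHS]addrC subrK.
  ring.
rewrite normrM mulrC ler_wpM2r //.
rewrite normrM gtr0_norm //.
apply: (@le_trans _ _ (\sum_(i < n) (e / n.+1%:R))).
  apply: (@le_trans _ _ `|\sum_i defect u v i c (eta1 i, h)|).
    by rewrite ler_piMl // ltW.
  apply: (le_trans (ler_norm_sum _ _ _)); apply: ler_sum => i _.
  have [eh _] := eta1h i.
  apply: (AB (eta1 i, h)); last by rewrite !ltW.
  split => /=.
    have [] // : (A `&` B) (eta1 i).
    by apply: dAB; rewrite /ball /= sub0r normrN (le_lt_trans eh).
  have [] // : (A `&` B) h.
  by apply: dAB; rewrite /ball /= sub0r normrN.
rewrite sumr_const card_ord -[_ *+ n]mulr_natl mulrCA ler_piMr ?(ltW e0) //.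
by rewrite ler_pdivrMr // mul1r ler_nat.
Qed.

End Potential.

(** * Peano's theorem *)

(** A cluster point of an ultrafilter is a limit. One fixed ultrafilter thus gives limits at all
    times simultaneously, in place of a diagonal choice of subsequences. *)
Lemma ultra_cvg (T : Type) (X : topologicalType) (U : set_system T) (f : T -> X)
    (A : set X) : UltraFilter U -> compact A -> (\forall t \near U, A (f t)) ->
  exists2 p, A p & f @ U --> p.
Proof.
move=> UU cA UA.
have PU : ProperFilter (f @ U) by apply: fmap_proper_filter.
have [p [Ap clp]] := cA _ PU UA.
exists p => // B nB.
have [//|UC] := in_ultra_setVsetC (f @^-1` B) UU.
by have [x [/= nBx Bx]] := clp (~` B) B UC nB.
Qed.

Section Peano.
Variables (R : realType) (n : nat) (W : 'rV[R]_n -> 'rV[R]_n) (M : R) (u0 : 'rV[R]_n).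
Hypothesis cW : continuous W.
Hypothesis M0 : 0 < M.
Hypothesis WM : forall u, `|W u| <= M.

Let E (k m : nat) : 'rV[R]_n := iter m (fun x => x + k.+1%:R^-1 *: W x) u0.

(** [E k m] is the Euler point after [m] steps of length [1 / k.+1]. With [w] the velocity at the
    limit point this estimate gives the derivative; with [w = 0] and [e = M] it gives the Lipschitz
    bound. *)
Lemma euler_drift k a d (w : 'rV[R]_n) e :
  (forall m, (a <= m < a + d)%N -> `|W (E k m) - w| <= e) ->
  `|E k (a + d) - E k a - (d%:R / k.+1%:R) *: w| <= e * (d%:R / k.+1%:R).
Proof.
elim: d => [|d IH] H; first by rewrite addn0 !mul0r scale0r subr0 subrr normr0 mulr0.
rewrite addnS [E k _.+1]/E /= -/(E k (a + d)).
have dS : d.+1%:R = d%:R + 1 :> R by rewrite natr1.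
have -> : E k (a + d) + k.+1%:R^-1 *: W (E k (a + d)) - E k a - (d.+1%:R / k.+1%:R) *: w
  = (E k (a + d) - E k a - (d%:R / k.+1%:R) *: w) + k.+1%:R^-1 *: (W (E k (a + d)) - w).
  by rewrite dS; apply/rowP => j; rewrite !mxE; ring.
rewrite dS mulrDl mul1r mulrDr.
apply: (le_trans (ler_normD _ _)); apply: lerD.
  by apply: IH => m /andP[am md]; apply: H; rewrite am addnS ltnS ltnW.
rewrite normrZ gtr0_norm ?invr_gt0 // mulrC ler_wpM2r ?invr_ge0 //.
by apply: H; rewrite leq_addr addnS ltnS leqnn.
Qed.

Lemma euler_bound k a b : (a <= b)%N ->
  `|E k b - E k a| <= M * ((b - a)%N%:R / k.+1%:R).
Proof.
move=> ab; have := @euler_drift k a (b - a) 0 M.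
rewrite subnKC // scaler0 subr0; apply => m _; rewrite subr0; exact: WM.
Qed.

Let y (t : R) (k : nat) : 'rV[R]_n := E k (Num.trunc (t * k.+1%:R)).

(** Both truncation errors lie in [0, 1) steps, so their difference is less than one step. *)
Lemma trunc_diff k (a b : R) : 0 <= a -> a <= b ->
  let r := (Num.trunc (b * k.+1%:R) - Num.trunc (a * k.+1%:R))%N%:R / k.+1%:R : R in
  `|r - (b - a)| <= k.+1%:R^-1.
Proof.
move=> a0 ab /=.
have k0 : (0 : R) < k.+1%:R by [].
have /truncn_itv /andP[a1 a2] : 0 <= a * k.+1%:R by rewrite mulr_ge0.
have /truncn_itv /andP[b1 b2] : 0 <= b * k.+1%:R by rewrite mulr_ge0 // (le_trans a0).
rewrite natrB; last by apply: le_truncn; rewrite ler_wpM2r.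
move: a1 a2 b1 b2; rewrite -!natr1.
set A : R := (Num.trunc (a * _))%:R; set B : R := (Num.trunc (b * _))%:R; set K : R := k%:R + 1.
move=> a1 a2 b1 b2.
have K0 : 0 < K by rewrite /K natr1.
have -> : (B - A) / K - (b - a) = ((B - b * K) - (A - a * K)) / K.
  by field; rewrite gt_eqF.
rewrite normrM [`|K^-1|]gtr0_norm ?invr_gt0 // ler_piMl ?invr_ge0 ?(ltW K0) //.
by rewrite ler_norml; apply/andP; split; lra.
Qed.

Lemma euler_in_ball t k : 0 <= t -> `|y t k - u0| <= M * t.
Proof.
move=> t0; have := @euler_bound k 0 (Num.trunc (t * k.+1%:R)) (leq0n _).
rewrite subn0 => H; apply: (le_trans H); apply: ler_wpM2l; first exact: ltW.
by rewrite ler_pdivrMr // truncn_le mulr_ge0.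
Qed.

(* The solution is the limit of Euler's step functions along an ultrafilter on
   the number of steps; it is extended linearly to negative times so as to have
   a two-sided derivative at 0. *)
Theorem peano : exists x : R -> 'rV[R]_n, x 0 = u0 /\
  forall t : R, 0 <= t -> forall i,
    is_derive t 1 (fun s => x s 0 i) (W (x t) 0 i).
Proof.
have [U [UU sU]] := ultraFilterLemma (eventually_filter).
have lim_t (t : R) : exists p : 'rV[R]_n, 0 <= t -> y t @ U --> p.
  have [t0|t0] := leP 0 t; last by exists 0; lra.
  have cB : compact [set v : 'rV[R]_n | `|v - u0| <= M * t].
    apply: bounded_closed_compact.
      exists (`|u0| + M * t); split; first exact: num_real.
      move=> B hB v /= hv; apply: ltW; apply: le_lt_trans hB.
      rewrite -[v](subrK u0) addrC; apply: (le_trans (ler_normD _ _)).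
      by rewrite lerD2l.
    have cf : continuous (fun v : 'rV[R]_n => `|v - u0|).
      move=> v; apply: (@cvg_norm _ _ _ (nbhs v) _ (fun v => v - u0)).
      by apply: cvgB; [exact: cvg_id|exact: cvg_cst].
    exact: (closed_comp (fun v _ => cf v) (@closed_le R (M * t))).
  have [|p _ yp] := ultra_cvg (f := y t) UU cB.
    by near=> k; exact: euler_in_ball.
  by exists p.
have [x xP] := choice lim_t.
have x0 : x 0 = u0.
  have H := xP 0 (lexx 0).
  apply: (@cvg_unique _ (@norm_hausdorff _ _) (y 0 @ U)) => //.
  rewrite (_ : y 0 = (fun => u0)); first exact: cvg_cst.
  by apply/funext => k; rewrite /y mul0r truncn0.
have main t e : 0 <= t -> 0 < e -> exists2 d, 0 < d & forall s, 0 <= s -> `|s - t| <= d ->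
    `|x s - x t - (s - t) *: W (x t)| <= e * `|s - t|.
  move=> t0 e0.
  have /cvgrPdist_le /(_ e e0) : W v @[v --> x t] --> W (x t) by exact: cW.
  case/nbhs_ballP => d /= d0 dW.
  (* At speed at most [M] the Euler points between the times [a] and [b] stay within [d / 4] plus
     one step, hence within [d / 2], of [y t k]. The latter is within [d / 4] of [x t], so all of
     them lie in the ball of radius [d] where [W] is close to [w]. *)
  pose d' := d / (4 * M).
  have d'0 : 0 < d' by rewrite divr_gt0 // mulr_gt0.
  exists d' => // s s0 std.
  set w := W (x t).
  suff key a b : 0 <= a -> a <= b -> b - a <= d' -> (t = a \/ t = b) ->
      `|x b - x a - (b - a) *: w| <= e * (b - a).
    have [st|/ltW ts] := leP s t.
      have -> : x s - x t - (s - t) *: w = - (x t - x s - (t - s) *: w).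
        by apply/rowP => j; rewrite !mxE; ring.
      rewrite normrN [`|s - t|]distrC [`|t - s|]ger0_norm ?subr_ge0 //; apply: key => //; last by right.
      by rewrite -[t - s]ger0_norm ?subr_ge0 // distrC.
    rewrite [`|s - t|]ger0_norm ?subr_ge0 //; apply: key => //; last by left.
    by rewrite -[s - t]ger0_norm ?subr_ge0.
  move=> a0 ab bad tab.
  have b0 := le_trans a0 ab.
  apply/ler_addgt0Pr => eta eta0.
  have C : 0 < 2 + e + M by rewrite !addr_gt0.
  (* Error budget: 2 for the two limits at [a] and [b], [e] for replacing [r] by [b - a] in the
     drift bound, [M] for the same replacement in the linear term. *)
  pose eta' := eta / (2 + e + M).
  have eta'0 : 0 < eta' by rewrite divr_gt0.
  have d40 : 0 < d / 4 by rewrite divr_gt0.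
  have [k [ka kb kt k1 k2]] : exists k, [/\ `|x a - y a k| <= eta', `|x b - y b k| <= eta',
      `|x t - y t k| <= d / 4, k.+1%:R^-1 < d / 4 / M & k.+1%:R^-1 < eta'].
    have /cvgrPdist_le /(_ _ eta'0) Ha := xP a a0.
    have /cvgrPdist_le /(_ _ eta'0) Hb := xP b b0.
    have /cvgrPdist_le /(_ _ d40) Ht := xP t t0.
    have dM : 0 < d / 4 / M by rewrite divr_gt0.
    have H1 : \forall k \near U, k.+1%:R^-1 < d / 4 / M.
      by apply: sU; exact: (near_infty_natSinv_lt (PosNum dM)).
    have H2 : \forall k \near U, k.+1%:R^-1 < eta'.
      by apply: sU; exact: (near_infty_natSinv_lt (PosNum eta'0)).
    near U => k; exists k; split; near: k => //.
  pose p := Num.trunc (a * k.+1%:R); pose q := Num.trunc (b * k.+1%:R).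
  have pq : (p <= q)%N by apply: le_truncn; rewrite ler_wpM2r.
  pose r : R := (q - p)%N%:R / k.+1%:R.
  have rab : `|r - (b - a)| <= k.+1%:R^-1 by exact: trunc_diff.
  have r0 : 0 <= r by rewrite divr_ge0.
  have rle : r <= b - a + k.+1%:R^-1.
    by move: rab; rewrite ler_norml => /andP[_]; rewrite lerBlDl.
  have Mr : M * r < d / 2.
    apply: (@le_lt_trans _ _ (M * (d' + k.+1%:R^-1))).
      by apply: ler_wpM2l; [exact: ltW|apply: (le_trans rle); rewrite lerD2r].
    rewrite mulrDr /d'.
    have -> : M * (d / (4 * M)) = d / 4 by field; rewrite gt_eqF.
    have : M * k.+1%:R^-1 < d / 4 by rewrite mulrC -ltr_pdivlMr.
    move: (M * k.+1%:R^-1) => z; lra.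
  have near_t m : (p <= m < p + (q - p))%N -> `|E k m - y t k| <= M * r.
    rewrite subnKC // => /andP[pm /ltnW mq].
    have mono m1 m2 : (p <= m1)%N -> (m1 <= m2)%N -> (m2 <= q)%N -> `|E k m2 - E k m1| <= M * r.
      move=> h1 h2 h3; apply: (le_trans (euler_bound k h2)).
      apply: ler_wpM2l; first exact: ltW.
      by rewrite ler_wpM2r ?invr_ge0 // ler_nat leq_sub.
    case: tab => ->; first exact: (mono p m).
    by rewrite distrC; exact: (mono m q).
  have D : `|y b k - y a k - r *: w| <= e * r.
    have := @euler_drift k p (q - p) w e; rewrite subnKC //; apply => m hm.
    rewrite distrC; apply: dW; rewrite -ball_normE /=.
    have -> : x t - E k m = (x t - y t k) - (E k m - y t k) by rewrite opprB addrA subrK.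
    apply: (le_lt_trans (ler_normB _ _)).
    have := near_t m; rewrite subnKC // in hm *.
    by move=> /(_ hm); lra.
  have -> : x b - x a - (b - a) *: w = (x b - y b k) - (x a - y a k) +
      (y b k - y a k - r *: w) + (r - (b - a)) *: w.
    by apply/rowP => j; rewrite !mxE; ring.
  apply: (le_trans (ler_normD _ _)); rewrite normrZ.
  have h1 : `|x b - y b k - (x a - y a k) + (y b k - y a k - r *: w)| <= eta' + eta' + e * r.
    apply: (le_trans (ler_normD _ _)); apply: lerD => //.
    by apply: (le_trans (ler_normB _ _)); apply: lerD.
  have h2 : `|r - (b - a)| * `|w| <= eta' * M.
    by apply: ler_pM => //; [apply: (le_trans rab); exact: ltW|exact: WM].
  have h3 : e * r <= e * (b - a) + e * eta'.
    rewrite -mulrDr; apply: ler_wpM2l; first exact: ltW.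
    by apply: (le_trans rle); rewrite lerD2l ltW.
  have : eta' * (2 + e + M) = eta by rewrite /eta' divfK // gt_eqF.
  lra.
pose z t := if 0 <= t then x t else u0 + t *: W u0.
exists z; split; first by rewrite /z lexx.
move=> t t0 i; apply/is_derive1_near => e e0.
have [d d0 dP] := main t e t0 e0.
have zt : z t = x t by rewrite /z t0.
have good h : `|h| <= d -> 0 <= t + h ->
    `|z (t + h) 0 i - z t 0 i - h * W (z t) 0 i| <= e * `|h|.
  move=> hd th0; rewrite zt /z th0.
  have E1 : t + h - t = h by rewrite addrC addKr.
  have := dP (t + h) th0; rewrite E1 => /(_ hd) H.
  apply: le_trans H; apply: le_trans (ler_coord_norm _ i).
  by rewrite !mxE.
have [t1|t1] := ltP 0 t.
  have m0 : 0 < Num.min d t by rewrite lt_min d0.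
  apply/nbhs_ballP; exists (Num.min d t) => //= h; rewrite /ball /= sub0r normrN lt_min => /andP[hd ht].
  apply: good; first exact: ltW.
  by move: ht; rewrite ltr_norml => /andP[]; lra.
have tE : t = 0 by apply/eqP; rewrite eq_le t0 t1.
apply/nbhs_ballP; exists d => //= h; rewrite /ball /= sub0r normrN => hd.
have [th0|th0] := leP 0 (t + h); first by apply: good => //; exact: ltW.
have -> : z (t + h) = u0 + (t + h) *: W u0 by rewrite /z leNgt th0.
rewrite zt tE x0 add0r !mxE.
rewrite (_ : _ - _ = 0) ?normr0 ?mulr_ge0 // ?ltW //; ring.
Unshelve. all: end_near. Qed.

End Peano.

(** * Gradients of Laplacian type and gradient-like flows *)

Section LimitOfDerivative.
Variable R : realType.

(** The increment of [f] over [[t, t + 1]] tends to 0 and is a value of [d] at an intermediate time.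
    Hence the limit of a convergent solution is stationary. *)
Lemma derive_lim_eq0 (f d : R -> R) (c L : R) :
  (forall t : R, 0 < t -> is_derive t 1 f (d t)) ->
  d @ +oo --> L -> f @ +oo --> c -> L = 0.
Proof.
move=> df dL fc; apply/eqP; rewrite -normr_le0; apply/ler_addgt0Pr => e e0.
have e3 : 0 < e / 3 by rewrite divr_gt0.
have /cvgrPdist_le /(_ _ e3) [A [Ar hA]] := dL.
have /cvgrPdist_le /(_ _ e3) [B [Br hB]] := fc.
have [t [tA tB t0]] : exists t : R, [/\ A < t, B < t & 0 < t].
  exists (Num.max 0 (Num.max A B) + 1).
  by split; rewrite ltr_pwDr // !le_max lexx ?orbT.
have tt1 : t < t + 1 by rewrite ltrDl.
have [x|x /andP[x1 x2]] := @MVT_seg R f d t (t + 1) _ tt1.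
  by move=> /andP[tx _]; apply: df; exact: lt_le_trans tx.
rewrite addrAC subrr add0r mulr1 => E.
have hx := hA x; rewrite /= in hx.
have ht := hB t; have ht1 := hB (t + 1); rewrite /= in ht ht1.
have {}hx : `|L - d x| <= e / 3 by apply: hx; lra.
have {}ht : `|c - f t| <= e / 3 by apply: ht.
have {}ht1 : `|c - f (t + 1)| <= e / 3 by apply: ht1; lra.
have -> : L = (L - d x) + ((c - f t) - (c - f (t + 1))) by rewrite -E; ring.
rewrite add0r; apply: (le_trans (ler_normD _ _)).
have := ler_normB (c - f t) (c - f (t + 1)).
lra.
Qed.

End LimitOfDerivative.

Definition const_rV (R : realType) n (v : 'rV[R]_n) := forall i j, v 0 i = v 0 j.

Section LaplacianGradient.
Variables (R : realType) (n : nat) (i0 : 'I_n).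
Implicit Types u v w : 'rV[R]_n.
Variables (phi : 'rV[R]_n -> 'I_n -> R) (A : 'rV[R]_n -> 'I_n -> 'I_n -> R).
Hypothesis dphi : forall u v i (t : R), is_derive t 1 (fun s => phi (u + s *: v) i)
  (\sum_j A (u + t *: v) i j * (v 0 i - v 0 j)).
Hypothesis cphi : forall i, continuous (fun u => phi u i).
Hypothesis cA : forall i j, continuous (fun u => A u i j).
Hypothesis symA : forall u i j, A u i j = A u j i.
Hypothesis A_ge0 : forall u i j, 0 <= A u i j.
Hypothesis kerA : forall u v,
  \sum_i \sum_j A u i j * (v 0 i - v 0 j) ^+ 2 = 0 -> const_rV v.
Hypothesis sum_phi : forall u, \sum_i phi u i = 0.

Let dot (f : 'I_n -> R) (v : 'rV[R]_n) := \sum_i f i * v 0 i.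

(** Summation by parts on a weighted graph: by symmetry of [A] the sum equals its index-swapped
    form, and adding the two produces the squares. *)
Lemma dirichlet_form u (f : 'I_n -> R) :
  \sum_i f i * (\sum_j A u i j * (f i - f j)) =
  2^-1 * \sum_i \sum_j A u i j * (f i - f j) ^+ 2.
Proof.
set S := LHS.
have E1 : S = \sum_i \sum_j A u i j * (f i * (f i - f j)).
  by apply: eq_bigr => i _; rewrite mulr_sumr; apply: eq_bigr => j _; rewrite mulrCA.
have E2 : S = \sum_i \sum_j A u i j * (f j * (f j - f i)).
  rewrite E1 exchange_big /=; apply: eq_bigr => i _; apply: eq_bigr => j _.
  by rewrite symA.
have -> : \sum_i \sum_j A u i j * (f i - f j) ^+ 2 = S + S.
  rewrite {1}E1 E2 -big_split; apply: eq_bigr => i _ /=.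
  by rewrite -big_split; apply: eq_bigr => j _ /=; ring.
by field.
Qed.

Lemma dirichlet_ge0 u (f : 'I_n -> R) : 0 <= \sum_i f i * (\sum_j A u i j * (f i - f j)).
Proof.
rewrite dirichlet_form mulr_ge0 ?invr_ge0 //.
by apply: sumr_ge0 => i _; apply: sumr_ge0 => j _; rewrite mulr_ge0 ?sqr_ge0.
Qed.

Lemma dirichlet_eq0 u (f : 'I_n -> R) :
  \sum_i f i * (\sum_j A u i j * (f i - f j)) = 0 -> forall i j, f i = f j.
Proof.
rewrite dirichlet_form => /eqP; rewrite mulf_eq0 invr_eq0 pnatr_eq0 /= => /eqP H i j.
have := @kerA u (\row_k f k).
under eq_bigr do under eq_bigr do rewrite !mxE.
by move=> /(_ H) /(_ i j); rewrite !mxE.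
Qed.

Lemma dot_derive u v (t : R) : is_derive t 1 (fun s => dot (phi (u + s *: v)) v)
  (\sum_i v 0 i * \sum_j A (u + t *: v) i j * (v 0 i - v 0 j)).
Proof.
rewrite /dot (_ : (fun s => _) = \sum_i (fun s => phi (u + s *: v) i * v 0 i)); last first.
  by apply/funext => s; rewrite fct_sumE.
apply: is_derive_sum => i.
have d := is_deriveM (dphi u v i t) (is_derive_cst (v 0 i) t 1).
by apply: is_derive_eq d _; rewrite /GRing.scale /= mulr0 add0r.
Qed.

Lemma dot_mono u v (s t : R) : s <= t -> dot (phi (u + s *: v)) v <= dot (phi (u + t *: v)) v.
Proof.
rewrite le_eqVlt => /predU1P[->//|st].
have [c _ E] := MVT_seg (fun x _ => dot_derive u v x) st.
rewrite -subr_ge0 E mulr_ge0 ?subr_ge0 ?(ltW st) //; exact: dirichlet_ge0.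
Qed.

Lemma dot_mono_strict u v (s t : R) : ~ const_rV v -> s < t ->
  dot (phi (u + s *: v)) v < dot (phi (u + t *: v)) v.
Proof.
move=> nv st.
have [c _ E] := MVT_seg (fun x _ => dot_derive u v x) st.
rewrite -subr_gt0 E mulr_gt0 ?subr_gt0 // lt_def dirichlet_ge0 andbT.
by apply/eqP => /dirichlet_eq0 H; apply: nv.
Qed.

Lemma phi_shift u v : const_rV v -> phi (u + v) = phi u.
Proof.
move=> cv; apply/funext => i.
have [c _ E] := MVT_seg (fun x _ => dphi u v i x) (@ltr01 R).
move: E; rewrite scale1r scale0r addr0 big1 ?mul0r; last first.
  by move=> j _; rewrite (cv i j) subrr mulr0.
by move/eqP; rewrite subr_eq0 => /eqP.
Qed.

Lemma phi_zero_unique u w : (forall i, phi u i = 0) -> (forall i, phi w i = 0) ->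
  const_rV (w - u).
Proof.
move=> pu pw; apply: contrapT => /(dot_mono_strict u) /(_ (@ltr01 R)).
by rewrite sub_line scale0r addr0 /dot !big1 ?ltxx // => i _; rewrite ?pu ?pw mul0r.
Qed.

Lemma primitive_exists : exists G : 'rV[R]_n -> R, forall u v (t : R),
  is_derive t 1 (fun s => G (u + s *: v)) (\sum_i phi (u + t *: v) i * v 0 i).
Proof.
(* The graph Laplacian as a matrix, degrees minus weights; it is symmetric because [A] is. *)
pose J u i j := (i == j)%:R * (\sum_k A u i k) - A u i j.
apply: (@potential_exists R n phi J).
- move=> u v i t; apply: is_derive_eq (dphi u v i t) _.
  rewrite /J; under [RHS]eq_bigr do rewrite mulrBl.
  under [LHS]eq_bigr do rewrite mulrBr.
  rewrite !sumrB -mulr_suml; congr (_ - _).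
  rewrite [RHS](bigD1 i) //= -[LHS]addr0; congr (_ + _); first by rewrite eqxx mul1r.
  by rewrite big1 // => j ji; rewrite eq_sym (negbTE ji) !mul0r.
- move=> i j; apply: continuous_fsub; last exact: cA.
  apply: continuous_fmul; first by move=> u; exact: cst_continuous.
  by apply: continuous_fsum => k _; exact: cA.
- move=> u i j; rewrite /J symA eq_sym.
  by case: eqP => [->//|_]; rewrite !mul0r.
Qed.

Variable G : 'rV[R]_n -> R.
Hypothesis dG : forall u v (t : R),
  is_derive t 1 (fun s => G (u + s *: v)) (\sum_i phi (u + t *: v) i * v 0 i).

Lemma G_line u v (s t : R) : s < t -> exists2 x, s < x < t &
  G (u + t *: v) - G (u + s *: v) = dot (phi (u + x *: v)) v * (t - s).
Proof. by move=> st; exact: MVT_seg (fun x _ => dG u v x) st. Qed.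

Lemma G_shift u v : const_rV v -> G (u + v) = G u.
Proof.
move=> cv; have [c _] := G_line u v (@ltr01 R).
rewrite scale1r scale0r addr0 phi_shift; last by move=> i j; rewrite !mxE (cv i j).
rewrite subr0 mulr1 /dot => E; apply/eqP; rewrite -subr_eq0 E; apply/eqP.
under eq_bigr do rewrite (cv _ i0).
by rewrite -mulr_suml sum_phi mul0r.
Qed.

(* Monotonicity of [phi] makes [G] convex; this replaces total
   differentiability of [G] in the chain rule below. *)
Lemma G_sandwich u w : dot (phi u) (w - u) <= G w - G u <= dot (phi w) (w - u).
Proof.
have [c /andP[c0 c1]] := G_line u (w - u) (@ltr01 R).
rewrite sub_line scale0r addr0 subr0 mulr1 => ->; apply/andP; split.
  by have := dot_mono u (w - u) (ltW c0); rewrite scale0r addr0.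
by have := dot_mono u (w - u) (ltW c1); rewrite sub_line.
Qed.

Lemma G_strict u w : (forall i, phi u i = 0) -> ~ const_rV (w - u) -> G u < G w.
Proof.
move=> pu nc; have [c /andP[c0 c1]] := G_line u (w - u) (@ltr01 R).
rewrite sub_line scale0r addr0 subr0 mulr1 -subr_gt0 => ->.
have := dot_mono_strict u nc c0; rewrite scale0r addr0.
by rewrite /dot [X in X < _]big1 // => i _; rewrite pu mul0r.
Qed.

Lemma cvg_dot (T : Type) (F : set_system T) (FF : Filter F) (f : T -> 'I_n -> R)
    (g : T -> 'rV[R]_n) (lf : 'I_n -> R) (lg : 'rV[R]_n) :
  (forall i, (fun t => f t i) @ F --> lf i) -> g @ F --> lg ->
  (fun t => dot (f t) (g t)) @ F --> dot lf lg.
Proof.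
move=> hf hg; apply: cvg_sumr => i _; apply: cvgM; first exact: hf.
exact: cvg_coord.
Qed.

Lemma cvg_phi (T : Type) (F : set_system T) (FF : Filter F) (x : T -> 'rV[R]_n) u i :
  x @ F --> u -> (fun t => phi (x t) i) @ F --> phi u i.
Proof.
by move=> xu; apply: (@continuous_cvg _ _ _ F FF x (fun u => phi u i) u) => //; exact: cphi.
Qed.

(** Both sides of [G_sandwich] tend to 0 with [x - u], by continuity of [phi]. *)
Lemma cvg_G (T : Type) (F : set_system T) (FF : Filter F) (x : T -> 'rV[R]_n) u :
  x @ F --> u -> G \o x @ F --> G u.
Proof.
move=> xu.
have c0 : (fun t => x t - u) @ F --> u - u by apply: cvgB => //; exact: cvg_cst.
have H1 : (fun t => dot (phi u) (x t - u) + G u) @ F --> dot (phi u) (u - u) + G u.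
  apply: cvgD; last exact: cvg_cst.
  by apply: (@cvg_dot _ _ _ (fun _ => phi u)) => // i; exact: cvg_cst.
have H2 : (fun t => dot (phi (x t)) (x t - u) + G u) @ F --> dot (phi u) (u - u) + G u.
  apply: cvgD; last exact: cvg_cst.
  by apply: cvg_dot => // i; exact: cvg_phi.
have E : dot (phi u) (u - u) + G u = G u.
  by rewrite subrr /dot big1 ?add0r // => i _; rewrite mxE mulr0.
rewrite E in H1 H2.
apply: (squeeze_cvgr _ H1 H2); apply: nearW => t /=.
by have := G_sandwich u (x t); rewrite lerBrDr lerBlDr.
Qed.

Lemma continuous_G : continuous G.
Proof. by move=> u; exact: (@cvg_G _ (nbhs u) _ id u (@cvg_id _ _)). Qed.

Lemma G_chain (x : R -> 'rV[R]_n) (d : 'rV[R]_n) (t : R) :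
  (forall i, is_derive t 1 (fun s => x s 0 i) (d 0 i)) ->
  is_derive t 1 (G \o x) (\sum_i phi (x t) i * d 0 i).
Proof.
move=> dx.
pose q h : 'rV[R]_n := h^-1 *: (x (h + t) - x t).
have cq : q @ 0^' --> d.
  apply: cvg_rVP => i; have [dr <-] := dx i.
  have -> : (fun h => q h 0 i) = (fun h => h^-1 *: (x (h *: (1 : R) + t) 0 i - x t 0 i)).
    by apply/funext => h; rewrite /q !mxE scaler1.
  exact: dr.
have cx : x @ t --> x t.
  by apply: cvg_rVP => i; apply: is_derive1_continuous (dx i).
have cxh : (fun h => x (h + t)) @ 0^' --> x t.
  apply: cvg_within_filter.
  apply: (@cvg_comp _ _ _ (fun h => h + t) x _ (nbhs t)) => //.
  have := @cvgD _ _ _ (nbhs (0 : R)) _ id (cst t) 0 t cvg_id (cvg_cst _).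
  rewrite add0r.
  exact.
have H1 : (fun h => dot (phi (x t)) (q h)) @ 0^' --> dot (phi (x t)) d.
  by apply: cvg_dot => // i; exact: cvg_cst.
have H2 : (fun h => dot (phi (x (h + t))) (q h)) @ 0^' --> dot (phi (x t)) d.
  by apply: cvg_dot => // i; exact: cvg_phi.
have H : (fun h => h^-1 *: (G (x (h *: (1 : R) + t)) - G (x t))) @ 0^' --> dot (phi (x t)) d.
  (* After division by [h] the two bounds of [G_sandwich] have the same limit. The difference
     quotient of [G] lies between them, so its distance to one is at most their gap, whatever the
     sign of [h]. *)
  have H3 : (fun h => dot (phi (x (h + t))) (q h) - dot (phi (x t)) (q h)) @ 0^' --> 0.
    by rewrite -[X in _ --> X](subrr (dot (phi (x t)) d)); apply: cvgB.
  have H4 : (fun h => h^-1 *: (G (x (h *: (1 : R) + t)) - G (x t)) - dot (phi (x t)) (q h)) @ 0^' --> 0.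
    apply/cvgr0Pnorm_le => e e0; move/cvgr0Pnorm_le : H3 => /(_ e e0).
    rewrite /dnbhs !near_withinE; apply: filterS => h H hn0.
    apply: le_trans (H hn0) => {H}; rewrite scaler1.
    have /andP[] := G_sandwich (x t) (x (h + t)).
    have Eq (f : 'I_n -> R) : dot f (q h) = h^-1 * dot f (x (h + t) - x t).
      by rewrite /dot mulr_sumr; apply: eq_bigr => i _; rewrite /q !mxE mulrCA.
    rewrite !Eq /GRing.scale /= -!mulrBr !normrM => a b.
    rewrite ler_wpM2l //.
    by rewrite !ger0_norm ?subr_ge0 ?lerD2r // (le_trans a b).
  rewrite (_ : (fun h => _) = (fun h => (h^-1 *: (G (x (h *: (1 : R) + t)) - G (x t))
    - dot (phi (x t)) (q h)) + dot (phi (x t)) (q h))); last by apply/funext => h; rewrite subrK.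
  by rewrite -[X in _ --> X]add0r; apply: cvgD.
apply: DeriveDef; first by apply/cvg_ex; exists (dot (phi (x t)) d).
exact/cvg_lim.
Qed.

Lemma G_normalize u : G (u - const_mx (u 0 i0)) = G u.
Proof. by apply: G_shift => i j; rewrite !mxE. Qed.

(** If [G] has risen above its initial value by time [s], its slope was positive before [s] and
    stays positive afterwards, by monotonicity of [phi]. *)
Lemma G_quasiconvex u v (s t : R) : 0 < s -> s <= t ->
  G (u + s *: v) <= Num.max (G u) (G (u + t *: v)).
Proof.
move=> s0; rewrite le_eqVlt le_max => /predU1P[->|st]; first by rewrite lexx orbT.
have [//|Gs] := leP (G (u + s *: v)) (G u).
have [x /andP[x0 xs] Ex] := G_line u v s0.
have [y /andP[sy yt] Ey] := G_line u v st.
move: Ex; rewrite scale0r addr0 subr0 => Ex.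
have px : 0 < dot (phi (u + x *: v)) v.
  by rewrite -(pmulr_lgt0 _ s0) -Ex subr_gt0.
have py := lt_le_trans px (dot_mono u v (ltW (lt_trans xs sy))).
by rewrite /= -subr_ge0 Ey mulr_ge0 ?subr_ge0 // ltW.
Qed.

Lemma G_unbounded_ray b v (t C : R) : 0 < t -> 0 < dot (phi (b + t *: v)) v ->
  exists2 s, 0 < s & C < G (b + s *: v).
Proof.
move=> t0; set c := dot _ _ => c0.
pose s := t + (`|C - G (b + t *: v)| + 1) / c.
have ts : t < s by rewrite ltrDl divr_gt0 // ltr_wpDl.
exists s; first exact: lt_trans ts.
have [x /andP[tx xs] E] := G_line b v ts.
have : c <= dot (phi (b + x *: v)) v by apply: dot_mono; exact: ltW.
rewrite -(ler_pM2r (_ : 0 < s - t)) ?subr_gt0 // -E.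
have -> : c * (s - t) = `|C - G (b + t *: v)| + 1.
  by rewrite /s addrAC subrr add0r mulrC divfK // gt_eqF.
have := ler_norm (C - G (b + t *: v)).
lra.
Qed.

Lemma compact_bounded_closed (S : set 'rV[R]_n) (B : R) :
  (forall v, S v -> `|v| <= B) -> closed S -> compact S.
Proof.
move=> SB cS; apply: bounded_closed_compact => //.
by exists B; split => [|C BC v Sv]; [exact: num_real|exact: (le_trans (SB v Sv) (ltW BC))].
Qed.

(** Modulo constants and positive factors the directions form the compact set [K]. Each ray exceeds
    the level [C'] at some time, nearby rays do so at the same time by continuity, and compactness
    gives a common bound [T]. Quasi-convexity then keeps the sublevel set within distance [T] of
    [b], modulo constants. *)
Lemma G_coercive b :
  (forall v, ~ const_rV v -> exists2 t, 0 < t & 0 < dot (phi (b + t *: v)) v) ->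
  forall C, exists D : R, forall u, G u <= C -> forall i j, `|u 0 i - u 0 j| <= D.
Proof.
move=> H C.
pose K : set 'rV[R]_n := [set v : 'rV[R]_n | v 0 i0 = 0 /\ `|v| = 1].
have cK : compact K.
  apply: (@compact_bounded_closed _ 1); first by move=> v [_ ->].
  apply: closedI.
    apply: (@preimage_closed _ _ (fun v : 'rV[R]_n => v 0 i0) [set 0]); last exact: closed_eq.
    by move=> v _; exact: coord_continuous.
  apply: (@preimage_closed _ _ (fun v : 'rV[R]_n => `|v|) [set 1]); last exact: closed_eq.
  by move=> v _; exact: norm_continuous.
have nK v : K v -> ~ const_rV v.
  move=> [v0 v1] cv; have : v = 0.
    by apply/rowP => i; rewrite mxE (cv i i0).
  by move=> vE; move: v1; rewrite vE normr0 => /eqP; rewrite eq_sym oner_eq0.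
(* Quasi-convexity compares with the larger of the two end values, so the threshold has to dominate
   [G b] too. *)
pose C' := Num.max C (G b).
pose P (T : R) v := exists t, [/\ 0 < t, t <= T & C' < G (b + t *: v)].
have [T [T0 KT]] : exists T : R, 0 < T /\ K `<=` P T.
  have /compact_near_coveringP NK := cK.
  have : \forall T \near +oo, K `<=` P T.
    apply: (NK R (pinfty_nbhs R) P) => v Kv.
    have [t t0 pt] := H v (nK v Kv).
    have [s s0 Cs] := G_unbounded_ray C' t0 pt.
    have cs : {for v, continuous (fun w => G (b + s *: w))}.
      apply: (@cvg_G _ (nbhs v) _ (fun w => b + s *: w)).
      apply: (@cvgD _ _ _ (nbhs v) _ (cst b) (fun w => s *: w)); first exact: cvg_cst.
      exact: scaler_continuous.
    have n1 : \forall w \near v, C' < G (b + s *: w) by exact: (cvgr_gt _ cs).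
    exists ([set w | C' < G (b + s *: w)], [set T | s < T]) => /=.
      by split => //; apply: nbhs_pinfty_gt; exact: num_real.
    by move=> [w T] /= [w1 sT]; exists s; split => //; exact: ltW.
  move=> HT; have [T [T1 T2]] := @filter_ex _ _ _ _ (filterI (nbhs_pinfty_gt (num_real (0 : R))) HT).
  by exists T.
exists (2 * `|b| + 2 * T) => u GuC i j.
pose w := u - b - const_mx ((u - b) 0 i0).
have Gw : G (b + w) = G u.
  by rewrite /w addrA [b + _]addrC subrK; apply: G_shift => k l; rewrite !mxE.
have wT : `|w| <= T.
  have [->|w0] := eqVneq w 0; first by rewrite normr0 ltW.
  have nw : 0 < `|w| by rewrite normr_gt0.
  pose v := `|w|^-1 *: w.
  have Kv : K v.
    split; first by rewrite /v /w !mxE subrr mulr0.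
    by rewrite /v normrZ normfV normr_id mulVf // gt_eqF.
  have [t [t0 tT Ct]] := KT v Kv.
  apply: le_trans tT; rewrite leNgt; apply/negP => tw.
  have := G_quasiconvex b v t0 (ltW tw).
  have -> : `|w| *: v = w by rewrite /v scalerA mulfV ?scale1r // gt_eqF.
  rewrite Gw leNgt => /negP; apply; apply: le_lt_trans Ct.
  by rewrite /C' ge_max !le_max lexx orbT GuC.
have -> : u 0 i - u 0 j = (b 0 i - b 0 j) + (w 0 i - w 0 j).
  by rewrite /w !mxE; ring.
have nb k := ler_coord_norm b k.
have nw k := le_trans (ler_coord_norm w k) wT.
apply: (le_trans (ler_normD _ _)); apply: lerD.
  by apply: (le_trans (ler_normB _ _)); rewrite mulr2n mulrDl mul1r lerD.
by apply: (le_trans (ler_normB _ _)); rewrite mulr2n mulrDl mul1r lerD.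
Qed.

(** The sublevel set is compact only after normalising the coordinate [i0]; a minimum over this
    slice is global since [G] is invariant under constants. The derivative of [G] along the [i]-th
    unit vector is [phi i]. *)
Lemma G_critical_exists b :
  (forall v, ~ const_rV v -> exists2 t, 0 < t & 0 < dot (phi (b + t *: v)) v) ->
  exists u, forall i, phi u i = 0.
Proof.
move=> H; have [D HD] := G_coercive H (G 0).
pose S : set 'rV[R]_n := [set u : 'rV[R]_n | u 0 i0 = 0 /\ G u <= G 0].
have cS : compact S.
  apply: (@compact_bounded_closed _ D).
    move=> u [u0 /HD Hu]; apply: norm_rV_le.
      by have := Hu i0 i0; rewrite subrr normr0.
    by move=> i; have := Hu i i0; rewrite u0 subr0.
  apply: closedI.
    apply: (@preimage_closed _ _ (fun v : 'rV[R]_n => v 0 i0) [set 0]); last exact: closed_eq.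
    by move=> v _; exact: coord_continuous.
  apply: (@preimage_closed _ _ G [set x | x <= G 0]); last exact: closed_le.
  by move=> v _; exact: continuous_G.
have S0 : S !=set0 by exists 0; split; rewrite ?mxE.
have [c cS' cmin] := compact_EVT_min S0 cS (continuous_subspaceT continuous_G).
have {}cmin w : G c <= G w.
  rewrite -(G_normalize w).
  have [le0|gt0] := leP (G (w - const_mx (w 0 i0))) (G 0).
    by apply: cmin; rewrite inE; split => //; rewrite !mxE subrr.
  by apply: ltW; apply: le_lt_trans gt0; apply: cmin; rewrite inE; split; rewrite ?mxE.
exists c => i.
have d := dG c (delta_mx 0 i) 0.
have [_ d0] : is_derive (0 : R) 1 (fun s => G (c + s *: delta_mx 0 i)) 0.
  apply: (@derive1_at_min _ _ (-1) 1).
  - by rewrite lerNl (le_trans _ ler01) // oppr_le0.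
  - by move=> t _; case: (dG c (delta_mx 0 i) t).
  - by rewrite in_itv /= ltr01 oppr_lt0 ltr01.
  - by move=> t _; rewrite scale0r addr0.
move: d => [_]; rewrite d0 scale0r addr0 (bigD1 i) //= big1; last first.
  by move=> j ji; rewrite mxE eqxx (negbTE ji) mulr0.
by rewrite mxE !eqxx mulr1 addr0.
Qed.

(** * Flows along which the potential decreases and a sum over vertices is conserved *)

Variables (h h1 : R -> R) (V : 'rV[R]_n -> 'rV[R]_n).
Hypothesis dh : forall x : R, is_derive x 1 h (h1 x).
Hypothesis h_incr : forall x y : R, x < y -> h x < h y.
Hypothesis cV : continuous V.
Hypothesis V_dissipates : forall u, dot (phi u) (V u) <= 0.
Hypothesis V_critical : forall u, dot (phi u) (V u) = 0 -> forall i, phi u i = 0.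
Hypothesis V_conserves : forall u, \sum_i h1 (u 0 i) * V u 0 i = 0.

Let mass u := \sum_i h (u 0 i).

Lemma continuous_mass : continuous mass.
Proof.
apply: continuous_fsum => i _; apply: continuous_fcomp; last exact: coord_continuous.
by move=> x; apply: is_derive1_continuous (dh x).
Qed.

(** Adding a nonzero constant moves every term of the sum strictly in the same direction. So a level
    of [mass] contains at most one point of each scaling class. *)
Lemma mass_const u w : const_rV (w - u) -> mass u = mass w -> w = u.
Proof.
move=> cw mE; pose c := (w - u) 0 i0.
have wE i : w 0 i = u 0 i + c by have := cw i i0; rewrite -/c !mxE; lra.
apply/rowP => i; rewrite wE; suff -> : c = 0 by rewrite addr0.
have [c0|c0|//] := ltgtP c 0; exfalso.
- suff : mass w < mass u by rewrite mE ltxx.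
  apply: ltr_sum => [|j _]; first by apply/hasP; exists i => //; exact: mem_index_enum.
  by apply: h_incr; rewrite wE; lra.
- suff : mass u < mass w by rewrite mE ltxx.
  apply: ltr_sum => [|j _]; first by apply/hasP; exists i => //; exact: mem_index_enum.
  by apply: h_incr; rewrite wE; lra.
Qed.

(** Applied in both directions, this fixes the absolute size of [u], of which coercivity controls
    only the coordinate differences. *)
Lemma mass_between u w : mass u = mass w -> exists i, u 0 i <= w 0 i.
Proof.
move=> mE; apply: contrapT => /forallNP H.
suff : mass w < mass u by rewrite mE ltxx.
apply: ltr_sum => [|j _]; first by apply/hasP; exists i0 => //; exact: mem_index_enum.
by apply: h_incr; rewrite ltNge; apply/negP; exact: H.
Qed.

Section Trajectory.
Variables (ustar u0 : 'rV[R]_n).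
Hypothesis ustar0 : forall i, phi ustar i = 0.

Let S : set 'rV[R]_n := [set u | G u <= G u0 /\ mass u = mass u0].

(** [G] bounds the differences of coordinates and [mass] bounds some coordinate from above and some
    from below. Coercivity holds at [ustar] because the slope, zero there, increases strictly along
    nonconstant directions. *)
Lemma compact_level : compact S.
Proof.
have [v nv|D HD] := @G_coercive ustar _ (G u0).
  exists 1 => //; have := dot_mono_strict ustar nv (@ltr01 R).
  by rewrite scale0r addr0 {1}/dot big1 // => i _; rewrite ustar0 mul0r.
apply: (@compact_bounded_closed _ (`|u0| + D)).
  move=> u [/HD uD mu].
  have D0 : 0 <= D by have := uD i0 i0; rewrite subrr normr0.
  apply: norm_rV_le; first by rewrite addr_ge0.
  move=> k; have [i ui] := mass_between mu; have [j uj] := mass_between (esym mu).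
  have := uD k i; have := uD k j.
  have := ler_coord_norm u0 i; have := ler_coord_norm u0 j.
  rewrite !ler_norml => /andP[a1 a2] /andP[b1 b2] /andP[c1 c2] /andP[d1 d2].
  by apply/andP; split; lra.
apply: closedI.
  apply: (@preimage_closed _ _ G [set x | x <= G u0]); last exact: closed_le.
  by move=> v _; exact: continuous_G.
apply: (@preimage_closed _ _ mass [set x | x = mass u0]); last exact: closed_eq.
by move=> v _; exact: continuous_mass.
Qed.

Lemma continuous_dissipation : continuous (fun u => dot (phi u) (V u)).
Proof.
apply: continuous_fsum => i _; apply: continuous_fmul; first exact: cphi.
by move=> u; apply: (@cvg_coord _ _ _ (nbhs u)); exact: cV.
Qed.

(* Multiplying [V] by the positive factor [s], equal to 1 on the compact level
   set, bounds the field without affecting the signs that keep trajectories in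
   that level set. *)
Lemma local_flow_exists : exists x : R -> 'rV[R]_n, [/\ x 0 = u0,
  forall t : R, 0 <= t -> S (x t) &
  forall t : R, 0 <= t -> forall i, is_derive t 1 (fun s => x s 0 i) (V (x t) 0 i)].
Proof.
have Su0 : S u0 by [].
have cnV : continuous (fun u => `|V u|).
  by move=> u; apply: (@cvg_norm _ _ _ (nbhs u)); exact: cV.
have [c _ cmax] := compact_EVT_max (ex_intro S u0 Su0) compact_level (continuous_subspaceT cnV).
pose M := `|V c| + 1.
have M0 : 0 < M by rewrite ltr_wpDl.
have VM u : S u -> 1 + `|V u| <= M.
  by move=> Su; rewrite addrC lerD2r; apply: cmax; rewrite inE.
pose s u := Num.min 1 (M / (1 + `|V u|)).
have d0 u : 0 < 1 + `|V u| by rewrite ltr_pwDl.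
have s0 u : 0 < s u by rewrite lt_min ltr01 divr_gt0.
have s1 u : S u -> s u = 1.
  by move=> Su; apply/min_idPl; rewrite ler_pdivlMr // mul1r; exact: VM.
have cs : continuous s.
  move=> u; apply: (@continuous_min _ _ (fun=> 1) (fun u => M / (1 + `|V u|)) u); first exact: cst_continuous.
  apply: continuousM; first exact: cst_continuous.
  apply: continuousV; first by rewrite gt_eqF.
  apply: continuousD; first exact: cst_continuous.
  exact: cnV.
pose W u := s u *: V u.
have cW : continuous W.
  by move=> u; apply: (@cvgZ _ _ _ (nbhs u)); [exact: cs|exact: cV].
have WM u : `|W u| <= M.
  rewrite /W normrZ gtr0_norm //.
  apply: (@le_trans _ _ (M / (1 + `|V u|) * `|V u|)).
    by rewrite ler_wpM2r // ge_min lexx orbT.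
  by rewrite mulrAC ler_pdivrMr // ler_wpM2l ?(ltW M0) // lerDr.
have [x [x0 dx]] := peano u0 cW M0 WM.
have Sx (t : R) : 0 <= t -> S (x t).
  rewrite le_eqVlt => /predU1P[<-|t0]; first by rewrite x0.
  have dGx (r : R) : 0 <= r -> is_derive r 1 (G \o x) (\sum_i phi (x r) i * W (x r) 0 i).
    by move=> r0; apply: G_chain => i; exact: dx.
  have dmx (r : R) : 0 <= r -> is_derive r 1 (fun t => mass (x t)) 0.
    move=> r0; rewrite (_ : (fun t => _) = \sum_i (h \o (fun s => x s 0 i))); last first.
      by apply/funext => q; rewrite fct_sumE.
    have H i := is_derive1_comp (dh (x r 0 i)) (dx r r0 i).
    apply: is_derive_eq (is_derive_sum H) _.
    rewrite /W; under eq_bigr do rewrite mxE mulrCA.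
    by rewrite -mulr_sumr V_conserves mulr0.
  split.
    have [r|c1 /andP[c0 _] E] := @MVT_seg _ (G \o x) (fun r => \sum_i phi (x r) i * W (x r) 0 i) 0 t _ t0.
      by case/andP => r0 _; exact: dGx.
    rewrite -subr_le0 -x0 [X in X <= _]E subr0 pmulr_lle0 // /W.
    under eq_bigr do rewrite mxE mulrCA.
    by rewrite -mulr_sumr pmulr_rle0 //; exact: V_dissipates.
  have [r|c1 /andP[c0 _] E] := @MVT_seg _ (fun t => mass (x t)) (fun=> 0) 0 t _ t0.
    by case/andP => r0 _; exact: dmx.
  by apply/eqP; rewrite -subr_eq0 -x0 E mul0r.
exists x; split => // t t0 i; have := dx t t0 i.
by rewrite /W s1 ?scale1r //; exact: Sx.
Qed.

(** If the dissipation had a negative maximum [k] on [K], then [G] would decrease along the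
    trajectory at rate at least [-k] and fall below its minimum on [K]. *)
Lemma trajectory_meets_critical (x : R -> 'rV[R]_n) (K : set 'rV[R]_n) :
  compact K -> (forall t, 0 <= t -> K (x t)) ->
  (forall t : R, 0 <= t -> forall i, is_derive t 1 (fun s => x s 0 i) (V (x t) 0 i)) ->
  exists2 u, K u & forall i, phi u i = 0.
Proof.
move=> cK Kx dx.
have K0 : K !=set0 by exists (x 0); exact: Kx.
have [c cinK cmax] := compact_EVT_max K0 cK (continuous_subspaceT continuous_dissipation).
have [m _ mmin] := compact_EVT_min K0 cK (continuous_subspaceT continuous_G).
rewrite inE in cinK; exists c => //; apply: V_critical.
apply/eqP; rewrite eq_le V_dissipates /= leNgt; apply/negP => neg.
set k := dot _ _ in neg.
(* By this time a decrease at rate [-k] brings [G] down to [G m - 1]. *)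
pose t := (G m - G (x 0) - 1) / k.
have xm (r : R) : 0 <= r -> G m <= G (x r).
  by move=> r0; apply: mmin; rewrite inE; exact: Kx.
have t0 : 0 < t.
  by rewrite nmulr_rgt0 ?invr_lt0 //; have := xm 0 (lexx _); lra.
have [r|c1 /andP[c0 _] E] := @MVT_seg _ (G \o x) (fun r => dot (phi (x r)) (V (x r))) 0 t _ t0.
  by case/andP => r0 _; apply: G_chain => i; exact: dx.
have : dot (phi (x c1)) (V (x c1)) <= k by apply: cmax; rewrite inE; apply: Kx; exact: ltW.
rewrite -(ler_pM2r t0) -[t in _ * t <= _]subr0 -E /t mulrCA mulfV ?lt_eqF // mulr1 /=.
by have := xm t (ltW t0); rewrite /t; lra.
Qed.

(** The level set [S] contains a single critical point [l], the strict minimum of [G] there. The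
    part of [S] away from [l] is compact without critical points, so the trajectory cannot remain in
    it and comes arbitrarily close to [l]. Once [G] is below its minimum outside the [e]-ball, it
    stays below and the trajectory is trapped. *)
Theorem gradient_like_flow_converges : exists x : R -> 'rV[R]_n, [/\ x 0 = u0,
  forall t : R, 0 <= t -> forall i, is_derive t 1 (fun s => x s 0 i) (V (x t) 0 i) &
  exists l : 'rV[R]_n, x @ +oo --> l].
Proof.
have [x [x0 Sx dx]] := local_flow_exists.
exists x; split => //.
have [l Sl l0] := trajectory_meets_critical compact_level Sx dx.
have Gx (s t : R) : 0 <= s -> s <= t -> G (x t) <= G (x s).
  move=> s0; rewrite le_eqVlt => /predU1P[->//|st].
  have [r|c1 /andP[c0 _] E] := @MVT_seg _ (G \o x) (fun r => dot (phi (x r)) (V (x r))) s t _ st.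
    by case/andP => sr _; apply: G_chain => i; apply: dx; exact: le_trans sr.
  by rewrite -subr_le0 [X in X <= 0]E pmulr_lle0 ?subr_gt0.
have uniq_l u : S u -> ~ u = l -> G l < G u.
  move=> Su ul; apply: G_strict => // cu; apply: ul; apply: mass_const => //.
  by case: Su => _ ->; case: Sl.
pose K e : set 'rV[R]_n := [set u | S u /\ e <= `|u - l|].
have cK e : compact (K e).
  apply: compact_closedI compact_level _.
  apply: (@preimage_closed _ _ (fun u : 'rV[R]_n => `|u - l|) [set x | e <= x]); last exact: closed_ge.
  by move=> u _; apply: (@cvg_norm _ _ _ (nbhs u)); exact: continuous_subr.
have Kl e u : 0 < e -> K e u -> ~ u = l.
  by move=> e0 [_] + uE; rewrite uE subrr normr0 leNgt e0.
exists l; apply/cvgrPdist_lt => e e0.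
have [[k Kk]|/forallNP nK] := pselect (exists u, K e u); last first.
  exists 0; split; first exact: num_real.
  move=> t t0; rewrite distrC ltNge; apply/negP => et.
  by apply: (nK (x t)); split => //; apply: Sx; exact: ltW.
have [c cinK cmin] := compact_EVT_min (ex_intro _ k Kk) (cK e) (continuous_subspaceT continuous_G).
rewrite inE in cinK.
have Glc : G l < G c by apply: uniq_l; [case: cinK|exact: Kl cinK].
have : \forall u \near l, G u < G c.
  have cGl : G @ l --> G l by exact: continuous_G.
  exact: cvgr_lt cGl _ Glc.
case/nbhs_ballP => d /= d0 dG'.
have [T T0 Td] : exists2 T, 0 <= T & `|x T - l| < d.
  apply: contrapT => /forall2NP H.
  have [t t0|u Ku pu] := trajectory_meets_critical (cK d) _ dx.
    split; first exact: Sx.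
    by rewrite leNgt; apply/negP; case: (H t).
  apply: (Kl _ _ d0 Ku); apply: mass_const; last by case: Ku => [[_ ->] _]; case: Sl.
  exact: phi_zero_unique.
exists T; split; first exact: num_real.
move=> t Tt; rewrite distrC ltNge; apply/negP => et.
have : G c <= G (x t).
  apply: cmin; rewrite inE; split => //; apply: Sx; exact: le_trans (ltW Tt).
apply/negP; rewrite -ltNge; apply: (le_lt_trans (Gx _ _ T0 (ltW Tt))).
by apply: dG'; rewrite -ball_normE /= distrC.
Qed.

End Trajectory.
End LaplacianGradient.

(** * The angles of three mutually intersecting circles *)

Section CircleTriangle.
Variable R : realType.
Implicit Types x y z a b c : R.

Definition circ_len2 x y c := x ^+ 2 + y ^+ 2 + 2 * x * y * c.

(* [x, y, z] are the radii, [a, b, c] the cosines of the weights of the edges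
   opposite to [x], [y], [z]. *)
Definition circ_num x y z a b c := x ^+ 2 + x * y * c + x * z * b - y * z * a.

Definition circ_angle x y z a b c :=
  acos (circ_num x y z a b c / (Num.sqrt (circ_len2 x y c) * Num.sqrt (circ_len2 x z b))).

(* The square of twice the area of the triangle. *)
Definition circ_disc x y z a b c :=
  x ^+ 2 * y ^+ 2 * (1 - c ^+ 2) + x ^+ 2 * z ^+ 2 * (1 - b ^+ 2)
  + y ^+ 2 * z ^+ 2 * (1 - a ^+ 2)
  + 2 * x * y * z * (x * (a + b * c) + y * (b + a * c) + z * (c + a * b)).

(* The derivative of the angle at [x] with respect to [ln y]. *)
Definition circ_weight x y z a b c :=
  x * y * (x * y * (1 - c ^+ 2) + z * (x * (a + b * c) + y * (b + a * c)))
  / (circ_len2 x y c * Num.sqrt (circ_disc x y z a b c)).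

Lemma circ_len2C x y c : circ_len2 x y c = circ_len2 y x c.
Proof. rewrite /circ_len2; ring. Qed.

Lemma circ_angleC x y z a b c : circ_angle x y z a b c = circ_angle x z y a c b.
Proof.
rewrite /circ_angle; congr (acos (_ / _)); last by rewrite mulrC.
rewrite /circ_num; ring.
Qed.

Lemma circ_disc_swap12 x y z a b c : circ_disc y x z b a c = circ_disc x y z a b c.
Proof. rewrite /circ_disc; ring. Qed.

Lemma circ_disc_swap23 x y z a b c : circ_disc x z y a c b = circ_disc x y z a b c.
Proof. rewrite /circ_disc; ring. Qed.

Lemma circ_weightC x y z a b c : circ_weight x y z a b c = circ_weight y x z b a c.
Proof.
rewrite /circ_weight circ_disc_swap12 circ_len2C; congr (_ / _); ring.
Qed.

Section Fixed.
Variables x y z a b c : R.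
Hypotheses (x0 : 0 < x) (y0 : 0 < y) (z0 : 0 < z).
Hypotheses (a01 : 0 <= a <= 1) (b01 : 0 <= b <= 1) (c01 : 0 <= c <= 1).

Lemma circ_len2_gt x' y' c' : 0 < x' -> 0 < y' -> 0 <= c' -> x' ^+ 2 < circ_len2 x' y' c'.
Proof.
move=> x1 y1 c1; rewrite /circ_len2 -addrA ltrDl ltr_pwDl ?exprn_gt0 //.
by rewrite !mulr_ge0 // ltW.
Qed.

Lemma circ_len2_gt0 x' y' c' : 0 < x' -> 0 < y' -> 0 <= c' -> 0 < circ_len2 x' y' c'.
Proof. by move=> x1 y1 c1; apply: lt_trans (circ_len2_gt x1 y1 c1); rewrite exprn_gt0. Qed.

Lemma circ_sqrt_gt x' y' c' : 0 < x' -> 0 < y' -> 0 <= c' ->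
  x' < Num.sqrt (circ_len2 x' y' c').
Proof.
move=> x1 y1 c1; rewrite -[X in X < _]gtr0_norm // -sqrtr_sqr ltr_sqrt.
  exact: circ_len2_gt.
exact: circ_len2_gt0.
Qed.

Lemma circ_sqrt_le x' y' c' : 0 < x' -> 0 < y' -> c' <= 1 ->
  Num.sqrt (circ_len2 x' y' c') <= x' + y'.
Proof.
move=> x1 y1 c1; have xy : 0 < x' + y' by rewrite addr_gt0.
rewrite -[leRHS]gtr0_norm // -sqrtr_sqr ler_wsqrtr //.
rewrite /circ_len2 -subr_ge0.
have -> : (x' + y') ^+ 2 - (x' ^+ 2 + y' ^+ 2 + 2 * x' * y' * c') = 2 * x' * y' * (1 - c').
  by ring.
by rewrite !mulr_ge0 ?subr_ge0 // ltW.
Qed.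

Let a0 : 0 <= a. Proof. by case/andP: a01. Qed.
Let b0 : 0 <= b. Proof. by case/andP: b01. Qed.
Let c0 : 0 <= c. Proof. by case/andP: c01. Qed.

(** Nonnegative cosines make every term nonnegative. The first term is positive if [c != 1]; if
    [c = 1], the last one is, through its part [z * c]. *)
Lemma circ_disc_gt0 : 0 < circ_disc x y z a b c.
Proof.
have sq (t : R) : 0 <= t <= 1 -> 0 <= 1 - t ^+ 2.
  by case/andP=> t0 t1; rewrite subr_ge0 expr_le1.
have h1 := mulr_ge0 (mulr_ge0 (sqr_ge0 x) (sqr_ge0 y)) (sq c c01).
have h2 := mulr_ge0 (mulr_ge0 (sqr_ge0 x) (sqr_ge0 z)) (sq b b01).
have h3 := mulr_ge0 (mulr_ge0 (sqr_ge0 y) (sqr_ge0 z)) (sq a a01).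
have xyz : 0 < 2 * x * y * z by rewrite !mulr_gt0.
have g1 : 0 <= x * (a + b * c) by rewrite mulr_ge0 ?addr_ge0 ?mulr_ge0 // ltW.
have g2 : 0 <= y * (b + a * c) by rewrite mulr_ge0 ?addr_ge0 ?mulr_ge0 // ltW.
have g3 : 0 <= z * (c + a * b) by rewrite mulr_ge0 ?addr_ge0 ?mulr_ge0 // ltW.
rewrite /circ_disc.
have [c1|c1] := eqVneq c 1; last first.
  have c2 : 0 < 1 - c ^+ 2.
    by rewrite subr_gt0 expr_lt1 // lt_neqAle c1; case/andP: c01.
  have : 0 < x ^+ 2 * y ^+ 2 * (1 - c ^+ 2) by rewrite !mulr_gt0 ?exprn_gt0.
  have : 0 <= 2 * x * y * z * (x * (a + b * c) + y * (b + a * c) + z * (c + a * b)).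
    by rewrite mulr_ge0 ?addr_ge0 // ltW.
  lra.
have : 0 < 2 * x * y * z * (x * (a + b * c) + y * (b + a * c) + z * (c + a * b)).
  rewrite mulr_gt0 // ltr_wpDl ?addr_ge0 // mulr_gt0 // c1.
  by rewrite ltr_pwDl // mulr_ge0.
lra.
Qed.

Let s1 := Num.sqrt (circ_len2 x y c).
Let s2 := Num.sqrt (circ_len2 x z b).
Let P := circ_num x y z a b c.

Lemma circ_s1_gt0 : 0 < s1. Proof. exact: lt_trans (circ_sqrt_gt x0 y0 c0). Qed.
Lemma circ_s2_gt0 : 0 < s2. Proof. exact: lt_trans (circ_sqrt_gt x0 z0 b0). Qed.
Lemma circ_s1E : s1 ^+ 2 = circ_len2 x y c.
Proof. by rewrite sqr_sqrtr // ltW // circ_len2_gt0. Qed.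
Lemma circ_s2E : s2 ^+ 2 = circ_len2 x z b.
Proof. by rewrite sqr_sqrtr // ltW // circ_len2_gt0. Qed.

Lemma circ_cos_sq : 1 - (P / (s1 * s2)) ^+ 2 = circ_disc x y z a b c / (s1 * s2) ^+ 2.
Proof.
have n1 := gt_eqF circ_s1_gt0; have n2 := gt_eqF circ_s2_gt0.
have -> : circ_disc x y z a b c = (s1 * s2) ^+ 2 - P ^+ 2.
  rewrite exprMn circ_s1E circ_s2E /P /circ_disc /circ_len2 /circ_num; ring.
by field; rewrite n1 n2.
Qed.

Lemma circ_cos_bound : -1 < P / (s1 * s2) < 1.
Proof.
rewrite -ltr_norml -(@ltr_pXn2r _ 2) ?nnegrE // expr1n real_normK ?num_real //.
rewrite -subr_gt0 circ_cos_sq divr_gt0 ?circ_disc_gt0 // exprn_gt0 //.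
by rewrite mulr_gt0 ?circ_s1_gt0 ?circ_s2_gt0.
Qed.

Let bnd : -1 <= P / (s1 * s2) <= 1.
Proof. by case/andP: circ_cos_bound => h1 h2; rewrite !ltW. Qed.

Lemma cos_circ_angle : cos (circ_angle x y z a b c) = P / (s1 * s2).
Proof. by rewrite acosK // in_itv. Qed.

Lemma sqrt_circ_cos : Num.sqrt (1 - (P / (s1 * s2)) ^+ 2) =
  Num.sqrt (circ_disc x y z a b c) / (s1 * s2).
Proof.
rewrite circ_cos_sq sqrtrM ?(ltW circ_disc_gt0) // sqrtrV ?sqr_ge0 // sqrtr_sqr.
by rewrite gtr0_norm // mulr_gt0 ?circ_s1_gt0 ?circ_s2_gt0.
Qed.

Lemma sin_circ_angle : sin (circ_angle x y z a b c) =
  Num.sqrt (circ_disc x y z a b c) / (s1 * s2).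
Proof. by rewrite sin_acos // sqrt_circ_cos. Qed.

Lemma circ_angle_itv : 0 < circ_angle x y z a b c < pi.
Proof.
case/andP: circ_cos_bound => h1 h2.
by rewrite acos_gt0 ?h2 ?(ltW h1) //= acos_ltpi // h1 ltW.
Qed.

Lemma circ_weight_ge0 : 0 <= circ_weight x y z a b c.
Proof.
rewrite /circ_weight divr_ge0 //; last first.
  by rewrite mulr_ge0 ?sqrtr_ge0 // ltW // circ_len2_gt0.
have c2 : 0 <= 1 - c ^+ 2 by case/andP: c01 => _ c1; rewrite subr_ge0 expr_le1.
have [[X Y] Z] := (ltW x0, ltW y0, ltW z0).
by repeat first [assumption | apply: mulr_ge0 | apply: addr_ge0].
Qed.

(* The exceptional case: two tangent circles and a third one orthogonal to both. *)
Lemma circ_weight_eq0 : circ_weight x y z a b c = 0 -> [/\ a = 0, b = 0 & c = 1].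
Proof.
have c2 : 0 <= 1 - c ^+ 2 by case/andP: c01 => _ c1; rewrite subr_ge0 expr_le1.
have xy0 : 0 < x * y by rewrite mulr_gt0.
have [[X Y] Z] := (ltW x0, ltW y0, ltW z0).
have [w wE] : exists w, w = 1 - c ^+ 2 by eexists.
rewrite /circ_weight -wE in c2 *; move/eqP.
rewrite !mulf_eq0 invr_eq0 mulf_eq0.
rewrite (gt_eqF (circ_len2_gt0 x0 y0 c0)) sqrtr_eq0 leNgt circ_disc_gt0 /= orbF.
rewrite (gt_eqF x0) (gt_eqF y0) /= paddr_eq0; last 2 first.
- by rewrite !mulr_ge0.
- by repeat first [assumption | apply: mulr_ge0 | apply: addr_ge0].
rewrite mulf_eq0 (gt_eqF xy0) /= mulf_eq0 (gt_eqF z0) /= paddr_eq0; last 2 first.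
- by repeat first [assumption | apply: mulr_ge0 | apply: addr_ge0].
- by repeat first [assumption | apply: mulr_ge0 | apply: addr_ge0].
rewrite !mulf_eq0 (gt_eqF x0) (gt_eqF y0) /= !paddr_eq0 ?mulr_ge0 //.
case/and3P => /eqP c1 /andP[/eqP -> _] /andP[/eqP -> _]; split => //.
have : (1 - c) * (1 + c) = 0 by rewrite -c1 wE; ring.
by move/eqP; rewrite mulf_eq0 subr_eq0 => /orP[/eqP->//|]; rewrite gt_eqF // ltr_wpDr.
Qed.

(** In cosines the claim is [0 < P + a * (s1 * s2)]. Since [y < s1] and [z < s2], the second summand
    absorbs the only negative term of [P], and [x ^+ 2] is left over. *)
Lemma circ_angle_lt_supp (Ph : R) : 0 <= Ph <= pi / 2 -> a = cos Ph ->
  circ_angle x y z a b c < pi - Ph.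
Proof.
case/andP => P0 P1 aE.
have pi0 := @pi_gt0 R.
have /andP[t0 t1] := circ_angle_itv.
rewrite -(@ltr_cos R) ?in_itv /=; last 2 first.
- by apply/andP; split; lra.
- by apply/andP; split; lra.
rewrite cos_circ_angle addrC cosDpi cosN -aE.
rewrite ltr_pdivlMr ?mulr_gt0 ?circ_s1_gt0 ?circ_s2_gt0 // mulNr -subr_gt0 opprK.
have h1 : y < s1 by rewrite /s1 circ_len2C; exact: circ_sqrt_gt.
have h2 : z < s2 by rewrite /s2 circ_len2C; exact: circ_sqrt_gt.
have : a * (y * z) <= a * (s1 * s2).
  by rewrite ler_wpM2l // ler_pM ?(ltW y0) ?(ltW z0) // ltW.
have : 0 < x ^+ 2 by rewrite exprn_gt0.
have : 0 <= x * y * c by rewrite !mulr_ge0 // ltW.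
have : 0 <= x * z * b by rewrite !mulr_ge0 // ltW.
rewrite /P /circ_num; lra.
Qed.

(** The terms of [P] containing [x], and the error of replacing [s1 * s2] by [y * z], are each at
    most [(2 * d + d ^+ 2) * (y * z)]. For [d <= 1] they total at most [6 * d * (y * z)]. *)
Lemma circ_angle_small_vertex (Ph e : R) : 0 <= Ph <= pi / 2 -> a = cos Ph ->
  0 < e <= pi / 2 -> forall d, 0 < d <= 1 ->
  6 * d < cos (pi - Ph - e) + a -> x <= d * y -> x <= d * z ->
  pi - Ph - e < circ_angle x y z a b c.
Proof.
move=> /andP[P0 P1] aE /andP[e0 e1] d /andP[d0 d1] dh xy xz.
have pi0 := @pi_gt0 R.
have /andP[t0 t1] := circ_angle_itv.
rewrite -(@ltr_cos R) ?in_itv /=; last 2 first.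
- by apply/andP; split; lra.
- by apply/andP; split; lra.
rewrite cos_circ_angle.
rewrite ltr_pdivrMr ?mulr_gt0 ?circ_s1_gt0 ?circ_s2_gt0 //.
set C := cos _ in dh *.
have h1 : y < s1 by rewrite /s1 circ_len2C; exact: circ_sqrt_gt.
have h2 : z < s2 by rewrite /s2 circ_len2C; exact: circ_sqrt_gt.
case/andP: a01 => _ a1; case/andP: b01 => _ b1; case/andP: c01 => _ c1.
have g1 : s1 <= x + y by exact: circ_sqrt_le.
have g2 : s2 <= x + z by exact: circ_sqrt_le.
have yz0 : 0 < y * z by rewrite mulr_gt0.
have k1 : y * z <= s1 * s2 by rewrite ler_pM // ltW.
have k2 : s1 * s2 <= (1 + d) ^+ 2 * (y * z).
  apply: (@le_trans _ _ (((1 + d) * y) * ((1 + d) * z))).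
    by apply: ler_pM; rewrite ?(ltW circ_s1_gt0) ?(ltW circ_s2_gt0) //; lra.
  by rewrite le_eqVlt; apply/orP; left; apply/eqP; ring.
have k3 : x ^+ 2 <= d ^+ 2 * (y * z).
  rewrite !expr2 mulrACA; apply: ler_pM => //; exact: ltW.
have k4 : x * y * c <= d * (y * z).
  apply: (@le_trans _ _ (x * y)); first by rewrite ler_piMr // mulr_ge0 // ltW.
  by rewrite mulrA [d * y]mulrC -mulrA mulrC ler_wpM2l // ltW.
have k5 : x * z * b <= d * (y * z).
  apply: (@le_trans _ _ (x * z)); first by rewrite ler_piMr // mulr_ge0 // ltW.
  by rewrite mulrA ler_wpM2r // ltW.
have k6 : a * (s1 * s2 - y * z) <= ((1 + d) ^+ 2 - 1) * (y * z).
  apply: (@le_trans _ _ (s1 * s2 - y * z)); first by rewrite ler_piMl // subr_ge0.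
  by rewrite mulrBl mul1r lerD2r.
have k7 : 2 * (2 * d + d ^+ 2) * (y * z) <= 6 * d * (y * z).
  rewrite ler_wpM2r ?(ltW yz0) //.
  have : d ^+ 2 <= d by rewrite expr2 ler_piMl // ltW.
  lra.
have k8 : 6 * d * (y * z) < (C + a) * (s1 * s2).
  apply: (@lt_le_trans _ _ ((C + a) * (y * z))); first by rewrite ltr_pM2r.
  by rewrite ler_wpM2l // ltW // (lt_trans _ dh) // mulr_gt0.
rewrite /P /circ_num.
move: k6 k7 k8 k3 k4 k5; move: (s1 * s2) => S; lra.
Qed.

(** Of the factor 4, three units come from [s1 * s2 <= (x + y) * (x + z)], which exceeds [x ^+ 2] by
    three products of size [d * x ^+ 2], and one from the negative term of [P]. *)
Lemma circ_angle_large_vertex (e : R) : 0 < e <= pi -> forall d, 0 < d <= 1 ->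
  4 * d < 1 - cos e -> y <= d * x -> z <= d * x ->
  circ_angle x y z a b c < e.
Proof.
move=> /andP[e0 e1] d /andP[d0 d1] dh yx zx.
have pi0 := @pi_gt0 R.
have /andP[t0 t1] := circ_angle_itv.
rewrite -(@ltr_cos R) ?in_itv /=; last 2 first.
- by apply/andP; split; lra.
- by apply/andP; split; lra.
rewrite cos_circ_angle.
rewrite ltr_pdivlMr ?mulr_gt0 ?circ_s1_gt0 ?circ_s2_gt0 //.
set C := cos _ in dh *.
have h1 : x < s1 by exact: circ_sqrt_gt.
have h2 : x < s2 by exact: circ_sqrt_gt.
case/andP: a01 => _ a1; case/andP: b01 => _ b1; case/andP: c01 => _ c1.
have g1 : s1 <= x + y by exact: circ_sqrt_le.
have g2 : s2 <= x + z by exact: circ_sqrt_le.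
have k1 : x ^+ 2 <= s1 * s2 by rewrite expr2 ler_pM // ltW.
have k2 : s1 * s2 <= (x + y) * (x + z).
  by rewrite ler_pM // ltW // ?circ_s1_gt0 ?circ_s2_gt0.
have x20 : 0 < x ^+ 2 by rewrite exprn_gt0.
have k3 : x * y <= d * x ^+ 2 by rewrite expr2 mulrA mulrC ler_wpM2r // ltW.
have k4 : x * z <= d * x ^+ 2 by rewrite expr2 mulrA mulrC ler_wpM2r // ltW.
have k5 : y * z <= d * x ^+ 2.
  apply: (@le_trans _ _ (x * z)) => //; apply: ler_wpM2r; first exact: ltW.
  by apply: (le_trans yx); rewrite ler_piMl // ltW.
have k6 : y * z * a <= y * z by rewrite ler_piMr // mulr_ge0 // ltW.
have k7 : 4 * d * x ^+ 2 < (1 - C) * (s1 * s2).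
  apply: (@lt_le_trans _ _ ((1 - C) * x ^+ 2)); first by rewrite ltr_pM2r.
  by rewrite ler_wpM2l // ltW // (lt_trans _ dh) // mulr_gt0.
have k8 : 0 <= x * y * c by rewrite !mulr_ge0 // ltW.
have k9 : 0 <= x * z * b by rewrite !mulr_ge0 // ltW.
rewrite /P /circ_num.
move: k7 k2; move: (s1 * s2) => S; lra.
Qed.

End Fixed.

(** The angles are mere arccosines, so the sum is found by trigonometry: [sin (t1 + t2) > 0] places
    [t1 + t2] below [pi], where the cosine, which is [- cos t3], determines it. *)
Lemma circ_angle_sum x y z a b c : 0 < x -> 0 < y -> 0 < z ->
  0 <= a <= 1 -> 0 <= b <= 1 -> 0 <= c <= 1 ->
  circ_angle x y z a b c + circ_angle y x z b a c + circ_angle z x y c a b = pi.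
Proof.
move=> x0 y0 z0 a01 b01 c01.
have pi0 := @pi_gt0 R.
have a0 : 0 <= a by case/andP: a01.
have b0 : 0 <= b by case/andP: b01.
have c0 : 0 <= c by case/andP: c01.
have E0 := circ_disc_gt0 x0 y0 z0 a01 b01 c01.
have /andP[i1 i1'] := circ_angle_itv x0 y0 z0 a01 b01 c01.
have /andP[i2 i2'] := circ_angle_itv y0 x0 z0 b01 a01 c01.
have /andP[i3 i3'] := circ_angle_itv z0 x0 y0 c01 a01 b01.
have C1 := cos_circ_angle x0 y0 z0 a01 b01 c01.
have C2 := cos_circ_angle y0 x0 z0 b01 a01 c01.
have C3 := cos_circ_angle z0 x0 y0 c01 a01 b01.
have S1 := sin_circ_angle x0 y0 z0 a01 b01 c01.
have S2 := sin_circ_angle y0 x0 z0 b01 a01 c01.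
move: S1 S2 C1 C2 C3 i1 i1' i2 i2' i3 i3'.
rewrite (circ_disc_swap12 x y z a b c) (circ_len2C y x) (circ_len2C z x) (circ_len2C z y).
set t1 := circ_angle x y z _ _ _; set t2 := circ_angle y x z _ _ _.
set t3 := circ_angle z x y _ _ _.
have p12 : 0 < Num.sqrt (circ_len2 x y c) by rewrite sqrtr_gt0 circ_len2_gt0.
have p13 : 0 < Num.sqrt (circ_len2 x z b) by rewrite sqrtr_gt0 circ_len2_gt0.
have p23 : 0 < Num.sqrt (circ_len2 y z a) by rewrite sqrtr_gt0 circ_len2_gt0.
have q12 : Num.sqrt (circ_len2 x y c) ^+ 2 = circ_len2 x y c.
  by rewrite sqr_sqrtr // ltW // circ_len2_gt0.
have qE : Num.sqrt (circ_disc x y z a b c) ^+ 2 = circ_disc x y z a b c.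
  by rewrite sqr_sqrtr // ltW.
have pE : 0 < Num.sqrt (circ_disc x y z a b c) by rewrite sqrtr_gt0.
move: p12 p13 p23 q12 qE pE.
set s12 := Num.sqrt (circ_len2 x y c); set s13 := Num.sqrt (circ_len2 x z b).
set s23 := Num.sqrt (circ_len2 y z a); set E := Num.sqrt (circ_disc x y z a b c).
move=> p12 p13 p23 q12 qE pE S1 S2 C1 C2 C3 i1 i1' i2 i2' i3 i3'.
have n12 := gt_eqF p12; have n13 := gt_eqF p13; have n23 := gt_eqF p23.
have sinS : 0 < sin (t1 + t2).
  rewrite sinD S1 S2 C1 C2.
  have -> : E / (s12 * s13) * (circ_num y x z b a c / (s12 * s23)) +
     circ_num x y z a b c / (s12 * s13) * (E / (s12 * s23)) =
     E * (circ_num y x z b a c + circ_num x y z a b c) / (s12 ^+ 2 * (s13 * s23)).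
    by field; rewrite n12 n13 n23.
  have -> : circ_num y x z b a c + circ_num x y z a b c = s12 ^+ 2.
    rewrite q12 /circ_num /circ_len2; ring.
  by rewrite !(divr_gt0, mulr_gt0) ?exprn_gt0.
have tpi : t1 + t2 < pi.
  rewrite ltNge; apply/negP => h.
  have : 0 <= sin (t1 + t2 - pi) by apply: sin_ge0_pi; apply/andP; split; lra.
  rewrite sinB cospi sinpi mulr0 subr0 mulrN1 oppr_ge0.
  by rewrite leNgt sinS.
suff -> : t3 = pi - (t1 + t2) by rewrite addrC subrK.
apply: cos_inj; rewrite ?in_itv /=; try by apply/andP; split; lra.
rewrite C3 addrC cosDpi cosN cosD C1 C2 S1 S2.
have -> : - (circ_num x y z a b c / (s12 * s13) * (circ_num y x z b a c / (s12 * s23)) -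
     E / (s12 * s13) * (E / (s12 * s23))) =
   (E ^+ 2 - circ_num x y z a b c * circ_num y x z b a c) / (s12 ^+ 2 * (s13 * s23)).
  by field; rewrite n12 n13 n23.
have -> : E ^+ 2 - circ_num x y z a b c * circ_num y x z b a c =
   circ_num z x y c a b * s12 ^+ 2.
  rewrite qE q12 /circ_num /circ_disc /circ_len2; ring.
by field; rewrite n12 n13 n23.
Qed.

(** In logarithmic derivatives [al], [be], [ga], scale invariance of the angle leaves only
    differences, which is the source of the graph Laplacian. *)
Lemma circ_angle_derive (X Y Z : R -> R) (t al be ga a b c : R) :
  0 < X t -> 0 < Y t -> 0 < Z t ->
  0 <= a <= 1 -> 0 <= b <= 1 -> 0 <= c <= 1 ->
  is_derive t 1 X (X t * al) -> is_derive t 1 Y (Y t * be) -> is_derive t 1 Z (Z t * ga) ->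
  is_derive t 1 (fun s => circ_angle (X s) (Y s) (Z s) a b c)
   (circ_weight (X t) (Y t) (Z t) a b c * (be - al) +
    circ_weight (X t) (Z t) (Y t) a c b * (ga - al)).
Proof.
move=> x0 y0 z0 a01 b01 c01 dX dY dZ.
have a0 : 0 <= a by case/andP: a01.
have b0 : 0 <= b by case/andP: b01.
have c0 : 0 <= c by case/andP: c01.
pose P s := circ_num (X s) (Y s) (Z s) a b c.
pose L s := circ_len2 (X s) (Y s) c.
pose M s := circ_len2 (X s) (Z s) b.
have dsc (k : R) (f : R -> R) (d : R) : is_derive t 1 f d -> is_derive t 1 (fun s => f s * k) (d * k).
  move=> df; have H := is_deriveM df (is_derive_cst k t 1).
  by apply: is_derive_eq H _; rewrite /GRing.scale /= mulr0 add0r mulrC.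
have dm (f g : R -> R) (d e : R) : is_derive t 1 f d -> is_derive t 1 g e ->
    is_derive t 1 (fun s => f s * g s) (d * g t + f t * e).
  move=> df dg; have H := is_deriveM df dg.
  by apply: is_derive_eq H _; rewrite /GRing.scale /= addrC [g t * _]mulrC.
have dV (f : R -> R) (d : R) : f t != 0 -> is_derive t 1 f d ->
    is_derive t 1 (fun s => (f s)^-1) (- (f t) ^- 2 * d).
  move=> f0 [df dE]; apply: DeriveDef; first exact: derivableV.
  by rewrite deriveV // dE.
have dP : is_derive t 1 P (2 * X t ^+ 2 * al + X t * Y t * c * (al + be)
    + X t * Z t * b * (al + ga) - Y t * Z t * a * (be + ga)).
  have H := is_deriveB (is_deriveD (is_deriveD (dm _ _ _ _ dX dX)
    (dsc c _ _ (dm _ _ _ _ dX dY))) (dsc b _ _ (dm _ _ _ _ dX dZ))) (dsc a _ _ (dm _ _ _ _ dY dZ)).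
  apply: is_derive_eq (H) _; ring.
have dL : is_derive t 1 L (2 * X t ^+ 2 * al + 2 * Y t ^+ 2 * be
    + 2 * X t * Y t * c * (al + be)).
  have H := is_deriveD (is_deriveD (dm _ _ _ _ dX dX) (dm _ _ _ _ dY dY))
    (dsc (2 * c) _ _ (dm _ _ _ _ dX dY)).
  rewrite (_ : L = (fun s => X s * X s) + (fun s => Y s * Y s) + (fun s => X s * Y s * (2 * c))); last first.
    by apply/funext => s; rewrite /L /circ_len2 !fctE; ring.
  apply: is_derive_eq (H) _; ring.
have dM : is_derive t 1 M (2 * X t ^+ 2 * al + 2 * Z t ^+ 2 * ga
    + 2 * X t * Z t * b * (al + ga)).
  have H := is_deriveD (is_deriveD (dm _ _ _ _ dX dX) (dm _ _ _ _ dZ dZ))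
    (dsc (2 * b) _ _ (dm _ _ _ _ dX dZ)).
  rewrite (_ : M = (fun s => X s * X s) + (fun s => Z s * Z s) + (fun s => X s * Z s * (2 * b))); last first.
    by apply/funext => s; rewrite /M /circ_len2 !fctE; ring.
  apply: is_derive_eq (H) _; ring.
have L0 : 0 < L t by exact: circ_len2_gt0.
have M0 : 0 < M t by exact: circ_len2_gt0.
have dsL := is_derive1_comp (is_derive1_sqrt L0) dL.
have dsM := is_derive1_comp (is_derive1_sqrt M0) dM.
have dS := dm _ _ _ _ dsL dsM.
have sL0 : 0 < Num.sqrt (L t) by rewrite sqrtr_gt0.
have sM0 : 0 < Num.sqrt (M t) by rewrite sqrtr_gt0.
have S0 : Num.sqrt (L t) * Num.sqrt (M t) != 0 by rewrite mulf_neq0 ?gt_eqF.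
have dI := dV _ _ S0 dS.
have dq := dm _ _ _ _ dP dI.
have dA := @is_derive1_comp R (@acos R)
  (fun s => P s * (Num.sqrt (L s) * Num.sqrt (M s))^-1) t _ _ (is_derive1_acos (circ_cos_bound x0 y0 z0 a01 b01 c01)) dq.
apply: is_derive_eq (dA) _.
rewrite sqrt_circ_cos // /circ_weight (circ_disc_swap23 (X t) (Y t) (Z t)).
have E0 := circ_disc_gt0 x0 y0 z0 a01 b01 c01.
have sE0 : 0 < Num.sqrt (circ_disc (X t) (Y t) (Z t) a b c) by rewrite sqrtr_gt0.
have sLE : Num.sqrt (L t) ^+ 2 = L t by rewrite sqr_sqrtr // ltW.
have sME : Num.sqrt (M t) ^+ 2 = M t by rewrite sqr_sqrtr // ltW.
rewrite /GRing.scale /= -/(L t) -/(M t).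
move: sL0 sM0 sLE sME sE0.
set sL := Num.sqrt (L t); set sM := Num.sqrt (M t); set sE := Num.sqrt (circ_disc _ _ _ _ _ _).
move=> sL0 sM0 sLE sME sE0.
set p' := _ - Y t * Z t * a * (be + ga).
set l' := 2 * X t ^+ 2 * al + 2 * Y t ^+ 2 * be + _.
set m' := 2 * X t ^+ 2 * al + 2 * Z t ^+ 2 * ga + _.
(* In this form only squares of the side lengths occur; replacing them by polynomials leaves [sE] as
   the single root. *)
transitivity ((P t * (l' / (2 * sL ^+ 2) + m' / (2 * sM ^+ 2)) - p') / sE).
  by field; rewrite (gt_eqF sL0) (gt_eqF sM0) (gt_eqF sE0).
rewrite sLE sME {}/p' {}/l' {}/m' /P.
have nL := gt_eqF L0; have nM := gt_eqF M0; have nE := gt_eqF sE0.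
move: nL nM; rewrite /L /M /circ_num /circ_len2 => nL nM.
by field; rewrite nL nM nE.
Qed.

End CircleTriangle.

(** * Counting cells *)

Section FiniteSums.
Variables (R : realType) (N : nat).
Implicit Types (i j k : 'I_N) (g : {set 'I_N} -> R).

Lemma sum_pairs g : \sum_i \sum_(j | j != i) g [set i; j]%SET =
  2 * \sum_(e : {set 'I_N} | #|e| == 2%N) g e.
Proof.
rewrite pair_big_dep /= (partition_big (fun p : 'I_N * 'I_N => [set p.1; p.2]%SET)
  (fun e : {set 'I_N} => #|e| == 2%N)) /=; last first.
  by move=> [i j] /= ji; rewrite cards2 (eq_sym i) ji.
rewrite mulr_sumr; apply: eq_bigr => e /cards2P [a [b [ab ->]]].
rewrite (eq_bigr (fun=> g [set a; b]%SET)); last by move=> p /andP[_ /eqP ->].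
rewrite sumr_const (_ : #|_| = 2%N) ?mulr_natl //.
transitivity #|[set (a, b); (b, a)]%SET|; last by rewrite cards2 xpair_eqE negb_and ab.
apply: eq_card => -[i j]; rewrite !inE !xpair_eqE /=.
apply/andP/orP.
  case=> ji /eqP E.
  have : i \in [set a; b]%SET by rewrite -E !inE eqxx.
  have : j \in [set a; b]%SET by rewrite -E !inE eqxx orbT.
  rewrite !inE => /orP[] /eqP jE /orP[] /eqP iE; subst i j; rewrite ?eqxx in ji *; by auto.
case=> /andP[/eqP -> /eqP ->]; first by rewrite eq_sym ab eqxx.
by rewrite ab finset.setUC eqxx.
Qed.

(** Adding [i] to [e] is a bijection onto the three-point sets containing [i], and each of those
    arises from its three points. *)
Lemma sum_add_point g : \sum_i \sum_(e : {set 'I_N} | (#|e| == 2%N) && (i \notin e)) g (i |: e)%SET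
  = 3 * \sum_(f : {set 'I_N} | #|f| == 3%N) g f.
Proof.
transitivity (\sum_i \sum_(f : {set 'I_N} | (#|f| == 3%N) && (i \in f)) g f).
  apply: eq_bigr => i _.
  rewrite [RHS](reindex_onto (fun e : {set 'I_N} => i |: e)%SET (fun f : {set 'I_N} => f :\ i)%SET); last first.
    by move=> f /andP[_ fi]; rewrite finset.setD1K.
  apply: eq_bigl => e; rewrite cardsU1 finset.setU11 andbT.
  have [ie|ie] := boolP (i \in e); last by rewrite /= andbT finset.setU1K // eqxx andbT.
  rewrite andbF; symmetry; apply/negP => /andP[_ /eqP E].
  by move: ie; rewrite -E !inE eqxx.
rewrite (exchange_big_dep (fun f : {set 'I_N} => #|f| == 3%N)) /=; last by move=> i f _ /andP[].
rewrite mulr_sumr; apply: eq_bigr => f /eqP f3.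
rewrite (eq_bigl (fun i => i \in f)); last by move=> i; rewrite f3 eqxx.
by rewrite sumr_const f3 mulr_natl.
Qed.

Lemma sum_triples g : \sum_i \sum_j \sum_k (#|[set i; j; k]%SET| == 3%N)%:R * g [set i; j; k]%SET =
  6 * \sum_(f : {set 'I_N} | #|f| == 3%N) g f.
Proof.
have -> : (6 : R) = 2 * 3 by ring.
rewrite -mulrA -sum_add_point mulr_sumr; apply: eq_bigr => i _.
pose h (e : {set 'I_N}) := (i \notin e)%:R * g (i |: e)%SET.
have -> : \sum_(e : {set 'I_N} | (#|e| == 2%N) && (i \notin e)) g (i |: e)%SET =
   \sum_(e : {set 'I_N} | #|e| == 2%N) h e.
  rewrite [RHS](bigID (fun e : {set 'I_N} => i \notin e)) /= [X in _ + X]big1 ?addr0.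
    by apply: eq_bigr => e /andP[_ ie]; rewrite /h ie mul1r.
  by move=> e /andP[_ /negPn ie]; rewrite /h ie mul0r.
rewrite -sum_pairs; apply: eq_bigr => j _.
rewrite [RHS]big_mkcond; apply: eq_bigr => k _.
rewrite /h -finset.setUA cardsU1 cards2; have [->|kj] := eqVneq k j => /=.
  by case: (i \in _); rewrite mul0r.
by case: (i \in _).
Qed.

End FiniteSums.

Section CyclicOrder.
Variable (T : eqType).

Lemma prev_at_last (x y : T) p : x \notin p -> prev_at x x y p = last y p.
Proof.
elim: p y => [|z p IH] y /=; first by rewrite eqxx.
by rewrite inE negb_or => /andP[/negbTE -> /IH ->].
Qed.

(** With [x] rotated to the front, its successor is the second entry and its predecessor the last.
    This is why an edge lies in two distinct faces. *)
Lemma next_neq_prev (c : seq T) x : uniq c -> (2 < size c)%N -> x \in c ->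
  next c x != prev c x.
Proof.
move=> uc sc /rot_to [n c' E].
rewrite -(next_rot n uc) -(prev_rot n uc) E.
have : uniq (x :: c') by rewrite -E rot_uniq.
have : (2 < size (x :: c'))%N by rewrite -E size_rot.
case: c' {E} => [//|y [//|z s]] _; set w := z :: s.
rewrite /= => /and3P[xyw yw _]; rewrite eqxx.
rewrite -[if _ then _ else _]/(prev_at x x x (y :: w)) prev_at_last //.
by apply: contra yw => /eqP ->; rewrite /w /= mem_last.
Qed.

End CyclicOrder.

(** * Incidences of the triangulation and cell counts over ordered triples *)

Section Triangulation.
Variables (R : realType) (N : nat) (T : triangulated_surface N).
Implicit Types (i j k : 'I_N) (I : {set 'I_N}).

Definition edge_rel i j := [set i; j]%SET \in edges T.
Definition tri i j k := [set i; j; k]%SET \in faces T.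

Lemma tri_swap23 i j k : tri i j k = tri i k j.
Proof. by rewrite /tri -!finset.setUA [X in (_ :|: X)%SET]finset.setUC. Qed.

Lemma tri_swap12 i j k : tri i j k = tri j i k.
Proof. by rewrite /tri [X in (X :|: _)%SET]finset.setUC. Qed.

Lemma edge_neq i j : edge_rel i j -> i != j.
Proof. by move=> /(@card_edge _ T); rewrite cards2; case: (i != j). Qed.

Lemma tri_neq i j k : tri i j k -> [/\ i != j, i != k & j != k].
Proof.
move=> /(@card_face _ T); rewrite -finset.setUA cardsU1 cards2 !inE negb_or.
by case: (i != j); case: (i != k); case: (j != k).
Qed.

Lemma tri_edge i j k : tri i j k -> edge_rel i j.
Proof.
move=> t; have [ij _ _] := tri_neq t.
apply: (@edge_of_face _ T _ _ t); last by rewrite cards2 ij.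
exact: finset.subsetUl.
Qed.

Lemma card_tri_edge i j : edge_rel i j -> #|[set k | tri i j k]%SET| = 2%N.
Proof.
have [c [uc sc ce cf]] := link_cycle T i.
rewrite /edge_rel ce => jc.
rewrite (_ : [set k | tri i j k]%SET = [set next c j; prev c j]%SET).
  by rewrite cards2 next_neq_prev.
by apply/setP => k; rewrite !inE /tri cf jc.
Qed.

Lemma edge_tri i j : edge_rel i j -> exists k, tri i j k.
Proof.
move=> /card_tri_edge H; have : (0 < #|[set k | tri i j k]%SET|)%N by rewrite H.
by move=> /card_gt0P [k]; rewrite inE; exists k.
Qed.

Lemma exists_crossing_edge I : I != finset.set0 -> I \proper [set: 'I_N]%SET ->
  exists i j, [/\ i \in I, j \notin I & edge_rel i j].
Proof.
move=> /set0Pn [i iI] /properP [_ [j _ jI]].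
apply: contrapT => H.
have cl x y : connect [rel a b | [set a; b]%SET \in edges T] x y -> x \in I -> y \in I.
  move=> /connectP [p + ->]; elim: p x => [//|z p IH] x /= /andP[xz /IH {}IH] xI.
  apply: IH; apply: contrapT => /negP zI; apply: H; by exists x, z.
by move: jI; rewrite (cl _ _ (surface_connected T i j) iI).
Qed.

Let t i j k : R := (tri i j k)%:R.
Let m I i : R := (i \in I)%:R.

Lemma sum3_swap12 (F : 'I_N -> 'I_N -> 'I_N -> R) :
  \sum_i \sum_j \sum_k t i j k * F i j k = \sum_i \sum_j \sum_k t i j k * F j i k.
Proof.
rewrite exchange_big; apply: eq_bigr => i _; apply: eq_bigr => j _; apply: eq_bigr => k _.
by rewrite /t tri_swap12.
Qed.

Lemma sum3_swap23 (F : 'I_N -> 'I_N -> 'I_N -> R) :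
  \sum_i \sum_j \sum_k t i j k * F i j k = \sum_i \sum_j \sum_k t i j k * F i k j.
Proof.
apply: eq_bigr => i _; rewrite exchange_big; apply: eq_bigr => j _; apply: eq_bigr => k _.
by rewrite /t tri_swap23.
Qed.

Lemma card_face_sum I : #|[set f in faces T | f \subset I]%SET|%:R =
  6^-1 * \sum_i \sum_j \sum_k t i j k * (m I i * m I j * m I k).
Proof.
pose g (f : {set 'I_N}) : R := (f \in faces T)%:R * (f \subset I)%:R.
transitivity (\sum_(f : {set 'I_N} | #|f| == 3%N) g f).
  rewrite -sum1_card natr_sum [LHS]big_mkcond [RHS]big_mkcond; apply: eq_bigr => f _.
  rewrite inE /g; have [fF|] := boolP (f \in faces T); last by rewrite mul0r; case: ifP.
  by rewrite (card_face fF) eqxx mul1r /=; case: (f \subset I).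
have := sum_triples g => H.
have -> : \sum_(f : {set 'I_N} | #|f| == 3%N) g f = 6^-1 * (6 * \sum_(f : {set 'I_N} | #|f| == 3%N) g f).
  by rewrite mulrA mulVf ?mul1r.
rewrite -H; congr (_ * _); apply: eq_bigr => i _; apply: eq_bigr => j _; apply: eq_bigr => k _.
rewrite /g /t /tri; have [fF|] := boolP (_ \in faces T); last by rewrite !mul0r mulr0.
rewrite (card_face fF) eqxx !mul1r /m !finset.subUset !finset.sub1set.
by case: (i \in I); case: (j \in I); case: (k \in I); rewrite ?mul1r ?mul0r.
Qed.

(* 4 = 2 * 2: an edge has two orientations and lies in two faces. *)
Lemma card_edge_sum I : #|[set e in edges T | e \subset I]%SET|%:R =
  4^-1 * \sum_i \sum_j \sum_k t i j k * (m I i * m I j).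
Proof.
pose g (f : {set 'I_N}) : R := (f \in edges T)%:R * (f \subset I)%:R.
transitivity (\sum_(f : {set 'I_N} | #|f| == 2%N) g f).
  rewrite -sum1_card natr_sum [LHS]big_mkcond [RHS]big_mkcond; apply: eq_bigr => f _.
  rewrite inE /g; have [fF|] := boolP (f \in edges T); last by rewrite mul0r; case: ifP.
  by rewrite (card_edge fF) eqxx mul1r /=; case: (f \subset I).
have -> : \sum_(f : {set 'I_N} | #|f| == 2%N) g f = 2^-1 * (2 * \sum_(f : {set 'I_N} | #|f| == 2%N) g f).
  by rewrite mulrA mulVf ?mul1r.
rewrite -sum_pairs (_ : 4^-1 = 2^-1 * 2^-1); last by field.
rewrite -mulrA; congr (_ * _); rewrite mulr_sumr; apply: eq_bigr => i _.
rewrite big_mkcond mulr_sumr; apply: eq_bigr => j _.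
rewrite -mulr_suml /t -natr_sum.
have [e|ne] := boolP (edge_rel i j).
  have -> : (\sum_k tri i j k)%N = 2%N.
    rewrite -(card_tri_edge e) -sum1_card [RHS]big_mkcond; apply: eq_bigr => k _.
    by rewrite inE; case: (tri _ _ _).
  rewrite (eq_sym j i) (edge_neq e) [RHS]mulrA mulVf ?pnatr_eq0 // mul1r /g /m finset.subUset !finset.sub1set.
  move: e; rewrite /edge_rel => ->; rewrite mul1r.
  by case: (i \in I); case: (j \in I); rewrite ?mul1r ?mul0r.
rewrite big1; last by move=> k _; case: (boolP (tri i j k)) => // /tri_edge; rewrite (negbTE ne).
rewrite mul0r mulr0 /g; move: ne; rewrite /edge_rel => /negbTE ->.
by rewrite mul0r; case: ifP.
Qed.

(** The vertex of the pair takes the first place of the ordered triple; the edge occurs with both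
    orders of its ends. *)
Lemma Lk_sum I (h : {set 'I_N} -> R) : \sum_(p in Lk T I) h p.1 =
  2^-1 * \sum_i \sum_j \sum_k t i j k * (m I i * (1 - m I j) * (1 - m I k) * h [set j; k]%SET).
Proof.
pose g i (e : {set 'I_N}) : R := [disjoint e & I]%B%:R * ((i |: e)%SET \in faces T)%:R * h e.
have E : \sum_(p in Lk T I) h p.1 = \sum_i m I i * \sum_(e : {set 'I_N} | #|e| == 2%N) g i e.
  transitivity (\sum_(e : {set 'I_N}) \sum_(i | (e, i) \in Lk T I) h e).
    rewrite pair_big_dep /=; apply: eq_big => [[e i]|[e i] _] //=.
  rewrite (exchange_big_dep predT) //=; apply: eq_bigr => i _.
  rewrite mulr_sumr [LHS]big_mkcond [RHS]big_mkcond; apply: eq_bigr => e _.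
  rewrite inE /= /g /m.
  have [iI|iI] := boolP (i \in I); last by rewrite !mul0r andbF /= !andbF; case: ifP.
  have [d|d] := boolP [disjoint e & I]%B; last by rewrite andbF !mul0r mulr0; case: ifP.
  have [fF|fF] := boolP ((i |: e)%SET \in faces T); last by rewrite !andbF !(mul0r, mulr0); case: ifP.
  have ie : i \notin e by apply/negP => /(disjointFr d); rewrite iI.
  have e2 : #|e| = 2%N by have := card_face fF; rewrite cardsU1 ie => -[].
  rewrite e2 eqxx !mul1r (@edge_of_face _ T _ _ fF) //=; exact: finset.subsetUr.
rewrite E mulr_sumr; apply: eq_bigr => i _.
have -> : \sum_(e : {set 'I_N} | #|e| == 2%N) g i e = 2^-1 * (2 * \sum_(e : {set 'I_N} | #|e| == 2%N) g i e).
  by rewrite mulrA mulVf ?mul1r.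
rewrite -sum_pairs mulrCA; congr (_ * _); rewrite mulr_sumr; apply: eq_bigr => j _.
rewrite big_mkcond mulr_sumr; apply: eq_bigr => k _.
rewrite /t /tri -finset.setUA /g /m.
have [fF|] := boolP ((_ |: _)%SET \in faces T); last by rewrite !(mul0r, mulr0); case: ifP; rewrite ?mulr0.
have /tri_neq [_ _ jk] : tri i j k by rewrite /tri -finset.setUA.
rewrite eq_sym jk mulr1 mul1r -mulrA -mulrA; congr (_ * _); rewrite mulrA; congr (_ * _).
rewrite -setI_eq0 finset.setIUl.
have sI x : ([set x] :&: I == finset.set0)%SET = (x \notin I).
  by rewrite setI_eq0 disjoints1.
rewrite finset.setU_eq0 !sI.
by case: (j \in I); case: (k \in I); rewrite /= ?subrr ?subr0 ?mul0r ?mulr0 ?mul1r.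
Qed.

End Triangulation.

(** * Curvature and link bounds *)

Section Curvature.
Variables (R : realType) (N : nat) (T : triangulated_surface N) (Phi : {set 'I_N} -> R).
Hypothesis hPhi : is_weight T Phi.
Implicit Types (i j k : 'I_N) (I : {set 'I_N}) (u v r : 'rV[R]_N).

Let cs i j := cos (Phi [set i; j]%SET).
Let t i j k : R := (tri T i j k)%:R.
Let m I i : R := (i \in I)%:R.

Lemma cos_weightC i j : cs i j = cs j i.
Proof. by rewrite /cs finset.setUC. Qed.

Lemma cos_weight_itv i j : edge_rel T i j -> 0 <= cs i j <= 1.
Proof.
move=> /hPhi /andP[p0 p1]; rewrite cos_le1 andbT.
have pi0 := @pi_gt0 R.
by apply: cos_ge0_pihalf; apply/andP; split; lra.
Qed.

Lemma tri_cos_itv i j k : tri T i j k ->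
  [/\ 0 <= cs j k <= 1, 0 <= cs i k <= 1 & 0 <= cs i j <= 1].
Proof.
move=> h; split; apply: cos_weight_itv.
- by apply: (@tri_edge _ _ _ _ i); rewrite tri_swap23 tri_swap12.
- by apply: (@tri_edge _ _ _ _ j); rewrite tri_swap23.
- exact: tri_edge h.
Qed.

Definition vertex_angle r i j k :=
  circ_angle (r 0 i) (r 0 j) (r 0 k) (cos (Phi [set j; k]%SET))
    (cos (Phi [set i; k]%SET)) (cos (Phi [set i; j]%SET)).

Lemma vertex_angleC r i j k : vertex_angle r i j k = vertex_angle r i k j.
Proof. by rewrite /vertex_angle circ_angleC [X in Phi X]finset.setUC. Qed.

Lemma angleE r i j k : is_metric r -> tri T i j k ->
  angle Phi r i j k = vertex_angle r i j k.
Proof.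
move=> r0 /tri_cos_itv [/andP[a0 a1] /andP[b0 b1] /andP[c0 c1]].
rewrite /angle /vertex_angle /edge_length -/(cs j k) -/(cs i k) -/(cs i j).
rewrite -!/(circ_len2 _ _ _) /circ_angle.
have L x y c : 0 < x -> 0 < y -> 0 <= c -> 0 <= circ_len2 x y c.
  by move=> x0 y0 c0'; apply/ltW/circ_len2_gt0.
rewrite !sqr_sqrtr ?L //.
have q1 : 0 < Num.sqrt (circ_len2 (r 0 i) (r 0 j) (cs i j)) by rewrite sqrtr_gt0 circ_len2_gt0.
have q2 : 0 < Num.sqrt (circ_len2 (r 0 i) (r 0 k) (cs i k)) by rewrite sqrtr_gt0 circ_len2_gt0.
congr acos.
have -> : circ_len2 (r 0 i) (r 0 j) (cs i j) + circ_len2 (r 0 i) (r 0 k) (cs i k)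
  - circ_len2 (r 0 j) (r 0 k) (cs j k) =
  2 * circ_num (r 0 i) (r 0 j) (r 0 k) (cs j k) (cs i k) (cs i j).
  rewrite /circ_len2 /circ_num; ring.
by field; rewrite (gt_eqF q1) (gt_eqF q2).
Qed.

Lemma vertex_angle_sum r i j k : is_metric r -> tri T i j k ->
  vertex_angle r i j k + vertex_angle r j i k + vertex_angle r k i j = pi.
Proof.
move=> r0 /tri_cos_itv [a01 b01 c01]; rewrite /vertex_angle.
rewrite -/(cs j k) -/(cs i k) -/(cs i j) -/(cs j i) -/(cs k j) -/(cs k i).
by rewrite (cos_weightC j i) (cos_weightC k j) (cos_weightC k i) circ_angle_sum.
Qed.

Lemma vertex_angle_itv r i j k : is_metric r -> tri T i j k ->
  0 < vertex_angle r i j k < pi - Phi [set j; k]%SET.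
Proof.
move=> r0 h; have [a01 b01 c01] := tri_cos_itv h.
have /andP[-> _] /= := circ_angle_itv (r0 i) (r0 j) (r0 k) a01 b01 c01.
apply: circ_angle_lt_supp => //; apply: hPhi.
by apply: (@tri_edge _ _ _ _ i); rewrite tri_swap23 tri_swap12.
Qed.

Lemma gauss_curvE r i : is_metric r ->
  gauss_curv T Phi r i = 2 * pi - 2^-1 * \sum_j \sum_k t i j k * vertex_angle r i j k.
Proof.
move=> r0; rewrite /gauss_curv; congr (_ - _).
pose S := \sum_(j < N) \sum_(k < N | (j < k)%N) t i j k * vertex_angle r i j k.
have -> : \sum_(j < N) \sum_(k < N | (j < k)%N && ([set i; j; k]%SET \in faces T))
    angle Phi r i j k = S.
  apply: eq_bigr => j _; rewrite [LHS]big_mkcond [RHS]big_mkcond; apply: eq_bigr => k _.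
  rewrite /t /tri; case: ltnP => //= _.
  by case: (boolP (_ \in faces T)) => h; rewrite ?mul0r // mul1r angleE.
suff -> : \sum_j \sum_k t i j k * vertex_angle r i j k = S + S by field.
have S' : S = \sum_(j < N) \sum_(k < N | (k < j)%N) t i j k * vertex_angle r i j k.
  rewrite /S (exchange_big_dep predT) //=; apply: eq_bigr => j _; apply: eq_bigr => k _.
  by rewrite /t tri_swap23 vertex_angleC.
rewrite {2}S' /S -big_split; apply: eq_bigr => j _ /=.
rewrite (bigID (fun k : 'I_N => (j < k)%N)) /=; congr (_ + _).
rewrite [LHS]big_mkcond [RHS]big_mkcond; apply: eq_bigr => k _.
rewrite -leqNgt /t; case: ltngtP => //= kj.
case: (boolP (tri T i j k)) => [/tri_neq [_ _]|]; last by rewrite mul0r.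
by rewrite -val_eqE /= kj eqxx.
Qed.

(** A face with three vertices in [I] contributes angles of sum [pi]; with two, [pi] minus the angle
    at the outer vertex; with one, a single angle, compared with [pi - Phi]. As each edge lies in
    two faces, edges can be counted face by face, and the multiples of [pi] combine to the Euler
    term. The two remainders are sums of positive quantities over the mixed faces. *)
Lemma gauss_curv_sum r I : is_metric r ->
  \sum_(i in I) gauss_curv T Phi r i = link_bound T Phi I
   + 2^-1 * (\sum_i \sum_j \sum_k t i j k * (m I i * m I j * (1 - m I k) * vertex_angle r k i j))
   + 2^-1 * (\sum_i \sum_j \sum_k t i j k * (m I i * (1 - m I j) * (1 - m I k)
               * (pi - Phi [set j; k]%SET - vertex_angle r i j k))).
Proof.
move=> r0.
pose th := vertex_angle r.
pose S F := \sum_i \sum_j \sum_k t i j k * (F i j k : R).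
have SD F G : S (fun i j k => F i j k + G i j k) = S F + S G.
  rewrite /S -big_split; apply: eq_bigr => i _ /=; rewrite -big_split; apply: eq_bigr => j _ /=.
  by rewrite -big_split; apply: eq_bigr => k _ /=; rewrite mulrDr.
have SZ c F : S (fun i j k => c * F i j k) = c * S F.
  rewrite /S mulr_sumr; apply: eq_bigr => i _ /=; rewrite mulr_sumr; apply: eq_bigr => j _ /=.
  by rewrite mulr_sumr; apply: eq_bigr => k _ /=; rewrite mulrCA.
have SE F G : (forall i j k, tri T i j k -> F i j k = G i j k) -> S F = S G.
  move=> H; apply: eq_bigr => i _; apply: eq_bigr => j _; apply: eq_bigr => k _.
  by rewrite /t; case: (boolP (tri T i j k)) => h; rewrite ?mul0r // H.
have S12 F : S F = S (fun i j k => F j i k) by exact: sum3_swap12.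
have S23 F : S F = S (fun i j k => F i k j) by exact: sum3_swap23.
have KE : \sum_(i in I) gauss_curv T Phi r i = 2 * pi * #|I|%:R - 2^-1 * S (fun i j k => m I i * th i j k).
  under eq_bigr do rewrite gauss_curvE //.
  rewrite sumrB sumr_const -[_ *+ _]mulr_natr -mulr_sumr; congr (_ - _ * _).
  rewrite big_mkcond; apply: eq_bigr => i _; rewrite /m; case: (i \in I).
    by apply: eq_bigr => j _; apply: eq_bigr => k _; rewrite mul1r.
  by rewrite big1 // => j _; rewrite big1 // => k _; rewrite mul0r mulr0.
have lbE : link_bound T Phi I = 2 * pi * #|I|%:R
   - pi / 2 * S (fun i j k => m I i * m I j) + pi / 3 * S (fun i j k => m I i * m I j * m I k)
   - 2^-1 * S (fun i j k => m I i * (1 - m I j) * (1 - m I k) * (pi - Phi [set j; k]%SET)).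
  rewrite /link_bound (Lk_sum T I (fun e => pi - Phi e)) /euler_sub.
  rewrite intrD intrB -!pmulrn (card_face_sum R T I) (card_edge_sum R T I).
  by rewrite -!/(S _); field.
have E1 : S (fun i j k => m I i * th i j k) = S (fun i j k => m I i * m I j * m I k * th i j k)
   + 2 * S (fun i j k => m I i * m I j * (1 - m I k) * th i j k)
   + S (fun i j k => m I i * (1 - m I j) * (1 - m I k) * th i j k).
  have E : S (fun i j k => m I i * m I j * (1 - m I k) * th i j k)
         = S (fun i j k => m I i * (1 - m I j) * m I k * th i j k).
    by rewrite S23; apply: SE => i j k _; rewrite /th vertex_angleC; ring.
  rewrite mulr2n mulrDl mul1r {2}E -!SD; apply: SE => i j k _; ring.
have E2 : 3 * S (fun i j k => m I i * m I j * m I k * th i j k) =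
    pi * S (fun i j k => m I i * m I j * m I k).
  have F1 : S (fun i j k => m I i * m I j * m I k * th i j k) =
            S (fun i j k => m I i * m I j * m I k * th j i k).
    by rewrite S12; apply: SE => i j k _; ring.
  have F2 : S (fun i j k => m I i * m I j * m I k * th i j k) =
            S (fun i j k => m I i * m I j * m I k * th k i j).
    by rewrite F1 S23; apply: SE => i j k _; ring.
  have -> : 3 * S (fun i j k => m I i * m I j * m I k * th i j k) =
     S (fun i j k => m I i * m I j * m I k * th i j k) + S (fun i j k => m I i * m I j * m I k * th j i k)
     + S (fun i j k => m I i * m I j * m I k * th k i j) by rewrite -F1 -F2; ring.
  rewrite -!SD -SZ; apply: SE => i j k h; rewrite -(vertex_angle_sum r0 h) /th; ring.
have E3 : 2 * S (fun i j k => m I i * m I j * (1 - m I k) * th i j k) =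
    pi * S (fun i j k => m I i * m I j * (1 - m I k)) - S (fun i j k => m I i * m I j * (1 - m I k) * th k i j).
  have F1 : S (fun i j k => m I i * m I j * (1 - m I k) * th i j k) =
            S (fun i j k => m I i * m I j * (1 - m I k) * th j i k).
    by rewrite S12; apply: SE => i j k _; ring.
  rewrite mulr2n mulrDl mul1r {2}F1 -SD -SZ -mulN1r -SZ -SD; apply: SE => i j k h.
  rewrite -(vertex_angle_sum r0 h) /th; ring.
have E4 : S (fun i j k => m I i * m I j) =
   S (fun i j k => m I i * m I j * m I k) + S (fun i j k => m I i * m I j * (1 - m I k)).
  by rewrite -SD; apply: SE => i j k _; ring.
have E5 : S (fun i j k => m I i * (1 - m I j) * (1 - m I k) * (pi - Phi [set j; k]%SET - th i j k)) =
   S (fun i j k => m I i * (1 - m I j) * (1 - m I k) * (pi - Phi [set j; k]%SET))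
   - S (fun i j k => m I i * (1 - m I j) * (1 - m I k) * th i j k).
  by rewrite -mulN1r -SZ -SD; apply: SE => i j k _; ring.
change (\sum_(i in I) gauss_curv T Phi r i = link_bound T Phi I
   + 2^-1 * S (fun i j k => m I i * m I j * (1 - m I k) * th k i j)
   + 2^-1 * S (fun i j k => m I i * (1 - m I j) * (1 - m I k) * (pi - Phi [set j; k]%SET - th i j k))).
rewrite KE lbE E1 E4 E5; lra.
Qed.

(** The case where [I] is everything: the link sum and both remainders carry a vanishing factor
    [1 - m]. *)
Lemma gauss_bonnet r : is_metric r ->
  \sum_i gauss_curv T Phi r i = 2 * pi * (euler T)%:~R.
Proof.
move=> r0; have := gauss_curv_sum [set: 'I_N]%SET r0.
rewrite (eq_bigl predT); last by move=> i; rewrite inE.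
move=> ->; rewrite /link_bound /euler.
have m1 i : m [set: 'I_N]%SET i = 1 by rewrite /m inE.
rewrite (Lk_sum T _ (fun e => pi - Phi e)) !big1 ?mulr0 ?oppr0 ?add0r ?addr0 //.
all: move=> i _; rewrite big1 // => j _; rewrite big1 // => k _; rewrite ?m1 ?inE /= subrr ?(mulr0, mul0r) //.
Qed.

(** By connectedness some edge leaves [I]. A face on it has two vertices or one in [I], according to
    its third vertex, and makes the corresponding remainder positive. *)
Lemma link_bound_lt r I : is_metric r -> I != finset.set0 -> I \proper [set: 'I_N]%SET ->
  link_bound T Phi I < \sum_(i in I) gauss_curv T Phi r i.
Proof.
move=> r0 I0 I1; rewrite (gauss_curv_sum I r0) -addrA ltrDl -mulrDr mulr_gt0 ?invr_gt0 //.
have m01 i : 0 <= m I i <= 1 by rewrite /m; case: (i \in I); rewrite /= lexx ler01.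
have mc i : 0 <= 1 - m I i by case/andP: (m01 i) => _; rewrite subr_ge0.
have m0 i : 0 <= m I i by case/andP: (m01 i).
have g1 i j k : 0 <= t i j k * (m I i * m I j * (1 - m I k) * vertex_angle r k i j).
  rewrite /t; case: (boolP (tri T i j k)) => h; rewrite ?mul0r // mul1r !mulr_ge0 //.
  have h' : tri T k i j by rewrite tri_swap12 tri_swap23.
  by have /andP[/ltW] := vertex_angle_itv r0 h'.
have g2 i j k : 0 <= t i j k * (m I i * (1 - m I j) * (1 - m I k)
               * (pi - Phi [set j; k]%SET - vertex_angle r i j k)).
  rewrite /t; case: (boolP (tri T i j k)) => h; rewrite ?mul0r // mul1r !mulr_ge0 //.
  by have /andP[_ /ltW] := vertex_angle_itv r0 h; rewrite subr_ge0.
have pos F : (forall i j k, 0 <= F i j k :> R) -> forall i j k, 0 < F i j k ->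
    0 < \sum_i \sum_j \sum_k F i j k.
  move=> F0 i j k Fp; apply: (lt_le_trans Fp).
  rewrite (bigD1 i) //= (bigD1 j) //= (bigD1 k) //= -!addrA lerDl.
  by rewrite !addr_ge0 // sumr_ge0 // => *; rewrite ?sumr_ge0 // => *; rewrite sumr_ge0.
have [i [j [iI jI e]]] := exists_crossing_edge T I0 I1.
have [k h] := edge_tri e.
have [kI|kI] := boolP (k \in I).
  rewrite ltr_pwDl //; last first.
    by apply: sumr_ge0 => *; apply: sumr_ge0 => *; apply: sumr_ge0.
  apply: (pos _ g1 i k j).
  have h2 : tri T i k j by rewrite tri_swap23.
  rewrite /t h2 /m iI kI (negbTE jI) subr0 !mul1r.
  have h' : tri T j i k by rewrite tri_swap12.
  by have /andP[] := vertex_angle_itv r0 h'.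
rewrite ltr_wpDl //.
  by apply: sumr_ge0 => *; apply: sumr_ge0 => *; apply: sumr_ge0.
apply: (pos _ g2 i j k).
rewrite /t h /m iI (negbTE kI) (negbTE jI) subr0 !mul1r subr_gt0.
by have /andP[] := vertex_angle_itv r0 h.
Qed.

End Curvature.

(** * Logarithmic coordinates *)

Section LogCoordinates.
Variables (R : realType) (N : nat) (T : triangulated_surface N) (Phi : {set 'I_N} -> R).
Hypothesis hPhi : is_weight T Phi.
Hypothesis hchi : euler T <= 0.
Implicit Types (i j k : 'I_N) (I : {set 'I_N}) (u v r : 'rV[R]_N).

Let cs i j := cos (Phi [set i; j]%SET).
Let t i j k : R := (tri T i j k)%:R.
Let x u i := expR (u 0 i / 2).

Lemma metric_r_of_u u : is_metric (r_of_u u).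
Proof. by move=> i; rewrite mxE expR_gt0. Qed.

Lemma r_of_u_sq u i : (r_of_u u) 0 i ^+ 2 = expR (u 0 i).
Proof. by rewrite mxE -expRM_natl mulrC divfK. Qed.

Lemma u_of_rK u : u_of_r (r_of_u u) = u.
Proof. by apply/rowP => i; rewrite !mxE expRK mulrC divfK. Qed.

Lemma r_of_uK r : is_metric r -> r_of_u (u_of_r r) = r.
Proof.
move=> r0; apply/rowP => i; rewrite !mxE [2 * _]mulrC mulfK // lnK //; exact: r0.
Qed.

Definition curv u i := gauss_curv T Phi (r_of_u u) i.

Definition angle_weight u i j k :=
  circ_weight (expR (u 0 i / 2)) (expR (u 0 j / 2)) (expR (u 0 k / 2))
    (cos (Phi [set j; k]%SET)) (cos (Phi [set i; k]%SET)) (cos (Phi [set i; j]%SET)).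

(** For [i != j] this is minus the derivative of [K_i] in [u_j]. Each face on the edge occurs once;
    the factor [2^-1] comes from [u = 2 ln r]. *)
Definition curv_weight u i j : R := 2^-1 * \sum_k (tri T i j k)%:R * angle_weight u i j k.

Lemma angle_weightC u i j k : angle_weight u i j k = angle_weight u j i k.
Proof. by rewrite /angle_weight circ_weightC [X in _ (cos (Phi X))]finset.setUC. Qed.

Lemma angle_weight_ge0 u i j k : tri T i j k -> 0 <= angle_weight u i j k.
Proof.
move=> h; have [a01 b01 c01] := tri_cos_itv hPhi h.
by apply: circ_weight_ge0; rewrite ?expR_gt0.
Qed.

Lemma curv_weightC u i j : curv_weight u i j = curv_weight u j i.
Proof.
by congr (_ * _); apply: eq_bigr => k _; rewrite tri_swap12 angle_weightC.
Qed.

Lemma curv_weight_ge0 u i j : 0 <= curv_weight u i j.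
Proof.
rewrite mulr_ge0 ?invr_ge0 //; apply: sumr_ge0 => k _.
by case: (boolP (tri T i j k)) => h; rewrite ?mul0r // mul1r angle_weight_ge0.
Qed.

Lemma curv_weight_nonedge u i j : ~~ edge_rel T i j -> curv_weight u i j = 0.
Proof.
move=> ne; rewrite /curv_weight big1 ?mulr0 // => k _.
by case: (boolP (tri T i j k)) => [/tri_edge|]; rewrite ?mul0r // (negbTE ne).
Qed.

(** All terms vanish, so [v] agrees across edges of nonzero weight. If the weight of [i j] vanishes
    in the face [i j k], then [cs i j = 1] while the other two cosines are 0; hence the sides [i k]
    and [k j] have nonzero weights in that face, and [v 0 i = v 0 k = v 0 j]. *)
Lemma curv_weight_ker u v :
  \sum_i \sum_j curv_weight u i j * (v 0 i - v 0 j) ^+ 2 = 0 -> const_rV v.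
Proof.
move=> S0.
have B0 i j : 0 <= curv_weight u i j * (v 0 i - v 0 j) ^+ 2.
  by rewrite mulr_ge0 ?sqr_ge0 // curv_weight_ge0.
have Bz i j : curv_weight u i j * (v 0 i - v 0 j) ^+ 2 = 0.
  have S1 : forall k, predT k -> \sum_l curv_weight u k l * (v 0 k - v 0 l) ^+ 2 = 0.
    by apply: psumr_eq0P => // k _; apply: sumr_ge0.
  have S2 : forall l, predT l -> curv_weight u i l * (v 0 i - v 0 l) ^+ 2 = 0.
    by apply: psumr_eq0P => //; exact: S1.
  exact: S2.
have trieq i j k : tri T i j k -> angle_weight u i j k <> 0 -> v 0 i = v 0 j.
  move=> h w0; apply/eqP; rewrite -subr_eq0.
  move/eqP: (Bz i j); rewrite mulf_eq0 expf_eq0 /= => /orP[|//].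
  rewrite /curv_weight mulf_eq0 invr_eq0 pnatr_eq0 /= => /eqP w1.
  have w2 l : true -> 0 <= (tri T i j l)%:R * angle_weight u i j l.
    by move=> _; case: (boolP (tri T i j l)) => h'; rewrite ?mul0r // mul1r angle_weight_ge0.
  by have := @psumr_eq0P _ _ predT _ w2 w1 k isT; rewrite h mul1r.
have edgeeq i j : edge_rel T i j -> v 0 i = v 0 j.
  move=> /edge_tri [k h].
  have [a01 b01 c01] := tri_cos_itv hPhi h.
  have h2 : tri T i k j by rewrite tri_swap23.
  have h3 : tri T j k i by rewrite tri_swap23 tri_swap12.
  have [w0|/eqP w0] := eqVneq (angle_weight u i j k) 0; last exact: trieq h w0.
  have [||||||az bz cz] := circ_weight_eq0 _ _ _ _ _ _ w0; rewrite ?expR_gt0 //.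
  transitivity (v 0 k); last (symmetry; apply: (trieq _ _ _ h3)).
  - apply: (trieq _ _ _ h2) => w1.
    have [||||||_ + _] := circ_weight_eq0 _ _ _ _ _ _ w1; rewrite ?expR_gt0 //.
    + by rewrite (cos_weightC Phi k j).
    + by rewrite cz => /eqP; rewrite oner_eq0.
  - move=> w1.
    have [||||||_ + _] := circ_weight_eq0 _ _ _ _ _ _ w1; rewrite ?expR_gt0 //.
    + by rewrite (cos_weightC Phi k i).
    + by rewrite (cos_weightC Phi j i).
    + by rewrite (cos_weightC Phi j i) cz => /eqP; rewrite oner_eq0.
move=> i j; have /connectP [p + ->] := surface_connected T i j.
by elim: p i => [//|z p IH] i /= /andP[e /IH <-]; exact: edgeeq.
Qed.

Lemma is_derive_exp_half u v i (s : R) :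
  is_derive s 1 (fun s => expR ((u + s *: v) 0 i / 2)) (expR ((u + s *: v) 0 i / 2) * (v 0 i / 2)).
Proof.
have d1 : is_derive s 1 (fun s => (u + s *: v) 0 i / 2) (v 0 i / 2).
  rewrite (_ : (fun s => _) = (cst (u 0 i / 2)) + (fun s => s * (v 0 i / 2))); last first.
    by apply/funext => y; rewrite !fctE !mxE; ring.
  have H := is_deriveD (is_derive_cst (u 0 i / 2) s 1)
     (is_deriveM (is_derive_id s (1 : R)) (is_derive_cst (v 0 i / 2) s 1)).
  by apply: is_derive_eq (H) _; rewrite /GRing.scale /= add0r mulr0 add0r mulr1.
exact: (is_derive1_comp (is_derive_expR _) d1).
Qed.

Lemma curvE u i : curv u i = 2 * pi - 2^-1 * \sum_j \sum_k t i j k *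
  circ_angle (x u i) (x u j) (x u k) (cs j k) (cs i k) (cs i j).
Proof.
rewrite /curv gauss_curvE //; last exact: metric_r_of_u.
congr (_ - _ * _); apply: eq_bigr => j _; apply: eq_bigr => k _.
by rewrite /vertex_angle !mxE.
Qed.

Lemma curv_derive u v i (s : R) : is_derive s 1 (fun s => curv (u + s *: v) i)
  (\sum_j curv_weight (u + s *: v) i j * (v 0 i - v 0 j)).
Proof.
have dth j k : is_derive s 1 (fun s => t i j k * circ_angle (x (u + s *: v) i) (x (u + s *: v) j)
    (x (u + s *: v) k) (cs j k) (cs i k) (cs i j))
   (t i j k * (2^-1 * (angle_weight (u + s *: v) i j k * (v 0 j - v 0 i)
                     + angle_weight (u + s *: v) i k j * (v 0 k - v 0 i)))).
  rewrite /t; case: (boolP (tri T i j k)) => h; last first.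
    rewrite (_ : (fun s => _) = cst 0); last by apply/funext => y; rewrite mul0r.
    by rewrite mul0r; exact: is_derive_cst.
  rewrite (_ : (fun s => _) = (fun s => circ_angle (x (u + s *: v) i) (x (u + s *: v) j)
    (x (u + s *: v) k) (cs j k) (cs i k) (cs i j))); last by apply/funext => y; rewrite mul1r.
  have [a01 b01 c01] := tri_cos_itv hPhi h.
  have H := @circ_angle_derive R (fun s => x (u + s *: v) i) (fun s => x (u + s *: v) j)
    (fun s => x (u + s *: v) k) s (v 0 i / 2) (v 0 j / 2) (v 0 k / 2) (cs j k) (cs i k) (cs i j)
    (expR_gt0 _) (expR_gt0 _) (expR_gt0 _) a01 b01 c01
    (is_derive_exp_half u v i s) (is_derive_exp_half u v j s) (is_derive_exp_half u v k s).
  apply: is_derive_eq (H) _.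
  rewrite mul1r /angle_weight -/(cs j k) -/(cs i k) -/(cs i j) (cos_weightC Phi k j).
  by rewrite -/(cs j k) /x; field.
rewrite (_ : (fun s => _) = cst (2 * pi) - (fun s => 2^-1 * \sum_j \sum_k t i j k *
  circ_angle (x (u + s *: v) i) (x (u + s *: v) j) (x (u + s *: v) k) (cs j k) (cs i k) (cs i j))); last first.
  by apply/funext => y; rewrite curvE.
have dS : is_derive s 1 (fun s => \sum_j \sum_k t i j k *
  circ_angle (x (u + s *: v) i) (x (u + s *: v) j) (x (u + s *: v) k) (cs j k) (cs i k) (cs i j))
  (\sum_j \sum_k t i j k * (2^-1 * (angle_weight (u + s *: v) i j k * (v 0 j - v 0 i)
                     + angle_weight (u + s *: v) i k j * (v 0 k - v 0 i)))).
  rewrite (_ : (fun s => _) = \sum_j \sum_k (fun s => t i j k *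
    circ_angle (x (u + s *: v) i) (x (u + s *: v) j) (x (u + s *: v) k) (cs j k) (cs i k) (cs i j))); last first.
    by apply/funext => y; rewrite fct_sumE; apply: eq_bigr => j _; rewrite fct_sumE.
  by apply: is_derive_sum => j; apply: is_derive_sum => k; exact: dth.
have H := is_deriveB (is_derive_cst (2 * pi) s 1) (is_deriveM (is_derive_cst (2^-1 : R) s 1) dS).
apply: is_derive_eq (H) _.
rewrite /GRing.scale /= mulr0 addr0 sub0r.
(* Exchanging [j] and [k] identifies the two halves, so the sum doubles and the inner [2^-1]
   disappears. *)
have -> : \sum_j \sum_k t i j k * (2^-1 * (angle_weight (u + s *: v) i j k * (v 0 j - v 0 i)
                     + angle_weight (u + s *: v) i k j * (v 0 k - v 0 i))) =
   \sum_j \sum_k t i j k * (angle_weight (u + s *: v) i j k * (v 0 j - v 0 i)).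
  pose F j k := t i j k * (angle_weight (u + s *: v) i j k * (v 0 j - v 0 i)).
  transitivity (2^-1 * (\sum_j \sum_k F j k + \sum_j \sum_k F k j)).
    rewrite -big_split mulr_sumr; apply: eq_bigr => j _ /=.
    rewrite -big_split mulr_sumr; apply: eq_bigr => k _ /=.
    rewrite /F /t (tri_swap23 T i k j); ring.
  by rewrite [X in _ + X]exchange_big /= -/(F _ _); field.
rewrite mulr_sumr -sumrN; apply: eq_bigr => j _.
rewrite /curv_weight -mulrA mulr_suml -mulrN; congr (_ * _).
rewrite -sumrN; apply: eq_bigr => k _; rewrite /t; ring.
Qed.

Lemma continuous_exp_half i : continuous (fun u => expR (u 0 i / 2)).
Proof.
apply: continuous_fcomp; first exact: continuous_expR.
apply: continuous_fmul; first exact: coord_continuous.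
by move=> u; exact: cst_continuous.
Qed.

Let c_cst (c : R) : continuous (fun _ : 'rV[R]_N => c).
Proof. by move=> u; exact: cst_continuous. Qed.

Let c_sq (f : 'rV[R]_N -> R) : continuous f -> continuous (fun u => f u ^+ 2).
Proof. by move=> cf; under eq_fun do rewrite expr2; exact: continuous_fmul. Qed.

Let c_sqrt (f : 'rV[R]_N -> R) : continuous f -> continuous (fun u => Num.sqrt (f u)).
Proof. by move=> cf; apply: continuous_fcomp => //; exact: sqrt_continuous. Qed.

Let c_opp (f : 'rV[R]_N -> R) : continuous f -> continuous (fun u => - f u).
Proof. by move=> cf u; apply: continuousN; exact: cf. Qed.

Ltac continuity :=
  lazymatch goal with |- forall _, continuous_at _ ?h =>
    lazymatch h with
    | (fun w => @Algebra.add _ (@?f w) (@?g w)) =>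
        refine (@continuous_fadd R _ f g _ _); continuity
    | (fun w => @GRing.mul _ (@?f w) (@?g w)) =>
        refine (@continuous_fmul R _ f g _ _); continuity
    | (fun w => @Algebra.opp _ (@?f w)) => refine (@c_opp f _); continuity
    | (fun w => @GRing.exp _ (@?f w) 2) => refine (@c_sq f _); continuity
    | (fun w => Num.sqrt (@?f w)) => refine (@c_sqrt f _); continuity
    | _ => first [exact: continuous_exp_half | exact: c_cst]
    end
  end.

Lemma continuous_angle i j k : tri T i j k ->
  continuous (fun u => circ_angle (x u i) (x u j) (x u k) (cs j k) (cs i k) (cs i j)).
Proof.
move=> h; have [a01 b01 c01] := tri_cos_itv hPhi h.
have [[c0 _] [b0 _]] := (andP c01, andP b01).
have cq : continuous (fun u => circ_num (x u i) (x u j) (x u k) (cs j k) (cs i k) (cs i j) /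
    (Num.sqrt (circ_len2 (x u i) (x u j) (cs i j)) * Num.sqrt (circ_len2 (x u i) (x u k) (cs i k)))).
  apply: continuous_fmul; first by rewrite /circ_num; continuity.
  apply: continuous_finv; last by rewrite /circ_len2; continuity.
  by move=> u; rewrite mulf_neq0 // gt_eqF // sqrtr_gt0 circ_len2_gt0 ?expR_gt0.
move=> u; apply: (@continuous_comp _ _ _ _ (@acos R) u); first exact: cq.
by apply: continuous_acos; apply: circ_cos_bound; rewrite ?expR_gt0.
Qed.

Lemma continuous_curv i : continuous (fun u => curv u i).
Proof.
under eq_fun do rewrite curvE.
apply: continuous_fsub; first exact: c_cst.
apply: continuous_fmul; first exact: c_cst.
apply: continuous_fsum => j _; apply: continuous_fsum => k _.
rewrite /t; case: (boolP (tri T i j k)) => h /=.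
  by apply: continuous_fmul; [exact: c_cst|exact: continuous_angle].
by under eq_fun do rewrite mul0r; exact: c_cst.
Qed.

Lemma continuous_curv_weight i j : continuous (fun u => curv_weight u i j).
Proof.
apply: continuous_fmul; first exact: c_cst.
apply: continuous_fsum => k _.
case: (boolP (tri T i j k)) => h /=; last first.
  by under eq_fun do rewrite mul0r; exact: c_cst.
have [a01 b01 c01] := tri_cos_itv hPhi h.
apply: continuous_fmul; first exact: c_cst.
apply: continuous_fmul; first by continuity.
apply: continuous_finv; last by rewrite /circ_len2 /circ_disc; continuity.
move=> u; case/andP: (c01) => c0 _.
rewrite mulf_neq0 // gt_eqF //; first by rewrite circ_len2_gt0 ?expR_gt0.
by rewrite sqrtr_gt0 circ_disc_gt0 ?expR_gt0.
Qed.

Definition total_curv : R := 2 * pi * (euler T)%:~R.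

Lemma total_curv_le0 : total_curv <= 0.
Proof. by rewrite /total_curv mulr_ge0_le0 ?mulr_ge0 ?pi_ge0 // lerz0. Qed.

(** The squared norm of [r], in the coordinates [u]. *)
Definition area u : R := \sum_k expR (u 0 k).
Definition area_share u i := expR (u 0 i) / area u.

Lemma area_gt0 u : 0 < area u.
Proof.
rewrite /area (bigD1 (Ordinal (vertex_gt0 T))) //= ltr_pwDl ?expR_gt0 //.
by apply: sumr_ge0 => k _; exact: expR_ge0.
Qed.

Lemma area_share_gt0 u i : 0 < area_share u i.
Proof. by rewrite divr_gt0 ?expR_gt0 ?area_gt0. Qed.

Lemma sum_area_share u : \sum_i area_share u i = 1.
Proof. by rewrite /area_share -mulr_suml mulfV // gt_eqF // area_gt0. Qed.

(* The paper's [varphi_i]; [gap_weight u i j] is minus the off-diagonal part of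
   its Jacobian in the coordinates [u]. *)
Definition curv_gap u i := curv u i - total_curv * area_share u i.
Definition gap_weight u i j :=
  curv_weight u i j - total_curv * (area_share u i * area_share u j).

Lemma sum_curv_gap u : \sum_i curv_gap u i = 0.
Proof.
rewrite sumrB -mulr_sumr sum_area_share mulr1 gauss_bonnet ?subrr //.
exact: metric_r_of_u.
Qed.

Lemma curv_gapE u i : curv_gap u i =
  gauss_curv T Phi (r_of_u u) i - Rav T (r_of_u u) * (r_of_u u) 0 i ^+ 2.
Proof.
rewrite /Rav; under eq_bigr do rewrite r_of_u_sq.
rewrite r_of_u_sq /curv_gap /total_curv /area_share /curv; congr (_ - _).
by rewrite [RHS]mulrAC mulrA.
Qed.

Lemma is_derive_coord u v i (s : R) : is_derive s 1 (fun s => (u + s *: v) 0 i) (v 0 i).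
Proof.
rewrite (_ : (fun s => _) = (cst (u 0 i)) + (fun s => s * v 0 i)); last first.
  by apply/funext => y; rewrite !fctE !mxE.
have H := is_deriveD (is_derive_cst (u 0 i) s 1)
   (is_deriveM (is_derive_id s (1 : R)) (is_derive_cst (v 0 i) s 1)).
by apply: is_derive_eq (H) _; rewrite /GRing.scale /= add0r mulr0 add0r mulr1.
Qed.

(** The derivative of the softmax function; since the shares add up to 1 it takes the form of a
    Laplacian on the complete graph. *)
Lemma area_share_derive u v i (s : R) : is_derive s 1 (fun s => area_share (u + s *: v) i)
  (area_share (u + s *: v) i * \sum_j area_share (u + s *: v) j * (v 0 i - v 0 j)).
Proof.
have dE k := is_derive1_comp (is_derive_expR _) (is_derive_coord u v k s).
have dA : is_derive s 1 (fun s => area (u + s *: v)) (\sum_k expR ((u + s *: v) 0 k) * v 0 k).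
  rewrite (_ : (fun s => _) = \sum_k (expR \o (fun s => (u + s *: v) 0 k))); last first.
    by apply/funext => y; rewrite fct_sumE.
  by apply: is_derive_sum => k; exact: dE.
have n0 : area (u + s *: v) != 0 by rewrite gt_eqF // area_gt0.
have dI : is_derive s 1 (fun s => (area (u + s *: v))^-1)
   (- (area (u + s *: v)) ^- 2 * \sum_k expR ((u + s *: v) 0 k) * v 0 k).
  by case: dA => dA dAE; apply: DeriveDef; [exact: derivableV|rewrite deriveV // dAE].
have H := is_deriveM (dE i) dI.
apply: is_derive_eq (H) _.
rewrite /GRing.scale /=.
have -> : \sum_j area_share (u + s *: v) j * (v 0 i - v 0 j) = v 0 i -
    (\sum_k expR ((u + s *: v) 0 k) * v 0 k) / area (u + s *: v).
  under eq_bigr do rewrite mulrBr.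
  rewrite sumrB -mulr_suml sum_area_share mul1r; congr (_ - _).
  by rewrite mulr_suml; apply: eq_bigr => k _; rewrite mulrAC.
by rewrite /area_share; field.
Qed.

Lemma curv_gap_derive u v i (s : R) : is_derive s 1 (fun s => curv_gap (u + s *: v) i)
  (\sum_j gap_weight (u + s *: v) i j * (v 0 i - v 0 j)).
Proof.
have H := is_deriveB (curv_derive u v i s)
  (is_deriveM (is_derive_cst total_curv s 1) (area_share_derive u v i s)).
apply: is_derive_eq (H) _; rewrite /GRing.scale /= mulr0 addr0.
rewrite !mulr_sumr -sumrB; apply: eq_bigr => j _; rewrite /gap_weight; ring.
Qed.

Lemma continuous_area_share i : continuous (fun u => area_share u i).
Proof.
have ce k : continuous (fun u => expR (u 0 k)).
  by apply: continuous_fcomp; [exact: continuous_expR|exact: coord_continuous].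
apply: continuous_fmul => //; apply: continuous_finv.
  by move=> u; rewrite gt_eqF // area_gt0.
exact: continuous_fsum.
Qed.

Lemma continuous_curv_gap i : continuous (fun u => curv_gap u i).
Proof.
apply: continuous_fsub; first exact: continuous_curv.
by apply: continuous_fmul; [exact: c_cst|exact: continuous_area_share].
Qed.

Lemma continuous_gap_weight i j : continuous (fun u => gap_weight u i j).
Proof.
apply: continuous_fsub; first exact: continuous_curv_weight.
apply: continuous_fmul; first exact: c_cst.
by apply: continuous_fmul; exact: continuous_area_share.
Qed.

Lemma gap_weightC u i j : gap_weight u i j = gap_weight u j i.
Proof. by rewrite /gap_weight curv_weightC [_ * area_share u j]mulrC. Qed.

Lemma gap_weight_ge u i j : curv_weight u i j <= gap_weight u i j.
Proof.
rewrite /gap_weight -subr_ge0 addrAC subrr add0r oppr_ge0 mulr_le0_ge0 ?total_curv_le0 //.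
by rewrite mulr_ge0 // ltW // area_share_gt0.
Qed.

Lemma gap_weight_ge0 u i j : 0 <= gap_weight u i j.
Proof. exact: le_trans (curv_weight_ge0 u i j) (gap_weight_ge u i j). Qed.

Lemma gap_weight_ker u v :
  \sum_i \sum_j gap_weight u i j * (v 0 i - v 0 j) ^+ 2 = 0 -> const_rV v.
Proof.
move=> S0; apply: (@curv_weight_ker u); apply/eqP; rewrite eq_le; apply/andP; split; last first.
  by apply: sumr_ge0 => i _; apply: sumr_ge0 => j _; rewrite mulr_ge0 ?sqr_ge0 // curv_weight_ge0.
rewrite -[leRHS]S0; apply: ler_sum => i _; apply: ler_sum => j _.
by rewrite ler_wpM2r ?sqr_ge0 // gap_weight_ge.
Qed.

(** If [K_i = c r_i^2] for all [i], summation and Gauss-Bonnet identify [c] with [R_av]. *)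
Lemma constant_Rcurv_gap r : is_metric r ->
  constant_Rcurv T Phi r <-> forall i, curv_gap (u_of_r r) i = 0.
Proof.
move=> r0; set u := u_of_r r; have rE : r = r_of_u u by rewrite r_of_uK.
have RE i : Rcurv T Phi r i = curv u i / expR (u 0 i).
  by rewrite /Rcurv {1 2}rE r_of_u_sq.
have e0 i : expR (u 0 i) != 0 by rewrite gt_eqF // expR_gt0.
have a0 : area u != 0 by rewrite gt_eqF // area_gt0.
split=> [H i|H i j]; last first.
  have E k : Rcurv T Phi r k = total_curv / area u.
    move/eqP: (H k); rewrite subr_eq0 RE => /eqP ->.
    by rewrite /area_share; field; rewrite a0 e0.
  by rewrite !E.
pose c := Rcurv T Phi r i.
have E k : curv u k = c * expR (u 0 k) by rewrite /c (H i k) RE divfK.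
have : total_curv = c * area u.
  rewrite /area mulr_sumr; under eq_bigr do rewrite -E.
  by rewrite gauss_bonnet //; exact: metric_r_of_u.
by rewrite /curv_gap E /area_share => ->; field.
Qed.

End LogCoordinates.

(** * Behaviour along rays *)

Section LevelSets.
Variables (R : realType) (N : nat).
Implicit Types (v : 'rV[R]_N) (y : 'I_N -> R) (I : {set 'I_N}).

Definition lower_set v I := forall i j, i \in I -> j \notin I -> v 0 i < v 0 j.

(* Induction on the number of non-maximal coordinates of [v]: replacing the
   largest value of [v] by the second largest one decreases the pairing. *)
Lemma level_sets_pairing_gt0 v y : \sum_i y i = 0 -> ~ const_rV v ->
  (forall I, I != finset.set0 -> I \proper [set: 'I_N]%SET -> lower_set v I ->
     \sum_(i in I) y i < 0) ->
  0 < \sum_i y i * v 0 i.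
Proof.
move=> y0; pose top (w : 'rV[R]_N) : {set 'I_N} := [set i | [forall j, w 0 j <= w 0 i]]%SET.
have [n] := ubnP #|~: top v|; elim: n v => // n IH v tn nc H.
have [i0 i0nt] : exists i, i \notin top v.
  apply: contrapT => /forallNP allt; apply: nc => i j.
  have tt k : k \in top v by apply: contrapT => /negP; exact: allt.
  have := tt i; have := tt j; rewrite !inE => /forallP /(_ i) a /forallP /(_ j) b.
  by apply/eqP; rewrite eq_le a b.
have [a at_] : exists a, a \in top v.
  pose a := [arg max_(j > i0) v 0 j]%O.
  exists a; rewrite inE; apply/forallP => j; rewrite /a.
  by case: Order.TotalTheory.arg_maxP => // i _; exact.
have topE i : i \in top v -> v 0 i = v 0 a.
  rewrite inE => /forallP /(_ a) h; move: at_; rewrite inE => /forallP /(_ i) h'.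
  by apply/eqP; rewrite eq_le h h'.
have ntopE i : i \notin top v -> v 0 i < v 0 a.
  rewrite inE negb_forall => /existsP [j]; rewrite -ltNge => h.
  by apply: (lt_le_trans h); move: at_; rewrite inE => /forallP.
pose b := [arg max_(j > i0 | j \notin top v) v 0 j]%O.
have [bnt bmax] : b \notin top v /\ forall j, j \notin top v -> v 0 j <= v 0 b.
  by rewrite /b; case: Order.TotalTheory.arg_maxP.
have ba := ntopE b bnt.
have bot : \sum_(i in ~: top v) y i < 0.
  apply: H.
  - by apply/set0Pn; exists i0; rewrite inE.
  - rewrite properE finset.subsetT /=; apply/subsetPn; exists a; first by rewrite inE.
    by rewrite finset.in_setC negbK.
  - move=> i j; rewrite !finset.in_setC negbK => /ntopE ia jt.
    by rewrite (topE j).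
have topy : 0 < \sum_(i in top v) y i.
  have : \sum_(i in top v) y i + \sum_(i in ~: top v) y i = 0.
    rewrite -[RHS]y0 [RHS](bigID (mem (top v))) /=; congr (_ + _).
    by apply: eq_bigl => i; rewrite inE.
  lra.
pose w : 'rV[R]_N := \row_i (if i \in top v then v 0 b else v 0 i).
have vw : \sum_i y i * v 0 i = (v 0 a - v 0 b) * (\sum_(i in top v) y i) + \sum_i y i * w 0 i.
  rewrite [\sum_(i in top v) _]big_mkcond mulr_sumr -big_split; apply: eq_bigr => i _ /=.
  rewrite /w mxE; case: ifP => it; last by rewrite mulr0 add0r.
  by rewrite (topE i it); ring.
have gap : 0 < (v 0 a - v 0 b) * (\sum_(i in top v) y i) by rewrite mulr_gt0 ?subr_gt0.
rewrite vw ltr_pwDl //.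
have wmax j : w 0 j <= v 0 b.
  by rewrite mxE; case: ifPn => // /bmax.
have wb : w 0 b = v 0 b by rewrite mxE (negbTE bnt).
have topw : (b |: top v \subset top w)%SET.
  apply/fintype.subsetP => i; rewrite !inE => ib; apply/forallP => j.
  suff -> : w 0 i = v 0 b by exact: wmax.
  case/orP: ib => [/eqP ->//|it]; by rewrite mxE inE it.
have [cw|ncw] := pselect (const_rV w).
  rewrite (eq_bigr (fun i => y i * v 0 b)); last by move=> i _; rewrite (cw i b) wb.
  by rewrite -mulr_suml y0 mul0r.
apply: ltW; apply: IH => //.
  rewrite ltnS in tn; apply: leq_trans tn.
  rewrite proper_card // properC; apply: proper_sub_trans topw.
  by rewrite properE finset.subsetUr /=; apply/subsetPn; exists b; [exact: finset.setU11|exact: bnt].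
(* On [top v] the vector [w] attains its maximum, so a proper lower set of [w] misses [top v] and is
   a lower set of [v] as well. *)
move=> I I0 I1 low; apply: H => // i j iI jI.
have := low i j iI jI; rewrite !mxE.
have bI : (top v :&: I)%SET = finset.set0.
  apply/eqP; rewrite -finset.subset0; apply/fintype.subsetP => k; rewrite finset.in_setI => /andP[kt kI].
  have := low k j kI jI; rewrite !mxE kt; case: ifPn => [_|jt]; first by rewrite ltxx.
  by rewrite ltNge bmax.
have it : i \notin top v.
  by apply/negP => it; have : i \in (top v :&: I)%SET; [rewrite finset.in_setI it iI|rewrite bI inE].
rewrite (negbTE it); case: ifPn => // jt _.
by rewrite (topE j jt); exact: ntopE.
Qed.

End LevelSets.

Section RayLimits.
Variables (R : realType) (N : nat) (T : triangulated_surface N) (Phi : {set 'I_N} -> R).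
Hypothesis hPhi : is_weight T Phi.
Hypothesis hchi : euler T <= 0.
Implicit Types (i j k : 'I_N) (I : {set 'I_N}) (u v r : 'rV[R]_N).

(** With [c = 2] this compares radii along a ray, with [c = 1] their squares. *)
Lemma exp_ray_ratio (a b d c : R) : a < b -> 0 < d -> 0 < c ->
  \forall s \near +oo, expR (s * a / c) <= d * expR (s * b / c).
Proof.
move=> ab d0 c0.
exists (- ln d * c / (b - a)); split; first exact: num_real.
move=> s hs; rewrite -{1}(lnK d0) -expRD ler_expR.
have : - ln d * c < s * (b - a) by rewrite -ltr_pdivrMr ?subr_gt0.
move=> h; rewrite -lerBlDr -mulrBl ler_pdivrMr // ltW //.
lra.
Qed.

Let ray v (s : R) := r_of_u (0 + s *: v).

Lemma rayE v s i : ray v s 0 i = expR (s * v 0 i / 2).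
Proof. by rewrite !mxE add0r. Qed.

Lemma angle_large_limit v i j k : tri T i j k -> v 0 j < v 0 i -> v 0 k < v 0 i ->
  (fun s => vertex_angle Phi (ray v s) i j k) @ +oo --> 0.
Proof.
move=> h ji ki; have [a01 b01 c01] := tri_cos_itv hPhi h.
have pi0 := @pi_gt0 R.
apply/cvgr0Pnorm_le => e e0.
(* The cosine comparison needs [e' <= pi]. Below, [d] is taken so that [4 * d] is half of the margin
   [1 - cos e']. *)
pose e' := Num.min e 1.
have e'0 : 0 < e' by rewrite lt_min e0 ltr01.
have e'1 : e' <= pi.
  have := pi_ge2 R; have : e' <= 1 by rewrite ge_min lexx orbT.
  lra.
have ce : cos e' < 1.
  rewrite -cos0 ltr_cos ?in_itv /= ?lexx ?pi_ge0 //.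
  by rewrite ltW.
pose d := (1 - cos e') / 8.
have d0 : 0 < d by rewrite divr_gt0 ?subr_gt0.
have cm := cos_geN1 e'.
have d01 : 0 < d <= 1 by rewrite d0 /d; lra.
have R1 := exp_ray_ratio ji d0 (ltr0n R 2).
have R2 := exp_ray_ratio ki d0 (ltr0n R 2).
near=> s.
have r0 : is_metric (ray v s) by exact: metric_r_of_u.
have /andP[t0 _] := vertex_angle_itv hPhi r0 h.
rewrite gtr0_norm //; apply: (@le_trans _ _ e'); last by rewrite ge_min lexx.
apply: ltW; apply: (@circ_angle_large_vertex R _ _ _ _ _ _ (r0 i) (r0 j) (r0 k) a01 b01 c01 e' _ d d01).
- by rewrite e'0.
- by rewrite /d; lra.
- by rewrite !rayE; near: s.
- by rewrite !rayE; near: s.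
Unshelve. all: end_near. Qed.

Lemma angle_small_limit v i j k : tri T i j k -> v 0 i < v 0 j -> v 0 i < v 0 k ->
  (fun s => pi - Phi [set j; k]%SET - vertex_angle Phi (ray v s) i j k) @ +oo --> 0.
Proof.
move=> h ij ik; have [a01 b01 c01] := tri_cos_itv hPhi h.
have pi0 := @pi_gt0 R.
have P01 : 0 <= Phi [set j; k]%SET <= pi / 2.
  by apply: hPhi; apply: (@tri_edge _ _ _ _ i); rewrite tri_swap23 tri_swap12.
have /andP[P0 P1] := P01.
apply/cvgr0Pnorm_le => e e0.
pose e' := Num.min e 1.
have e'0 : 0 < e' by rewrite lt_min e0 ltr01.
have e'1 : e' <= pi / 2.
  have := pi_ge2 R; have : e' <= 1 by rewrite ge_min lexx orbT.
  lra.
set C := cos (pi - Phi [set j; k]%SET - e').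
have Ca : 0 < C + cos (Phi [set j; k]%SET).
  rewrite -[cos (Phi _)]opprK subr_gt0 -cosN -cosDpi addrC ltr_cos ?in_itv /=; first by lra.
  - by apply/andP; split; lra.
  - by apply/andP; split; lra.
(* The estimate needs [d <= 1] and [6 * d] below the margin; 12 leaves half of it. *)
pose d := Num.min 1 ((C + cos (Phi [set j; k]%SET)) / 12).
have d0 : 0 < d by rewrite lt_min ltr01 divr_gt0.
have d01 : 0 < d <= 1 by rewrite d0 ge_min lexx.
have d6 : 6 * d < C + cos (Phi [set j; k]%SET).
  have : d <= (C + cos (Phi [set j; k]%SET)) / 12 by rewrite ge_min lexx orbT.
  by lra.
have R1 := exp_ray_ratio ij d0 (ltr0n R 2).
have R2 := exp_ray_ratio ik d0 (ltr0n R 2).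
near=> s.
have r0 : is_metric (ray v s) by exact: metric_r_of_u.
have /andP[_ t0] := vertex_angle_itv hPhi r0 h.
rewrite gtr0_norm ?subr_gt0 //; apply: (@le_trans _ _ e'); last by rewrite ge_min lexx.
rewrite lerBlDr -lerBlDl.
apply: ltW; apply: (@circ_angle_small_vertex R _ _ _ _ _ _ (r0 i) (r0 j) (r0 k) a01 b01 c01 (Phi [set j; k]%SET) e' P01 erefl _ d d01 d6).
- by rewrite e'0.
- by rewrite !rayE; near: s.
- by rewrite !rayE; near: s.
Unshelve. all: end_near. Qed.

(** Along the ray, radii outside [I] dominate those inside. In a face with one vertex outside, the
    angle there tends to 0; in a face with one vertex inside, the angle there tends to [pi - Phi].
    So both remainders of [gauss_curv_sum] vanish in the limit. *)
Lemma curv_ray_limit v I : lower_set v I ->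
  (fun s => \sum_(i in I) curv T Phi (0 + s *: v) i) @ +oo --> link_bound T Phi I.
Proof.
move=> low.
rewrite (_ : (fun s => _) = (fun s => link_bound T Phi I
   + 2^-1 * (\sum_i \sum_j \sum_k (tri T i j k)%:R * ((i \in I)%:R * (j \in I)%:R * (1 - (k \in I)%:R) * vertex_angle Phi (ray v s) k i j))
   + 2^-1 * (\sum_i \sum_j \sum_k (tri T i j k)%:R * ((i \in I)%:R * (1 - (j \in I)%:R) * (1 - (k \in I)%:R)
               * (pi - Phi [set j; k]%SET - vertex_angle Phi (ray v s) i j k))))); last first.
  apply/funext => s; exact: (gauss_curv_sum hPhi I (metric_r_of_u (0 + s *: v))).
rewrite -[X in _ --> X]addr0; apply: cvgD; last first.
  rewrite -[X in _ --> X](mulr0 2^-1); apply: cvgM; first exact: cvg_cst.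
  rewrite [X in _ --> X](_ : 0 = \sum_(i < N) \sum_(j < N) \sum_(k < N) (0 : R)); last first.
    by rewrite big1 // => i _; rewrite big1 // => j _; rewrite big1.
  apply: cvg_sumr => i _; apply: cvg_sumr => j _; apply: cvg_sumr => k _.
  case: (boolP (tri T i j k)) => h; last by under eq_fun do rewrite mul0r; exact: cvg_cst.
  rewrite -[X in _ --> X](mulr0 true%:R); apply: cvgM; first exact: cvg_cst.
  case: (boolP (i \in I)) => iI; last by under eq_fun do rewrite !mul0r; exact: cvg_cst.
  case: (boolP (j \in I)) => jI; first by under eq_fun do rewrite subrr mulr0 !mul0r; exact: cvg_cst.
  case: (boolP (k \in I)) => kI; first by under eq_fun do rewrite subrr mulr0 !mul0r; exact: cvg_cst.
  rewrite -[X in _ --> X](mulr0 (true%:R * (1 - false%:R) * (1 - false%:R))); apply: cvgM; first exact: cvg_cst.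
  by apply: angle_small_limit => //; exact: low.
rewrite -[X in _ --> X]addr0; apply: cvgD; first exact: cvg_cst.
rewrite -[X in _ --> X](mulr0 2^-1); apply: cvgM; first exact: cvg_cst.
rewrite [X in _ --> X](_ : 0 = \sum_(i < N) \sum_(j < N) \sum_(k < N) (0 : R)); last first.
  by rewrite big1 // => i _; rewrite big1 // => j _; rewrite big1.
apply: cvg_sumr => i _; apply: cvg_sumr => j _; apply: cvg_sumr => k _.
case: (boolP (tri T i j k)) => h; last by under eq_fun do rewrite mul0r; exact: cvg_cst.
rewrite -[X in _ --> X](mulr0 true%:R); apply: cvgM; first exact: cvg_cst.
case: (boolP (i \in I)) => iI; last by under eq_fun do rewrite !mul0r; exact: cvg_cst.
case: (boolP (j \in I)) => jI; last by under eq_fun do rewrite mulr0 !mul0r; exact: cvg_cst.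
case: (boolP (k \in I)) => kI; first by under eq_fun do rewrite subrr mulr0 !mul0r; exact: cvg_cst.
rewrite -[X in _ --> X](mulr0 (true%:R * true%:R * (1 - false%:R))); apply: cvgM; first exact: cvg_cst.
apply: angle_large_limit; [|exact: low|exact: low].
by rewrite tri_swap12 tri_swap23.
Qed.

Lemma area_share_ray_limit v i j : v 0 i < v 0 j ->
  (fun s => area_share (0 + s *: v) i) @ +oo --> 0.
Proof.
move=> ij; apply/cvgr0Pnorm_le => e e0.
have R1 := exp_ray_ratio ij e0 ltr01.
near=> s.
rewrite gtr0_norm ?area_share_gt0 // /area_share ler_pdivrMr ?(area_gt0 T) //.
have : expR (s * v 0 i / 1) <= e * expR (s * v 0 j / 1) by near: s.
rewrite !divr1 => h.
rewrite !mxE add0r; apply: (le_trans h); rewrite ler_wpM2l ?(ltW e0) //.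
rewrite /area (bigD1 j) //= !mxE add0r lerDl.
by apply: sumr_ge0 => k _; exact: expR_ge0.
Unshelve. all: end_near. Qed.

Lemma curv_gap_ray_lt0 v I : lower_set v I -> I \proper [set: 'I_N]%SET ->
  link_bound T Phi I < 0 ->
  \forall s \near +oo, \sum_(i in I) curv_gap T Phi (0 + s *: v) i < 0.
Proof.
move=> low /properP [_ [j _ jI]] lb.
have L : (fun s => \sum_(i in I) curv_gap T Phi (0 + s *: v) i) @ +oo --> link_bound T Phi I.
  rewrite (_ : (fun s => _) = (fun s => \sum_(i in I) curv T Phi (0 + s *: v) i -
     total_curv R T * \sum_(i in I) area_share (0 + s *: v) i)); last first.
    by apply/funext => s; rewrite mulr_sumr -sumrB.
  rewrite -[X in _ --> X]subr0; apply: cvgB; first exact: curv_ray_limit.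
  rewrite -[X in _ --> X](mulr0 (total_curv R T)); apply: cvgM; first exact: cvg_cst.
  rewrite [X in _ --> X](_ : 0 = \sum_(i in I) (0 : R)); last by rewrite big1.
  by apply: cvg_sumr => i iI; apply: (@area_share_ray_limit _ _ j); exact: low.
exact: (cvgr_lt _ L).
Qed.

Lemma link_bound_ray_derivative v :
  (forall I, I != finset.set0 -> I \proper [set: 'I_N]%SET -> link_bound T Phi I < 0) ->
  ~ const_rV v ->
  exists2 s : R, 0 < s & 0 < \sum_i curv_gap T Phi (0 + s *: v) i * v 0 i.
Proof.
move=> lb nc.
have H : \forall s \near +oo, forall I, I != finset.set0 -> I \proper [set: 'I_N]%SET ->
    lower_set v I -> \sum_(i in I) curv_gap T Phi (0 + s *: v) i < 0.
  apply: filter_forall => I.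
  have [[I0 [I1 low]]|n] := pselect (I != finset.set0 /\ I \proper [set: 'I_N]%SET /\ lower_set v I).
    by apply: filterS (curv_gap_ray_lt0 low I1 (lb I I0 I1)) => s.
  by apply: nearW => s I0 I1 low; exfalso; apply: n.
have [s [s0 Hs]] := @filter_ex _ _ _ _ (filterI (nbhs_pinfty_gt (num_real (0 : R))) H).
exists s => //; apply: level_sets_pairing_gt0 => //; exact: sum_curv_gap.
Qed.

End RayLimits.

(** * The three flows *)

Section Flows.
Variables (R : realType) (N : nat) (T : triangulated_surface N) (Phi : {set 'I_N} -> R).
Hypothesis hPhi : is_weight T Phi.
Hypothesis hchi : euler T <= 0.
Implicit Types (i j k : 'I_N) (I : {set 'I_N}) (u v r : 'rV[R]_N).

Let phi := curv_gap T Phi.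
Let A := gap_weight T Phi.
Let B := curv_weight T Phi.

Lemma curv_gap_zero_exists :
  (forall I, I != finset.set0 -> I \proper [set: 'I_N]%SET -> link_bound T Phi I < 0) ->
  exists u, forall i, phi u i = 0.
Proof.
move=> lb.
have [G dG] := primitive_exists (curv_gap_derive hPhi)
  (fun i j => continuous_gap_weight hPhi (i := i) (j := j)) (gap_weightC T Phi).
apply: (G_critical_exists (Ordinal (vertex_gt0 T)) (curv_gap_derive hPhi)
  (fun i => continuous_curv_gap hPhi (i := i)) (gap_weightC T Phi)
  (gap_weight_ge0 hPhi hchi) (sum_curv_gap hPhi) dG (b := 0)) => v nc.
exact: link_bound_ray_derivative.
Qed.

Lemma constant_Rcurv_unique r r' : is_metric r -> is_metric r' ->
  constant_Rcurv T Phi r -> constant_Rcurv T Phi r' ->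
  exists2 a : R, 0 < a & r' = a *: r.
Proof.
move=> r0 r0' /(constant_Rcurv_gap hPhi r0) z /(constant_Rcurv_gap hPhi r0') z'.
have c := phi_zero_unique (curv_gap_derive hPhi) (gap_weightC T Phi)
  (gap_weight_ge0 hPhi hchi) (fun u v => gap_weight_ker hPhi hchi (u := u) (v := v)) z z'.
pose i0 := Ordinal (vertex_gt0 T).
exists (r' 0 i0 / r 0 i0); first by rewrite divr_gt0.
apply/rowP => i; rewrite mxE.
have h : ln (r' 0 i) - ln (r 0 i) = ln (r' 0 i0) - ln (r 0 i0).
  by have := c i i0; rewrite !mxE; lra.
suff : r' 0 i / r 0 i = r' 0 i0 / r 0 i0.
  by move=> <-; rewrite divfK // gt_eqF.
apply: ln_inj; rewrite ?posrE ?divr_gt0 //.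
by rewrite !lnM ?posrE ?invr_gt0 // !lnV ?posrE.
Qed.

Section GradientLikeFlow.
(* [h] is both the coordinate change from [u] to the flow's own coordinate [c]
   and the function whose sum over the vertices the flow conserves: [expR] for
   the Ricci and Calabi flows, the identity for the modified Calabi flow. *)
Variables (h h1 : R -> R) (V : 'rV[R]_N -> 'rV[R]_N) (c X : 'rV[R]_N -> 'rV[R]_N).
Hypothesis dh : forall x : R, is_derive x 1 h (h1 x).
Hypothesis ch1 : continuous h1.
Hypothesis h1_gt0 : forall x, 0 < h1 x.
Hypothesis cV : continuous V.
Hypothesis V_dissipates : forall u, \sum_i phi u i * V u 0 i <= 0.
Hypothesis V_critical : forall u, \sum_i phi u i * V u 0 i = 0 -> forall i, phi u i = 0.
Hypothesis V_conserves : forall u, \sum_i h1 (u 0 i) * V u 0 i = 0.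
Hypothesis cE : forall u i, c (r_of_u u) 0 i = h (u 0 i).
Hypothesis XE : forall u i, X (r_of_u u) 0 i = h1 (u 0 i) * V u 0 i.

Lemma flow_converges_of_constant r0 : is_metric r0 ->
  (exists2 r, is_metric r & constant_Rcurv T Phi r) -> flow_converges c X r0.
Proof.
move=> m0 [rs ms /(constant_Rcurv_gap hPhi ms) zs].
have h_incr (x y : R) : x < y -> h x < h y.
  move=> xy; have [z _ E] := MVT_seg (fun w _ => dh w) xy.
  by rewrite -subr_gt0 E mulr_gt0 ?subr_gt0.
have [G dG] := primitive_exists (curv_gap_derive hPhi)
  (fun i j => continuous_gap_weight hPhi (i := i) (j := j)) (gap_weightC T Phi).
have [u [u0 du [l ul]]] := gradient_like_flow_converges (Ordinal (vertex_gt0 T))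
  (curv_gap_derive hPhi) (fun i => continuous_curv_gap hPhi (i := i)) (gap_weightC T Phi)
  (gap_weight_ge0 hPhi hchi) (fun u v => gap_weight_ker hPhi hchi (u := u) (v := v))
  (sum_curv_gap hPhi) dG dh h_incr cV V_dissipates V_critical V_conserves (u_of_r r0) zs.
have dc (s : R) i : 0 <= s ->
    is_derive s 1 (fun s => c (r_of_u (u s)) 0 i) (X (r_of_u (u s)) 0 i).
  move=> s0; rewrite XE.
  rewrite (_ : (fun s => _) = h \o (fun s => u s 0 i)); last by apply/funext => w; rewrite cE.
  exact: (is_derive1_comp (dh _) (du s s0 i)).
exists (fun s => r_of_u (u s)); split; first by rewrite u0 r_of_uK.
  split=> [s _|s i s0|i]; first exact: metric_r_of_u.
    by apply: dc; exact: ltW.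
  (* The constructed solution has a two-sided derivative at 0, which contains the required right
     derivative. *)
  have [d dE] := dc 0 i (lexx 0).
  rewrite -dE; apply: cvg_dnbhs_at_right.
  rewrite (_ : (fun q => _) = (fun q : R => q^-1 *: (c (r_of_u (u (q *: (1 : R) + 0))) 0 i - c (r_of_u (u 0)) 0 i))).
    exact: d.
  by apply/funext => q; rewrite scaler1 addr0.
exists (r_of_u l); first exact: metric_r_of_u.
apply: cvg_rVP => i; rewrite mxE.
under eq_fun do rewrite mxE.
have cexp : {for l 0 i, continuous (fun w : R => expR (w / 2))}.
  apply: (@continuous_fcomp R R (@expR R) (fun w => w / 2)); first exact: continuous_expR.
  by apply: continuous_fmul; [move=> w; exact: cvg_id|move=> w; exact: cst_continuous].
apply: (@continuous_cvg _ _ _ _ _ (fun s => u s 0 i) (fun w : R => expR (w / 2)) _ cexp).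
exact: cvg_coord.
Qed.

(** The coordinate [c] and its velocity both converge along the solution, so the velocity tends to
    0. As [h1 > 0], the field [V] vanishes at the limit, and so does the dissipation. *)
Lemma constant_of_flow_converges r0 : flow_converges c X r0 ->
  exists2 r, is_metric r & constant_Rcurv T Phi r.
Proof.
move=> [r [_ [mr dr _] [l ml rl]]].
exists l => //; apply/(constant_Rcurv_gap hPhi ml); apply: V_critical.
set ul := u_of_r l.
have uul : (fun s => u_of_r (r s)) @ +oo --> ul.
  apply: cvg_rVP => i; rewrite mxE; under eq_fun do rewrite mxE.
  apply: cvgM; first exact: cvg_cst.
  apply: (@continuous_cvg _ _ _ _ _ (fun s => r s 0 i) (@ln R) (l 0 i)); first exact: continuous_ln.
  exact: cvg_coord.
have near_u (f g : 'rV[R]_N -> R) (L : R) : (forall u, f (r_of_u u) = g u) -> 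
    (fun s => g (u_of_r (r s))) @ +oo --> L -> (fun s => f (r s)) @ +oo --> L.
  move=> fg; apply: cvg_trans; apply: near_eq_cvg.
  exists 0; split; first exact: num_real.
  by move=> s s0; rewrite -fg r_of_uK //; apply: mr; exact: ltW.
suff Vz i : V ul 0 i = 0 by rewrite big1 // => i _; rewrite Vz mulr0.
have hX : (fun s => X (r s) 0 i) @ +oo --> h1 (ul 0 i) * V ul 0 i.
  apply: (near_u (fun r => X r 0 i) (fun u => h1 (u 0 i) * V u 0 i)) => //.
  apply: cvgM.
    apply: (@continuous_cvg _ _ _ _ _ (fun s => u_of_r (r s) 0 i) h1 (ul 0 i)); first exact: ch1.
    exact: cvg_coord.
  apply: (@cvg_coord _ _ _ _ _ (fun s => V (u_of_r (r s))) (V ul)).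
  by apply: (@continuous_cvg _ _ _ _ _ (fun s => u_of_r (r s)) V ul) => //; exact: cV.
have hc : (fun s => c (r s) 0 i) @ +oo --> h (ul 0 i).
  apply: (near_u (fun r => c r 0 i) (fun u => h (u 0 i))) => //.
  apply: (@continuous_cvg _ _ _ _ _ (fun s => u_of_r (r s) 0 i) h (ul 0 i)).
    exact: is_derive1_continuous (dh _).
  exact: cvg_coord.
have /eqP := derive_lim_eq0 (fun s s0 => dr s i s0) hX hc.
by rewrite mulf_eq0 gt_eqF //= => /eqP.
Qed.

End GradientLikeFlow.

(** Here [phi] is a multiple of a positive vector, and its coordinates sum to 0. *)
Lemma curv_gap_const_eq0 u : (forall i j, phi u i / expR (u 0 i) = phi u j / expR (u 0 j)) ->
  forall i, phi u i = 0.
Proof.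
move=> H i; have e0 j : expR (u 0 j) != 0 by rewrite gt_eqF // expR_gt0.
have E j : phi u j = phi u i / expR (u 0 i) * expR (u 0 j) by rewrite (H i j) divfK.
have := sum_curv_gap hPhi u; rewrite -/phi; under eq_bigr do rewrite E.
rewrite -mulr_sumr => /eqP; rewrite mulf_eq0 [X in _ || X]gt_eqF ?orbF; last exact: (area_gt0 T).
by rewrite mulf_eq0 invr_eq0 (negbTE (e0 i)) orbF => /eqP.
Qed.

Lemma sum_antisym (C : 'I_N -> 'I_N -> R) (f : 'I_N -> R) :
  (forall i j, C i j = C j i) -> \sum_i \sum_j C i j * (f i - f j) = 0.
Proof.
move=> sC; set S := LHS.
have : S = - S.
  rewrite {2}/S exchange_big /= -sumrN; apply: eq_bigr => i _.
  by rewrite -sumrN; apply: eq_bigr => j _; rewrite sC; ring.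
lra.
Qed.

(** The fields are the velocities of [u]; for the first two, [g' = g u'] with [g = exp u]. They are
    written through [phi / exp u = R - R_av], whose differences are those of [R]. *)
Definition ricci_field u : 'rV[R]_N := \row_i (- (phi u i / expR (u 0 i))).
Definition calabi_field u : 'rV[R]_N :=
  \row_i (- ((\sum_j B u i j * (phi u i / expR (u 0 i) - phi u j / expR (u 0 j))) / expR (u 0 i))).
Definition modified_calabi_field u : 'rV[R]_N :=
  \row_i (- \sum_j A u i j * (phi u i - phi u j)).

Lemma RcurvE u i : Rcurv T Phi (r_of_u u) i = phi u i / expR (u 0 i) + Rav T (r_of_u u).
Proof.
rewrite /Rcurv r_of_u_sq /phi curv_gapE r_of_u_sq; field.
by rewrite gt_eqF // expR_gt0.
Qed.

Lemma ricci_velocityE u i :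
  ricci_velocity T Phi (r_of_u u) 0 i = expR (u 0 i) * ricci_field u 0 i.
Proof.
rewrite !mxE -expRM_natl.
have -> : 2 * (u 0 i / 2) = u 0 i by rewrite mulrC divfK.
by rewrite RcurvE; ring.
Qed.

Lemma partial_curv u i j : i != j ->
  partial (fun u => gauss_curv T Phi (r_of_u u) i) j u = - B u i j.
Proof.
move=> ij; rewrite /partial.
have d := curv_derive hPhi u (delta_mx 0 j) i 0.
rewrite (line_partial d) scale0r addr0 (bigD1 j) //= big1 ?addr0.
  by rewrite !mxE !eqxx (negbTE ij) /= sub0r mulrN1.
by move=> k kj; rewrite !mxE !eqxx (negbTE ij) (negbTE kj) subrr mulr0.
Qed.

Lemma calabi_velocityE u i :
  calabi_velocity T Phi (r_of_u u) 0 i = expR (u 0 i) * calabi_field u 0 i.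
Proof.
have e0 : expR (u 0 i) != 0 by rewrite gt_eqF // expR_gt0.
rewrite !mxE -expRM_natl /laplacian r_of_u_sq.
have -> : 2 * (u 0 i / 2) = u 0 i by rewrite mulrC divfK.
have -> : \sum_(j < N | [set i; j]%SET \in edges T)
    - partial (fun u => gauss_curv T Phi (r_of_u u) i) j (u_of_r (r_of_u u)) *
    (Rcurv T Phi (r_of_u u) j - Rcurv T Phi (r_of_u u) i) =
  - \sum_j B u i j * (phi u i / expR (u 0 i) - phi u j / expR (u 0 j)).
  rewrite big_mkcond -sumrN; apply: eq_bigr => j _.
  case: ifPn => e; last by rewrite /B curv_weight_nonedge // mul0r oppr0.
  by rewrite u_of_rK partial_curv ?(edge_neq e) // opprK !RcurvE; ring.
by field.
Qed.

Lemma modified_calabi_velocityE u i :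
  modified_calabi_velocity T Phi (r_of_u u) 0 i = modified_calabi_field u 0 i.
Proof.
rewrite !mxE u_of_rK /partial.
have CE w : Ctilde T Phi w = \sum_j phi w j * phi w j.
  by apply: eq_bigr => j _; rewrite -curv_gapE expr2.
pose v : 'rV[R]_N := delta_mx 0 i.
have d : is_derive (0 : R) 1 (fun s => Ctilde T Phi (u + s *: v))
    (\sum_j 2 * (phi u j * \sum_k A u j k * (v 0 j - v 0 k))).
  rewrite (_ : (fun s => _) = \sum_j (fun s => phi (u + s *: v) j * phi (u + s *: v) j)); last first.
    by apply/funext => s; rewrite fct_sumE CE.
  apply: is_derive_sum => j.
  have dp := curv_gap_derive hPhi u v j 0.
  have H := is_deriveM dp dp.
  apply: is_derive_eq (H) _.
  by rewrite scale0r addr0 /GRing.scale /= /phi /A; ring.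
rewrite (line_partial d) -mulr_sumr.
(* Self-adjointness of the graph Laplacian of [A], moved from the unit vector [v] to [phi]. *)
have -> : \sum_j phi u j * \sum_k A u j k * (v 0 j - v 0 k) = \sum_j A u i j * (phi u i - phi u j).
  pose D := \sum_j \sum_k A u j k * (phi u j * v 0 j).
  transitivity (D - \sum_j \sum_k A u j k * (phi u j * v 0 k)).
    rewrite /D -sumrB; apply: eq_bigr => j _; rewrite mulr_sumr -sumrB.
    by apply: eq_bigr => k _; ring.
  rewrite [X in _ - X]exchange_big /= /D -sumrB (bigD1 i) //= [X in _ + X]big1 ?addr0; last first.
    move=> j ji; rewrite -sumrB big1 // => k _.
    by rewrite /v !mxE eqxx (negbTE ji) /= !mulr0 subrr.
  rewrite -sumrB; apply: eq_bigr => j _.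
  rewrite /v !mxE !eqxx /= !mulr1 /A (gap_weightC T Phi u j i).
  ring.
by field.
Qed.

Let dB := dirichlet_ge0 (curv_weightC T Phi) (curv_weight_ge0 hPhi).
Let dA := dirichlet_ge0 (gap_weightC T Phi) (gap_weight_ge0 hPhi hchi).

Let c_phi i : continuous (fun u => phi u i).
Proof. exact: continuous_curv_gap. Qed.

Let c_ratio i : continuous (fun u => phi u i / expR (u 0 i)).
Proof.
apply: continuous_fmul; first exact: c_phi.
apply: continuous_finv; first by move=> u; rewrite gt_eqF // expR_gt0.
by apply: continuous_fcomp; [exact: continuous_expR|exact: coord_continuous].
Qed.

Let c_opp (f : 'rV[R]_N -> R) : continuous f -> continuous (fun u => - f u).
Proof. by move=> cf u; apply: continuousN; exact: cf. Qed.

Lemma ricci_flow_iff r0 : is_metric r0 ->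
  (exists2 r, is_metric r & constant_Rcurv T Phi r) <->
  flow_converges (@g_of_r R N) (ricci_velocity T Phi) r0.
Proof.
move=> m0.
have cV : continuous ricci_field.
  apply: continuous_rVP => i; under eq_fun do rewrite mxE; apply: c_opp; exact: c_ratio.
have E u : \sum_i phi u i * ricci_field u 0 i = - \sum_i phi u i ^+ 2 / expR (u 0 i).
  by rewrite -sumrN; apply: eq_bigr => i _; rewrite mxE expr2; ring.
have ge u i : 0 <= phi u i ^+ 2 / expR (u 0 i).
  by rewrite divr_ge0 ?sqr_ge0 ?expR_ge0.
have diss u : \sum_i phi u i * ricci_field u 0 i <= 0.
  by rewrite E oppr_le0; apply: sumr_ge0 => i _; exact: ge.
have crit u : \sum_i phi u i * ricci_field u 0 i = 0 -> forall i, phi u i = 0.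
  rewrite E => /eqP; rewrite oppr_eq0 => /eqP S0 i.
  have H : forall j, predT j -> phi u j ^+ 2 / expR (u 0 j) = 0.
    by apply: psumr_eq0P => // j _; exact: ge.
  have /eqP := H i isT; rewrite mulf_eq0 invr_eq0 [X in _ || X]gt_eqF ?expR_gt0 // orbF.
  by rewrite expf_eq0 /= => /eqP.
have cons u : \sum_i expR (u 0 i) * ricci_field u 0 i = 0.
  rewrite (eq_bigr (fun i => - phi u i)).
    by rewrite sumrN /phi (sum_curv_gap hPhi) oppr0.
  by move=> i _; rewrite mxE mulrN mulrC divfK // gt_eqF // expR_gt0.
have cE u i : g_of_r (r_of_u u) 0 i = expR (u 0 i) by rewrite mxE r_of_u_sq.
split.
  exact: (flow_converges_of_constant (@is_derive_expR R) (@expR_gt0 R) cV diss crit cons cE ricci_velocityE).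
exact: (constant_of_flow_converges (@is_derive_expR R) (@continuous_expR R) (@expR_gt0 R) cV crit cE ricci_velocityE).
Qed.

Lemma calabi_flow_iff r0 : is_metric r0 ->
  (exists2 r, is_metric r & constant_Rcurv T Phi r) <->
  flow_converges (@g_of_r R N) (calabi_velocity T Phi) r0.
Proof.
move=> m0.
have cV : continuous calabi_field.
  apply: continuous_rVP => i; under eq_fun do rewrite mxE; apply: c_opp.
  apply: continuous_fmul.
    apply: continuous_fsum => j _; apply: continuous_fmul; first exact: continuous_curv_weight.
    by apply: continuous_fsub; exact: c_ratio.
  apply: continuous_finv; first by move=> u; rewrite gt_eqF // expR_gt0.
  by apply: continuous_fcomp; [exact: continuous_expR|exact: coord_continuous].
(* In terms of [psi] the dissipation is minus a Dirichlet form, so it vanishes only if [psi] is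
   constant. *)
pose psi u i := phi u i / expR (u 0 i).
have E u : \sum_i phi u i * calabi_field u 0 i =
   - \sum_i psi u i * \sum_j B u i j * (psi u i - psi u j).
  by rewrite -sumrN; apply: eq_bigr => i _; rewrite mxE /psi; ring.
have diss u : \sum_i phi u i * calabi_field u 0 i <= 0 by rewrite E oppr_le0; exact: dB.
have crit u : \sum_i phi u i * calabi_field u 0 i = 0 -> forall i, phi u i = 0.
  rewrite E => /eqP; rewrite oppr_eq0 => /eqP.
  move/(dirichlet_eq0 (curv_weightC T Phi) (fun u v => curv_weight_ker hPhi (u := u) (v := v))).
  exact: curv_gap_const_eq0.
have cons u : \sum_i expR (u 0 i) * calabi_field u 0 i = 0.
  transitivity (- \sum_i \sum_j B u i j * (psi u i - psi u j)).
    rewrite -sumrN; apply: eq_bigr => i _; rewrite mxE mulrN mulrC divfK //.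
    by rewrite gt_eqF // expR_gt0.
  by rewrite sum_antisym ?oppr0 // => i j; exact: curv_weightC.
have cE u i : g_of_r (r_of_u u) 0 i = expR (u 0 i) by rewrite mxE r_of_u_sq.
split.
  exact: (flow_converges_of_constant (@is_derive_expR R) (@expR_gt0 R) cV diss crit cons cE calabi_velocityE).
exact: (constant_of_flow_converges (@is_derive_expR R) (@continuous_expR R) (@expR_gt0 R) cV crit cE calabi_velocityE).
Qed.

Lemma modified_calabi_flow_iff r0 : is_metric r0 ->
  (exists2 r, is_metric r & constant_Rcurv T Phi r) <->
  flow_converges (@u_of_r R N) (modified_calabi_velocity T Phi) r0.
Proof.
move=> m0.
have cV : continuous modified_calabi_field.
  apply: continuous_rVP => i; under eq_fun do rewrite mxE; apply: c_opp.
  apply: continuous_fsum => j _; apply: continuous_fmul; first exact: continuous_gap_weight.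
  by apply: continuous_fsub; exact: c_phi.
have E u : \sum_i phi u i * modified_calabi_field u 0 i =
   - \sum_i phi u i * \sum_j A u i j * (phi u i - phi u j).
  by rewrite -sumrN; apply: eq_bigr => i _; rewrite mxE mulrN.
have diss u : \sum_i phi u i * modified_calabi_field u 0 i <= 0 by rewrite E oppr_le0; exact: dA.
have crit u : \sum_i phi u i * modified_calabi_field u 0 i = 0 -> forall i, phi u i = 0.
  rewrite E => /eqP; rewrite oppr_eq0 => /eqP.
  move/(dirichlet_eq0 (gap_weightC T Phi) (fun u v => gap_weight_ker hPhi hchi (u := u) (v := v))).
  move=> H i; have := sum_curv_gap hPhi u; rewrite -/phi (eq_bigr (fun=> phi u i)) //.
  rewrite sumr_const card_ord => /eqP; rewrite mulrn_eq0 -leqn0 leqNgt (vertex_gt0 T) /=.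
  by move/eqP.
have cons u : \sum_i (fun=> 1) (u 0 i) * modified_calabi_field u 0 i = 0.
  transitivity (- \sum_i \sum_j A u i j * (phi u i - phi u j)).
    by rewrite -sumrN; apply: eq_bigr => i _; rewrite mxE mul1r.
  by rewrite sum_antisym ?oppr0 // => i j; exact: gap_weightC.
have cE u i : u_of_r (r_of_u u) 0 i = id (u 0 i) by rewrite u_of_rK.
have XE u i : modified_calabi_velocity T Phi (r_of_u u) 0 i = (fun=> 1) (u 0 i) * modified_calabi_field u 0 i.
  by rewrite modified_calabi_velocityE mul1r.
have did (y : R) : is_derive y 1 id ((fun=> 1 : R) y) by exact: is_derive_id.
have c1 : continuous (fun _ : R => 1 : R) by move=> y; exact: cst_continuous.
have p1 (y : R) : 0 < (fun=> 1 : R) y by [].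
split.
  exact: (flow_converges_of_constant did p1 cV diss crit cons cE XE).
exact: (constant_of_flow_converges did c1 p1 cV crit cE XE).
Qed.

(** Since [K_i = R_av r_i^2], the left-hand side is the total curvature over [I]. *)
Lemma constant_Rcurv_link_bound r I : is_metric r -> constant_Rcurv T Phi r ->
  I != finset.set0 -> I \proper [set: 'I_N]%SET ->
  2 * pi * (euler T)%:~R * ((\sum_(i in I) r 0 i ^+ 2) / (\sum_i r 0 i ^+ 2)) > link_bound T Phi I.
Proof.
move=> m0 /(constant_Rcurv_gap hPhi m0) z I0 I1.
apply: (lt_le_trans (link_bound_lt hPhi m0 I0 I1)).
have -> : 2 * pi * (euler T)%:~R * ((\sum_(i in I) r 0 i ^+ 2) / (\sum_i r 0 i ^+ 2)) =
    Rav T r * \sum_(i in I) r 0 i ^+ 2 by rewrite /Rav; ring.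
rewrite mulr_sumr; apply: ler_sum => i _.
have := z i; rewrite curv_gapE r_of_uK // => /eqP; rewrite subr_eq0 => /eqP ->.
exact: lexx.
Qed.

End Flows.

Theorem theorem1p5 (R : realType) (N : nat) (T : triangulated_surface N)
    (Phi : {set 'I_N} -> R) (hPhi : is_weight T Phi) (hchi : euler T <= 0) :
  (forall r r' : 'rV[R]_N, is_metric r -> is_metric r' ->
     constant_Rcurv T Phi r -> constant_Rcurv T Phi r' ->
     exists2 a : R, 0 < a & r' = a *: r)
  /\
  (forall r0 : 'rV[R]_N, is_metric r0 ->
   [<-> (exists2 r : 'rV[R]_N, is_metric r & constant_Rcurv T Phi r);
        flow_converges (@g_of_r R N) (ricci_velocity T Phi) r0;
        flow_converges (@g_of_r R N) (calabi_velocity T Phi) r0;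
        flow_converges (@u_of_r R N) (modified_calabi_velocity T Phi) r0;
        (exists2 r : 'rV[R]_N, is_metric r &
           forall I : {set 'I_N}, I != finset.set0 -> I \proper [set: 'I_N]%SET ->
             2 * pi * (euler T)%:~R
               * ((\sum_(i in I) r 0 i ^+ 2) / (\sum_i r 0 i ^+ 2))
             > link_bound T Phi I);
        (euler T < 0 ->
           exists2 x : 'rV[R]_N, Yset T Phi x & forall i, x 0 i < 0)
        /\ (euler T = 0 -> Yset T Phi 0)]).
Proof.
split=> [r r'|r0 m0]; first exact: constant_Rcurv_unique.
have R1 := ricci_flow_iff hPhi hchi m0.
have R2 := calabi_flow_iff hPhi hchi m0.
have R3 := modified_calabi_flow_iff hPhi hchi m0.
tfae.
- by move/R1.
- by move/R1/R2.
- by move/R2/R3.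
- move/R3 => [r mr cr]; exists r => // I I0 I1.
  exact: constant_Rcurv_link_bound.
- move=> [r mr H].
  have S0 : 0 < \sum_i r 0 i ^+ 2.
    rewrite (bigD1 (Ordinal (vertex_gt0 T))) //= ltr_pwDl ?exprn_gt0 //.
    by apply: sumr_ge0 => i _; exact: sqr_ge0.
  split=> e0.
    (* The total curvature distributed in proportion to [r_i^2]; its sums over [I] are the
       quantities bounded in (5). *)
    exists (\row_i (2 * pi * (euler T)%:~R * (r 0 i ^+ 2 / (\sum_i r 0 i ^+ 2)))); last first.
      move=> i; rewrite mxE pmulr_llt0; last by rewrite divr_gt0 // exprn_gt0.
      by rewrite pmulr_rlt0 ?ltrz0 // mulr_gt0 // pi_gt0.
    split.
      under eq_bigr do rewrite mxE.
      by rewrite -mulr_sumr -mulr_suml mulfV ?mulr1 // gt_eqF.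
    move=> I I0 I1; under eq_bigr do rewrite mxE.
    by rewrite -mulr_sumr -mulr_suml; exact: H.
  split; first by rewrite e0 mulr0 big1 // => i _; rewrite mxE.
  move=> I I0 I1; have := H I I0 I1; rewrite e0 mulr0 mul0r.
  by rewrite big1 // => i _; rewrite mxE.
move=> [Hneg Hzero].
have lb : forall I, I != finset.set0 -> I \proper [set: 'I_N]%SET -> link_bound T Phi I < 0.
  move=> I I0 I1; move: hchi; rewrite le_eqVlt => /predU1P[/Hzero [_ H]|/Hneg [x [_ H] x0]].
    by have := H I I0 I1; rewrite big1 // => i _; rewrite mxE.
  apply: (lt_le_trans (H I I0 I1)).
  by apply: sumr_le0 => i _; exact: ltW.
have [u u0] := curv_gap_zero_exists hPhi hchi lb.
exists (r_of_u u); first exact: metric_r_of_u.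
by apply/(constant_Rcurv_gap hPhi (metric_r_of_u u)) => i; rewrite u_of_rK.
Qed.
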